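(* Let $g\in\mathrm{BMOA}\setminus\mathrm{VMOA}$. Then $V_g\notin\mathcal{E}(\mathcal{T})$.
   Context: $\mathbb{D}$ is the open unit disk, $\mathbb{T}$ the unit circle, $H^2$ the Hardy space of $\mathbb{D}$, $\mathcal{B}(H^2)$ the algebra of bounded operators on $H^2$ and $\mathcal{K}(H^2)$ the compact operators. $\mathrm{BMOA}$ (resp. $\mathrm{VMOA}$) is the space of functions in $H^2$ whose boundary values have bounded (resp. vanishing) mean oscillation on $\mathbb{T}$. For $g$ holomorphic in $\mathbb{D}$, $V_gf(z)=\int_0^z f(u)g'(u)\,du$; it is bounded on $H^2$ iff $g\in\mathrm{BMOA}$. For $b\in L^\infty(\mathbb{T})$, the Toeplitz operator $T_b$ on $H^2$ is $T_bf=P_+(bf)$, where $P_+$ is the orthogonal projection of $L^2(\mathbb{T})$ onto $H^2$. The Toeplitz algebra $\mathcal{T}$ is the norm-closed subalgebra of $\mathcal{B}(H^2)$ generated by all Toeplitz operators $T_b$, $b\in L^\infty(\mathbb{T})$. For $\mathcal{A}\subset\mathcal{B}(H^2)$, the essential commutator is $\mathcal{E}(\mathcal{A})=\{T\in\mathcal{B}(H^2): TX-XT\in\mathcal{K}(H^2)\text{ for every }X\in\mathcal{A}\}$. *)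

(* Defs.v *)
From HB Require Import structures.
From mathcomp Require Import all_boot all_order all_algebra.
From mathcomp Require Import complex.
From mathcomp Require Import all_classical all_reals all_analysis.

Set Implicit Arguments.
Unset Strict Implicit.
Unset Printing Implicit Defensive.

Import Order.TTheory GRing.Theory Num.Theory.
Import numFieldNormedType.Exports.

Local Open Scope classical_set_scope.
Local Open Scope ring_scope.
Local Open Scope complex_scope.

(* A function on the open unit disk, or on the unit circle, is represented by
   a function R[i] -> R[i] of which only the values on the disk, resp. on the
   circle, are ever used.  In particular elements of H^2 are identified when
   they agree on the disk.  The norm `|z| of z : R[i] lies in R[i]; normc z is
   the same number in R. *)

Local Notation normc := ComplexField.Normc.normc.

Section complex_integration.
Context {R : realType}.
Implicit Types u : R[i] -> R[i].

Definition complex_integral (A : set R) (F : R -> R[i]) : R[i] :=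
  (\int[@lebesgue_measure R]_(t in A) complex.Re (F t))%R +i*
  (\int[@lebesgue_measure R]_(t in A) complex.Im (F t))%R.

Definition expi (t : R) : R[i] := cos t +i* sin t.

(* Functions on the circle are measured through the 2pi-periodic function
   t |-> u (expi t). *)
Definition circle_measurable u : Prop :=
  measurable_fun setT (fun t : R => complex.Re (u (expi t))) /\
  measurable_fun setT (fun t : R => complex.Im (u (expi t))).

Definition circle_integral u : R[i] :=
  ((2 * pi)^-1 : R)%:C *
  complex_integral `[0, 2 * pi] (fun t => u (expi t)).

Definition circle_L1 : set (R[i] -> R[i]) := [set u |
  circle_measurable u /\
  (\int[@lebesgue_measure R]_(t in `[0%R, (2 * pi)%R])
     (normc (u (expi t)))%:E < +oo)%E].

Definition circle_Linfty : set (R[i] -> R[i]) := [set u |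
  circle_measurable u /\
  exists M : R, {ae @lebesgue_measure R, forall t, normc (u (expi t)) <= M}].

End complex_integration.

Section hardy.
Context {R : realType}.
Implicit Types f g h u v w : R[i] -> R[i].

Definition disk : set R[i] := [set z | `|z| < 1].

(* Complex differentiability: R[i]^o is a normed module over the field R[i]. *)
Definition holomorphic_on_disk f : Prop :=
  forall z, disk z -> derivable (f : R[i]^o -> R[i]^o) z 1.

Definition cderiv f : R[i] -> R[i] := derive1 (f : R[i] -> R[i]^o).

Definition mean_square f (r : R) : \bar R :=
  (((2 * pi)^-1)%:E *
   \int[@lebesgue_measure R]_(t in `[0%R, (2 * pi)%R])
     ((normc (f (r%:C * expi t))) ^+ 2)%:E)%E.

Definition h2norm f : \bar R :=
  (ereal_sup [set mean_square f r | r in `[0%R, 1%R[] `^ 2^-1)%E.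

Definition H2 : set (R[i] -> R[i]) := [set f |
  holomorphic_on_disk f /\ (h2norm f < +oo)%E].

(* u is a representative of the boundary function of f: its radial limits
   almost everywhere.  By Fatou's theorem every f in H2 has such a u, and it is
   unique up to a null set. *)
Definition boundary_values f u : Prop :=
  circle_measurable u /\
  {ae @lebesgue_measure R, forall t,
    (f (r%:C * expi t) : R[i]^o) @[r --> (1 : R)^'-] --> (u (expi t) : R[i]^o)}.

(* The arc of length d starting at expi a is {expi t | a <= t <= a + d}, with
   0 < d <= 2pi. *)
Definition arc_mean u (a d : R) : R[i] :=
  (d^-1)%:C * complex_integral `[a, a + d] (fun t => u (expi t)).

Definition mean_oscillation u (a d : R) : \bar R :=
  ((d^-1)%:E * \int[@lebesgue_measure R]_(t in `[a, (a + d)%R])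
     (normc (u (expi t) - arc_mean u a d))%:E)%E.

Definition BMO : set (R[i] -> R[i]) := [set u |
  circle_L1 u /\ exists M : R, forall a d : R, 0 < d <= 2 * pi ->
    (mean_oscillation u a d <= M%:E)%E].

Definition VMO : set (R[i] -> R[i]) := [set u |
  BMO u /\ forall e : R, 0 < e -> exists2 eta : R, 0 < eta &
    forall a d : R, 0 < d <= 2 * pi -> d < eta ->
      (mean_oscillation u a d <= e%:E)%E].

Definition BMOA : set (R[i] -> R[i]) := [set f |
  H2 f /\ exists2 u, boundary_values f u & BMO u].

Definition VMOA : set (R[i] -> R[i]) := [set f |
  H2 f /\ exists2 u, boundary_values f u & VMO u].

(* h is the orthogonal projection onto H^2 of the function u of L^2 of the
   circle: h is in H^2 and u - h is orthogonal to H^2. *)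
Definition szego_projection u h : Prop :=
  H2 h /\
  forall w, boundary_values h w ->
  forall f v, H2 f -> boundary_values f v ->
    circle_integral (fun z => (u z - w z) * (v z)^*) = 0.

End hardy.

Section operators.
Context {R : realType}.

Definition operator := (R[i] -> R[i]) -> (R[i] -> R[i]).
Implicit Types S T X : operator.
Implicit Types A : set operator.

Definition opadd S T : operator := fun f z => S f z + T f z.
Definition opsub S T : operator := fun f z => S f z - T f z.
Definition opscale (c : R[i]) T : operator := fun f z => c * T f z.
Definition opcomp S T : operator := fun f => S (T f).

Definition linear_on_H2 T : Prop :=
  forall (c : R[i]) f h, H2 f -> H2 h -> forall z, disk z ->
    T (fun x => c * f x + h x) z = c * T f z + T h z.

Definition opnorm_le T (M : R) : Prop :=
  forall f, H2 f -> (h2norm (T f) <= M%:E * h2norm f)%E.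

(* The algebra B(H^2).  Linearity and boundedness make T f on the disk depend
   only on f on the disk. *)
Definition bounded_operators : set operator := [set T |
  [/\ forall f, H2 f -> H2 (T f),
      linear_on_H2 T &
      exists M : R, opnorm_le T M]].

(* Compactness: the image of a bounded sequence has a norm-convergent
   subsequence. *)
Definition compact_operators : set operator := [set T |
  bounded_operators T /\
  forall f_ : nat -> R[i] -> R[i],
    (forall n, H2 (f_ n)) ->
    (exists M : R, forall n, (h2norm (f_ n) <= M%:E)%E) ->
    exists s : nat -> nat, exists h,
      [/\ {homo s : m n / (m < n)%N}, H2 h &
          h2norm (fun z => T (f_ (s n)) z - h z)%R @[n --> \oo] --> (0 : \bar R)]].

Definition is_toeplitz (b : R[i] -> R[i]) T : Prop :=
  bounded_operators T /\
  forall f u, H2 f -> boundary_values f u ->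
    szego_projection (fun z => b z * u z) (T f).

Definition closed_subalgebra A : Prop :=
  [/\ A `<=` bounded_operators,
      forall S T, A S -> A T -> A (opadd S T),
      forall c T, A T -> A (opscale c T),
      forall S T, A S -> A T -> A (opcomp S T) &
      forall T, bounded_operators T ->
        (forall e : R, 0 < e -> exists2 S, A S & opnorm_le (opsub T S) e) ->
        A T].

Definition toeplitz_algebra : set operator := [set T |
  forall A, closed_subalgebra A ->
    (forall b S, circle_Linfty b -> is_toeplitz b S -> A S) -> A T].

Definition essential_commutator A : set operator := [set T |
  bounded_operators T /\
  forall X, A X -> compact_operators (opsub (opcomp T X) (opcomp X T))].

(* The integral from 0 to z along the segment u = t z, 0 <= t <= 1. *)
Definition volterra (g : R[i] -> R[i]) : operator := fun f z =>
  complex_integral `[0, 1] (fun t => f (t%:C * z) * cderiv g (t%:C * z) * z).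

End operators.

(* Main.v *)
Require Import Defs.
From mathcomp Require Import all_boot all_order all_algebra.
From mathcomp Require Import complex ring lra.
From mathcomp Require Import all_classical all_reals all_analysis.
From mathcomp Require Import measurable_realfun.

(* Write [V] for the Volterra operator and suppose that it commutes with every
   Toeplitz operator modulo compact operators.  For a symbol [b] bounded and
   holomorphic on the disk, the Toeplitz operator is multiplication by [b], and
   the commutator is [f |-> V (b f) - b V f].

   Let [peak zeta d] be the function [d / (1 + d - conj zeta z)], of norm
   [sqrt d], and let [f] be its normalisation.  If [peak zeta d * V f] is small
   in [H^2], then [g] has small mean oscillation on the arc of length [d] starting
   at [zeta].  As [g] is not in VMOA, there are [zeta_j] tending to a point [xi] of
   the circle and [d_j] tending to 0 for which this norm is bounded below.
   Multiply the peak by [1 - peak xi eta], with [eta] small, to make it vanish at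
   [xi], and by [z^N] with [N] large: this makes [V (beta f)] small and does not
   change the norm of [beta V f], so the commutator with the resulting symbol
   [beta] is bounded below at [f].  The commutator with a fixed function of the
   disk algebra tends to 0 in norm along the [f_j], while symbols concentrated
   near [xi] hardly affect a fixed [f].  So a sliding hump argument gives a bounded
   holomorphic symbol [b = sum_j beta_j], continuous on the closed disk except at
   [xi], whose commutator is bounded below along the [f_j].  This contradicts
   compactness, because the images of the [f_j] tend to 0 pointwise. *)

Set Implicit Arguments.
Unset Strict Implicit.
Unset Printing Implicit Defensive.

Import Order.TTheory GRing.Theory Num.Theory.
Import numFieldNormedType.Exports.

Local Open Scope classical_set_scope.
Local Open Scope ring_scope.
Local Open Scope complex_scope.

(** Compactness has to fail for one fixed symbol, and a symbol of the disk algebra cannot do it,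
    since its commutator tends to 0 along the test functions. So [b] must be discontinuous. Making
    every hump vanish at [xi] confines the discontinuity to that point: away from [xi] the sum
    converges uniformly, which gives holomorphy and radial limits almost everywhere. The powers
    [z ^+ N] act through the identity (V (z^N f))' = z^N (V f)'. If V f has coefficients F_k, then V
    (z^N f) has k F_k / (N + k) in degree N + k, small when k is small against N, whereas z^N V f
    merely shifts the F_k. The difference, -N F_k / (N + k), is small for large k, so a monomial
    commutator only sees finitely many low coefficients, and these are controlled by the size of f
    on a smaller disk. This is quantified by flatness, a bound on |f(z)| (1 - |z|), which replaces
    weak convergence to 0. Hardy norms are handled through square sums of Taylor coefficients.
    Adding two bounds there costs a factor 2, and the fractions [c0 / 10] and [c0 / 100] are chosen
    to absorb these losses. *)

Local Notation nc := ComplexField.Normc.normc.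
Local Notation cre := (@complex.Re _).
Local Notation cim := (@complex.Im _).
Local Notation cj := conjc.
Local Arguments ComplexField.Normc.normc : simpl never.


(** * Complex modulus *)

Section complex_modulus.
Context {R : realType}.
Implicit Types z w : R[i].

Lemma ncE z : nc z = Num.sqrt (cre z ^+ 2 + cim z ^+ 2).
Proof. by case: z. Qed.

Lemma nc_sqr z : nc z ^+ 2 = cre z ^+ 2 + cim z ^+ 2.
Proof. by rewrite ncE sqr_sqrtr// addr_ge0// sqr_ge0. Qed.

Lemma norm_nc z : `|z| = (nc z)%:C.
Proof. by rewrite normc_def ncE. Qed.

Lemma nc_ge0 z : 0 <= nc z.
Proof. by rewrite ncE sqrtr_ge0. Qed.

Lemma nc0 : nc (0 : R[i]) = 0. Proof. exact: ComplexField.Normc.normc0. Qed.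
Lemma nc1 : nc (1 : R[i]) = 1. Proof. exact: ComplexField.Normc.normc1. Qed.

Lemma nc_eq0 z : nc z = 0 -> z = 0.
Proof. exact: ComplexField.Normc.eq0_normc. Qed.

Lemma nc_gt0 z : z != 0 -> 0 < nc z.
Proof.
by move=> z0; rewrite lt_def nc_ge0 andbT; apply: contra z0 => /eqP/nc_eq0 ->.
Qed.

Lemma ncM z w : nc (z * w) = nc z * nc w.
Proof. exact: ComplexField.Normc.normcM. Qed.

Lemma ncV z : nc z^-1 = (nc z)^-1.
Proof. exact: ComplexField.Normc.normcV. Qed.

Lemma ncX z n : nc (z ^+ n) = nc z ^+ n.
Proof. by elim: n => [|n IH]; rewrite ?expr0 ?nc1// !exprS ncM IH. Qed.

Lemma ncN z : nc (- z) = nc z.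
Proof. by rewrite !ncE !raddfN /= !sqrrN. Qed.

Lemma ncD z w : nc (z + w) <= nc z + nc w.
Proof. exact: le_normcD. Qed.

Lemma ncB z w : nc (z - w) <= nc z + nc w.
Proof. by rewrite (le_trans (ncD _ _))// ncN. Qed.

Lemma ncBC z w : nc (z - w) = nc (w - z).
Proof. by rewrite -ncN opprB. Qed.

Lemma nc_triangle z w v : nc (z - w) <= nc (z - v) + nc (v - w).
Proof. by rewrite (_ : z - w = (z - v) + (v - w)) ?ncD//; ring. Qed.

Lemma nc_subl z w : nc z - nc w <= nc (z - w).
Proof. by rewrite lerBlDr -{1}(subrK w z) ncD. Qed.

Lemma ncC (x : R) : nc x%:C = `|x|.
Proof. by rewrite ncE /= expr0n addr0 sqrtr_sqr. Qed.

Lemma ncC_ge0 (x : R) : 0 <= x -> nc x%:C = x.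
Proof. by move=> x0; rewrite ncC ger0_norm. Qed.

Lemma nc_conj z : nc (cj z) = nc z.
Proof. by case: z => a b; rewrite !ncE /= sqrrN. Qed.

Lemma nc_sum (I : Type) (s : seq I) (F : I -> R[i]) :
  nc (\sum_(i <- s) F i) <= \sum_(i <- s) nc (F i).
Proof.
elim: s => [|i s IH]; first by rewrite !big_nil nc0.
by rewrite !big_cons (le_trans (ncD _ _))// lerD2l.
Qed.

Lemma nc_re z : `|cre z| <= nc z.
Proof. by rewrite ncE -sqrtr_sqr ler_wsqrtr// lerDl sqr_ge0. Qed.

Lemma nc_im z : `|cim z| <= nc z.
Proof. by rewrite ncE -sqrtr_sqr ler_wsqrtr// lerDr sqr_ge0. Qed.

Lemma nc_le_re_im z : nc z <= `|cre z| + `|cim z|.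
Proof.
rewrite -(@ler_pXn2r _ 2)// ?nnegrE ?nc_ge0 ?addr_ge0// nc_sqr sqrrD !real_normK ?num_real//.
by have := mulr_ge0 (normr_ge0 (cre z)) (normr_ge0 (cim z)); lra.
Qed.

Lemma complex_ext z w : cre z = cre w -> cim z = cim w -> z = w.
Proof. by case: z w => [a b] [c d] /= -> ->. Qed.

Lemma creM z w : cre (z * w) = cre z * cre w - cim z * cim w.
Proof. by case: z w => [a b] [c d]. Qed.
Lemma cimM z w : cim (z * w) = cre z * cim w + cim z * cre w.
Proof. by case: z w => [a b] [c d] /=; ring. Qed.
Lemma creD z w : cre (z + w) = cre z + cre w.
Proof. by case: z w => [a b] [c d]. Qed.
Lemma cimD z w : cim (z + w) = cim z + cim w.
Proof. by case: z w => [a b] [c d]. Qed.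
Lemma creB z w : cre (z - w) = cre z - cre w.
Proof. by case: z w => [a b] [c d]. Qed.
Lemma cimB z w : cim (z - w) = cim z - cim w.
Proof. by case: z w => [a b] [c d]. Qed.

Lemma disk_nc z : disk z <-> nc z < 1.
Proof. by rewrite /disk /= norm_nc -[1]/((1 : R)%:C) ltcR. Qed.

Lemma nc_expi (t : R) : nc (expi t) = 1.
Proof. by rewrite ncE /= cos2Dsin2 sqrtr1. Qed.

Lemma expiD (s t : R) : expi (s + t) = expi s * expi t.
Proof. by apply: complex_ext; rewrite /expi ?creM ?cimM /= ?cosD ?sinD; ring. Qed.

Lemma expi0 : expi (0 : R) = 1.
Proof. by rewrite /expi cos0 sin0. Qed.

Lemma expi2pi : expi (2 * pi : R) = 1.
Proof. by rewrite /expi mulrC mulr_natr cos2pi sin2pi. Qed.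

Lemma expiN (t : R) : expi (- t) = cj (expi t).
Proof. by rewrite /expi cosN sinN. Qed.

Lemma expi_conjM (t : R) : cj (expi t) * expi t = 1.
Proof. by rewrite -expiN -expiD addNr expi0. Qed.

End complex_modulus.

(** * Integrals and derivatives along real paths *)

Section complex_paths.
Context {R : realType}.
Implicit Types (F G : R -> R[i]) (a b t : R).

Definition ccont a b F := forall t, a <= t <= b -> forall e, 0 < e ->
  exists2 d, 0 < d & forall s, a <= s <= b -> `|s - t| < d -> nc (F s - F t) <= e.

Definition cder F t (L : R[i]) := forall e, 0 < e ->
  exists2 d, 0 < d & forall h, `|h| < d -> nc (F (t + h) - F t - h%:C * L) <= e * `|h|.

Lemma ccont_re a b F : ccont a b F -> {within `[a, b], continuous (cre \o F)}.
Proof.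
move=> cF; apply/subspace_continuousP => t /=; rewrite in_itv /= => tab.
apply/cvgrPdist_le => e e0; have [d d0 H] := cF t tab e e0.
rewrite near_withinE; near=> s; rewrite /= in_itv /= => sab.
have sd : `|s - t| < d.
  by near: s; have := @nbhsx_ballx R R t d d0; apply: filterS => s; rewrite /ball /= distrC.
by rewrite distrC -creB (le_trans (nc_re _))// H.
Unshelve. all: by end_near. Qed.

Lemma ccont_im a b F : ccont a b F -> {within `[a, b], continuous (cim \o F)}.
Proof.
move=> cF; apply/subspace_continuousP => t /=; rewrite in_itv /= => tab.
apply/cvgrPdist_le => e e0; have [d d0 H] := cF t tab e e0.
rewrite near_withinE; near=> s; rewrite /= in_itv /= => sab.
have sd : `|s - t| < d.
  by near: s; have := @nbhsx_ballx R R t d d0; apply: filterS => s; rewrite /ball /= distrC.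
by rewrite distrC -cimB (le_trans (nc_im _))// H.
Unshelve. all: by end_near. Qed.

Lemma cder_re F t L : cder F t L -> is_derive t 1 (cre \o F) (cre L).
Proof.
move=> dF.
suff H : h^-1 *: ((cre \o F) (h *: 1 + t) - (cre \o F) t) @[h --> 0^'] --> cre L.
  by apply: DeriveDef; [apply/cvg_ex; exists (cre L) | apply/cvg_lim].
apply/cvgrPdist_le => e e0; have [d d0 H] := dF e e0.
near=> h.
have h0 : h != 0 by near: h; exact: nbhs_dnbhs_neq.
have hd : `|h| < d.
  by near: h; apply: dnbhs0_lt.
have -> : h%:A = h :> R by exact: mulr1.
have := H h hd; rewrite /= (addrC t h) => K.
have K' := le_trans (nc_re _) K; move: K'; rewrite !creB creM /= mul0r subr0 => K'.
rewrite /GRing.scale /=.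
set D := cre _ - cre _ in K' *.
have -> : cre L - h^-1 * D = h^-1 * (h * cre L - D) by field.
by rewrite normrM normfV ler_pdivrMl ?normr_gt0// distrC (mulrC `|h|).
Unshelve. all: by end_near. Qed.

Lemma cder_mulC F t L c : cder F t L -> cder (fun s => c * F s) t (c * L).
Proof.
move=> dF e e0.
have c1 : 0 < nc c + 1 by rewrite ltr_wpDl ?nc_ge0.
have [d d0 H] := dF (e / (nc c + 1)) (divr_gt0 e0 c1).
exists d => // h hd.
have -> : c * F (t + h) - c * F t - h%:C * (c * L) = c * (F (t + h) - F t - h%:C * L).
  by ring.
rewrite ncM (le_trans (ler_wpM2l (nc_ge0 _) (H h hd)))// mulrA ler_wpM2r//.
by rewrite mulrCA ger_pMr// ler_pdivrMr// mul1r lerDl.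
Qed.

(** The imaginary part is the real part after multiplication by [- 'i]. *)
Lemma cder_im F t L : cder F t L -> is_derive t 1 (cim \o F) (cim L).
Proof.
move=> /(cder_mulC (- 'i)) /cder_re H.
have E z : cre (- 'i * z) = cim z by case: z => x y /=; ring.
have -> : cim \o F = cre \o (fun s => - 'i * F s) by apply/funext => s /=; rewrite E.
by rewrite -E.
Qed.

Lemma cder_cont F t L : cder F t L -> forall e, 0 < e ->
  exists2 d, 0 < d & forall s, `|s - t| < d -> nc (F s - F t) <= e.
Proof.
move=> dF e e0; have [d d0 H] := dF 1 ltr01.
have L0 : 0 < nc L + 1 by rewrite ltr_wpDl ?nc_ge0.
exists (Num.min d (e / (nc L + 1))); first by rewrite lt_min d0 divr_gt0.
move=> s; rewrite lt_min => /andP[sd se].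
have := H (s - t) sd; rewrite mul1r subrKC => K.
rewrite -[F s - F t](subrK ((s - t)%:C * L)) (le_trans (ncD _ _))//.
rewrite ncM ncC; apply: (@le_trans _ _ (`|s - t| * (nc L + 1))).
  by rewrite mulrDr mulr1 addrC lerD2l.
by move: se; rewrite ltr_pdivlMr// => /ltW.
Qed.

Definition cint a b F := complex_integral `[a, b] F.

Lemma ccont_integrable_re a b F : ccont a b F ->
  lebesgue_measure.-integrable `[a, b] (EFin \o (fun t => cre (F t))).
Proof.
move=> cF; apply: continuous_compact_integrable; first exact: segment_compact.
exact: ccont_re.
Qed.

Lemma ccont_integrable_im a b F : ccont a b F ->
  lebesgue_measure.-integrable `[a, b] (EFin \o (fun t => cim (F t))).
Proof.
move=> cF; apply: continuous_compact_integrable; first exact: segment_compact.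
exact: ccont_im.
Qed.

Lemma eq_cint a b F G : (forall t, a <= t <= b -> F t = G t) -> cint a b F = cint a b G.
Proof.
move=> FG; rewrite /cint /complex_integral.
by congr (_ +i* _); apply: eq_Rintegral => t; rewrite inE /= in_itv /= => /FG ->.
Qed.

Lemma cintD a b F G : ccont a b F -> ccont a b G ->
  cint a b (fun t => F t + G t) = cint a b F + cint a b G.
Proof.
move=> cF cG; rewrite /cint /complex_integral; apply: complex_ext => /=.
  rewrite -RintegralD//; [|exact: ccont_integrable_re..].
  by apply: eq_Rintegral => t _; rewrite creD.
rewrite -RintegralD//; [|exact: ccont_integrable_im..].
by apply: eq_Rintegral => t _; rewrite cimD.
Qed.

Lemma cintZ a b F c : ccont a b F -> cint a b (fun t => c * F t) = c * cint a b F.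
Proof.
move=> cF; have ir := ccont_integrable_re cF; have ii := ccont_integrable_im cF.
have Z (k : R) (f : R -> R) : lebesgue_measure.-integrable `[a, b] (EFin \o f) ->
    lebesgue_measure.-integrable `[a, b] (EFin \o (fun t => k * f t)).
  by move=> fi; apply: eq_integrable (integrableZl _ k fi).
rewrite /cint /complex_integral; apply: complex_ext; rewrite ?creM ?cimM /=.
  rewrite -!RintegralZl// -RintegralB//; [|exact: Z..].
  by apply: eq_Rintegral => t _; rewrite creM.
rewrite -!RintegralZl// -RintegralD//; [|exact: Z..].
by apply: eq_Rintegral => t _; rewrite cimM.
Qed.

Lemma cint_re a b F : cre (cint a b F) = (\int[lebesgue_measure]_(t in `[a, b]) cre (F t))%R.
Proof. by []. Qed.

(** Real and imaginary parts are estimated separately, whence the factor 2; it reappears in all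
    constants derived from contour integrals. *)
Lemma cint_bound a b F M : a <= b -> ccont a b F ->
  (forall t, a <= t <= b -> nc (F t) <= M) -> nc (cint a b F) <= 2 * M * (b - a).
Proof.
move=> ab cF FM.
have aux (f : R -> R) : lebesgue_measure.-integrable `[a, b] (EFin \o f) ->
    (forall t, a <= t <= b -> `|f t| <= M) ->
    `|\int[lebesgue_measure]_(t in `[a, b]) f t|%R <= M * (b - a).
  move=> fi fM; rewrite (le_trans (le_normr_Rintegral _ _))//.
  apply: (@le_trans _ _ (\int[lebesgue_measure]_(t in `[a, b]) cst M t)%R).
    apply: le_Rintegral => //.
    - exact: (integrable_abse fi).
    - apply: continuous_compact_integrable; first exact: segment_compact.
      by apply: continuous_subspaceT => x; exact: cvg_cst.
  rewrite Rintegral_cst//= lebesgue_measure_itv /= lte_fin.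
  case: ltP => // ba.
  by rewrite mulr0 (_ : b = a) ?subrr ?mulr0//; apply/le_anti; rewrite ab ba.
apply: (le_trans (nc_le_re_im _)); rewrite -mulrA mulr_natl mulr2n lerD//.
  apply: aux; first exact: ccont_integrable_re.
  by move=> t /FM; exact: le_trans (nc_re _).
apply: aux; first exact: ccont_integrable_im.
by move=> t /FM; exact: le_trans (nc_im _).
Qed.

Lemma cint_split a c b F : a <= c <= b -> ccont a b F ->
  cint a b F = cint a c F + cint c b F.
Proof.
move=> /andP[ac cb] cF.
have aux (f : R -> R) : lebesgue_measure.-integrable `[a, b] (EFin \o f) ->
    (\int[lebesgue_measure]_(t in `[a, b]) f t =
    \int[lebesgue_measure]_(t in `[a, c]) f t + \int[lebesgue_measure]_(t in `[c, b]) f t)%R.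
  move=> fi; apply/eqP; rewrite addrC -subr_eq; apply/eqP.
  rewrite Rintegral_itvB ?bnd_simp// Rintegral_itv_obnd_cbnd//.
  apply: integrableS fi => //; apply: subset_itv; rewrite bnd_simp//.
rewrite /cint /complex_integral; apply: complex_ext => /=.
  by apply: aux; exact: (ccont_integrable_re cF).
by apply: aux; exact: (ccont_integrable_im cF).
Qed.

Lemma cint_FTC a b F F' : a < b -> (forall t, a < t < b -> cder F t (F' t)) ->
  ccont a b F -> ccont a b F' -> cint a b F' = F b - F a.
Proof.
move=> ab dF cF cF'.
have aux (f f' : R -> R) : (forall t, a < t < b -> is_derive t 1 f (f' t)) ->
    {within `[a, b], continuous f} -> {within `[a, b], continuous f'} ->
    (\int[lebesgue_measure]_(t in `[a, b]) f' t = f b - f a)%R.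
  move=> df cf cf'; rewrite /Rintegral (continuous_FTC2 ab cf' (F := f))//.
    have [_ ca cb] := (continuous_within_itvP _ ab).1 cf.
    by split => // x; rewrite in_itv /= => /df [].
  by move=> x; rewrite in_itv /= => /df dx; rewrite derive1E derive_val.
rewrite /cint /complex_integral; apply: complex_ext; rewrite ?creB ?cimB /=.
  apply: (aux (cre \o F)) => [t /dF/cder_re//| |]; exact: ccont_re.
apply: (aux (cim \o F)) => [t /dF/cder_im//| |]; exact: ccont_im.
Qed.

End complex_paths.

(** * Limits and complex derivatives *)

Section limits.
Context {R : realType} {T : Type} (G : set_system T) {FG : Filter G}.
Implicit Types (F H : T -> R[i]) (l m : R[i]).

Definition clim F l := forall e : R, 0 < e -> G [set x | nc (F x - l) <= e].

Lemma clim_cst l : clim (fun=> l) l.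
Proof. by move=> e e0; apply: filterE => x /=; rewrite subrr nc0 ltW. Qed.

Lemma climD F H l m : clim F l -> clim H m -> clim (fun x => F x + H x) (l + m).
Proof.
move=> Fl Hm e e0; have e2 : 0 < e / 2 by rewrite divr_gt0.
apply: filterS2 (Fl _ e2) (Hm _ e2) => x /= h1 h2.
rewrite (_ : _ - _ = (F x - l) + (H x - m)); last ring.
by rewrite (le_trans (ncD _ _))// (le_trans (lerD h1 h2))// -splitr.
Qed.

Lemma clim_bounded F l : clim F l -> G [set x | nc (F x) <= nc l + 1].
Proof.
move=> /(_ 1 ltr01); apply: filterS => x /= h.
by rewrite -lerBlDl (le_trans (nc_subl _ _)).
Qed.

Lemma climM F H l m : clim F l -> clim H m -> clim (fun x => F x * H x) (l * m).
Proof.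
move=> Fl Hm e e0.
set A := nc l + 1; set B := nc m + 1.
have A0 : 0 < A by rewrite ltr_wpDl ?nc_ge0.
have B0 : 0 < B by rewrite ltr_wpDl ?nc_ge0.
have eA : 0 < e / 2 / A by rewrite !divr_gt0.
have eB : 0 < e / 2 / B by rewrite !divr_gt0.
apply: filterS3 (Fl _ eB) (Hm _ eA) (clim_bounded Fl) => x /= h1 h2 h3.
rewrite (_ : _ - _ = (F x - l) * m + F x * (H x - m)); last ring.
rewrite (le_trans (ncD _ _))// !ncM [leRHS](splitr e) lerD//.
  apply: (@le_trans _ _ (e / 2 / B * B)); last by rewrite divfK ?gt_eqF.
  by apply: ler_pM; rewrite ?nc_ge0// lerDl.
apply: (@le_trans _ _ (A * (e / 2 / A))); last by rewrite mulrC divfK ?gt_eqF.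
by apply: ler_pM; rewrite ?nc_ge0.
Qed.

Lemma climZ F l c : clim F l -> clim (fun x => c * F x) (c * l).
Proof. by move=> Fl; apply: climM => //; exact: clim_cst. Qed.

Lemma climN F l : clim F l -> clim (fun x => - F x) (- l).
Proof.
move=> Fl e e0; apply: filterS (Fl e e0) => x /=.
by rewrite -opprD ncN.
Qed.

Lemma climB F H l m : clim F l -> clim H m -> clim (fun x => F x - H x) (l - m).
Proof. by move=> Fl Hm; apply: climD => //; exact: climN. Qed.

Lemma climX F l n : clim F l -> clim (fun x => F x ^+ n) (l ^+ n).
Proof.
move=> Fl; elim: n => [|n IH]; first by under eq_fun do rewrite expr0; exact: clim_cst.
under eq_fun do rewrite exprS.
by rewrite exprS; exact: climM.
Qed.

Lemma climV F l : l != 0 -> clim F l -> clim (fun x => (F x)^-1) l^-1.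
Proof.
move=> l0 Fl e e0; have nl := nc_gt0 l0.
have h1 : 0 < nc l / 2 by rewrite divr_gt0.
have h2 : 0 < e * (nc l / 2 * nc l) by rewrite !mulr_gt0 ?invr_gt0.
apply: filterS2 (Fl _ h1) (Fl _ h2) => x /= k1 k2.
have Fx : nc l / 2 <= nc (F x).
  have := nc_subl l (F x); rewrite ncBC => /le_trans/(_ k1); lra.
have Fx0 : F x != 0.
  by apply/eqP => E; move: Fx; rewrite E nc0 leNgt h1.
rewrite (_ : _ - _ = (l - F x) * ((F x)^-1 * l^-1)); last by field; rewrite l0.
rewrite ncM ncBC (ncM (F x)^-1) !ncV -invfM ler_pdivrMr; last by rewrite mulr_gt0 ?nc_gt0.
by apply: (le_trans k2); apply: ler_wpM2l (ltW e0) _ _ _; apply: ler_wpM2r (nc_ge0 _) _ _ _.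
Qed.

Lemma clim_sum (I : Type) (s : seq I) (F : I -> T -> R[i]) (l : I -> R[i]) :
  (forall i, clim (F i) (l i)) ->
  clim (fun x => \sum_(i <- s) F i x) (\sum_(i <- s) l i).
Proof.
move=> H; elim: s => [|i s IH].
  by rewrite big_nil; under eq_fun do rewrite big_nil; exact: clim_cst.
by rewrite big_cons; under eq_fun do rewrite big_cons; exact: climD.
Qed.

(* First-order expansion of F at the value F0 in terms of the increment inc;
   it covers both derivatives along real paths and complex derivatives. *)
Definition gder (inc F : T -> R[i]) (F0 L : R[i]) := forall e : R, 0 < e ->
  G [set x | nc (F x - F0 - inc x * L) <= e * nc (inc x)].

Context (inc : T -> R[i]) (inc0 : clim inc 0).

Lemma gder_clim F (F0 : R[i]) L : gder inc F F0 L -> clim F F0.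
Proof.
move=> dF e e0; have L0 : 0 < nc L + 1 by rewrite ltr_wpDl ?nc_ge0.
have e1 : 0 < e / (nc L + 1) by rewrite divr_gt0.
apply: filterS2 (dF 1 ltr01) (inc0 e1) => x /=; rewrite subr0 mul1r => h1 h2.
rewrite -[F x - F0](subrK (inc x * L)) (le_trans (ncD _ _))// ncM.
apply: (@le_trans _ _ (nc (inc x) * (nc L + 1))); first by rewrite mulrDr mulr1 addrC lerD2l.
by rewrite -ler_pdivlMr.
Qed.

Lemma gder_cst c : gder inc (fun=> c) c 0.
Proof.
by move=> e e0; apply: filterE => x /=; rewrite subrr mulr0 subr0 nc0 mulr_ge0 ?nc_ge0 ?ltW.
Qed.

Lemma gder_inc c : gder inc (fun x => c + inc x) c 1.
Proof.
move=> e e0; apply: filterE => x /=.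
by rewrite mulr1 (addrC c) addrK subrr nc0 mulr_ge0 ?nc_ge0 ?ltW.
Qed.

Lemma gderD F (F0 : R[i]) L H (H0 : R[i]) M : gder inc F F0 L -> gder inc H H0 M ->
  gder inc (fun x => F x + H x) (F0 + H0) (L + M).
Proof.
move=> dF dH e e0; have e2 : 0 < e / 2 by rewrite divr_gt0.
apply: filterS2 (dF _ e2) (dH _ e2) => x /= h1 h2.
rewrite (_ : _ - _ = (F x - F0 - inc x * L) + (H x - H0 - inc x * M)); last ring.
by rewrite (le_trans (ncD _ _))// (le_trans (lerD h1 h2))// -mulrDl -splitr.
Qed.

Lemma gderM F (F0 : R[i]) L H (H0 : R[i]) M : gder inc F F0 L -> gder inc H H0 M ->
  gder inc (fun x => F x * H x) (F0 * H0) (L * H0 + F0 * M).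
Proof.
move=> dF dH e e0.
have e3 : 0 < e / 3 by rewrite divr_gt0.
have K0 (c : R[i]) : 0 < nc c + 1 by rewrite ltr_wpDl ?nc_ge0.
have eF : 0 < e / 3 / (nc F0 + 1 + 1) by rewrite divr_gt0// addr_gt0.
have eH : 0 < e / 3 / (nc H0 + 1) by rewrite divr_gt0.
have eL : 0 < e / 3 / (nc M + 1) by rewrite divr_gt0.
have A := dF _ eH; have B := dH _ eF; have C := gder_clim dF eL.
have D := clim_bounded (gder_clim dF).
apply: filterS3 A B (filterI C D) => x /= h1 h2 [h3 h4].
have -> : F x * H x - F0 * H0 - inc x * (L * H0 + F0 * M) =
  (F x - F0 - inc x * L) * H0 + F x * (H x - H0 - inc x * M) + (F x - F0) * (inc x * M).
  by ring.
have i0 := nc_ge0 (inc x).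
have -> : e * nc (inc x) = e / 3 * nc (inc x) + e / 3 * nc (inc x) + e / 3 * nc (inc x).
  by field.
rewrite (le_trans (ncD _ _))// lerD//.
  rewrite (le_trans (ncD _ _))// lerD// ncM.
    apply: (@le_trans _ _ (e / 3 / (nc H0 + 1) * nc (inc x) * (nc H0 + 1))).
      by apply: ler_pM; rewrite ?nc_ge0// lerDl.
    by rewrite mulrAC divfK// gt_eqF.
  apply: (@le_trans _ _ ((nc F0 + 1 + 1) * (e / 3 / (nc F0 + 1 + 1) * nc (inc x)))).
    by apply: ler_pM; rewrite ?nc_ge0// (le_trans h4)// lerDl.
  by rewrite mulrA (mulrC (nc F0 + 1 + 1)) divfK// gt_eqF// addr_gt0.
rewrite !ncM.
apply: (@le_trans _ _ (e / 3 / (nc M + 1) * (nc (inc x) * (nc M + 1)))).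
  by apply: ler_pM; rewrite ?mulr_ge0 ?nc_ge0// ler_wpM2l// lerDl.
by rewrite le_eqVlt; apply/orP; left; apply/eqP; field; rewrite gt_eqF.
Qed.

Lemma gder_ext F F' (F0 : R[i]) L : (forall x, F x = F' x) -> gder inc F F0 L -> gder inc F' F0 L.
Proof. by move=> /funext ->. Qed.

Lemma gderV F (F0 : R[i]) L : F0 != 0 -> gder inc F F0 L ->
  gder inc (fun x => (F x)^-1) F0^-1 (- L / F0 ^+ 2).
Proof.
move=> F00 dF e e0.
have cF := gder_clim dF; have cV := climV F00 cF.
have K0 (c : R[i]) : 0 < nc c + 1 by rewrite ltr_wpDl ?nc_ge0.
pose P := (nc F0^-1 + 1) * (nc F0^-1 + 1).
have P0 : 0 < P by rewrite mulr_gt0.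
have e1 : 0 < e / 2 / P by rewrite !divr_gt0.
have e2 : 0 < e / 2 / (nc (L / F0) + 1) by rewrite !divr_gt0.
have nz : G [set x | F x != 0].
  have h : 0 < nc F0 / 2 by rewrite divr_gt0 ?nc_gt0.
  apply: filterS (cF _ h) => x /= k; apply/eqP => E; move: k; rewrite E sub0r ncN.
  by have := nc_gt0 F00; lra.
apply: filterS3 (filterI (dF _ e1) nz) (cV _ e2) (clim_bounded cV) => x /= [h1 h0] h2 h3.
have -> : (F x)^-1 - F0^-1 - inc x * (- L / F0 ^+ 2) =
    - ((F x - F0 - inc x * L) * ((F x)^-1 * F0^-1)) - inc x * ((L / F0) * ((F x)^-1 - F0^-1)).
  by field; rewrite ?h0 ?F00.
have i0 := nc_ge0 (inc x).
rewrite (le_trans (ncB _ _))// (_ : e * _ = e / 2 * nc (inc x) + nc (inc x) * (e / 2)); last by field.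
rewrite lerD//.
  rewrite ncN ncM (ncM (F x)^-1).
  apply: (@le_trans _ _ (e / 2 / P * nc (inc x) * P)); last by rewrite mulrAC divfK ?gt_eqF.
  apply: ler_pM; rewrite ?mulr_ge0 ?nc_ge0//.
  by apply: ler_pM; rewrite ?nc_ge0// lerDl.
rewrite ncM ler_wpM2l// ncM.
apply: (@le_trans _ _ ((nc (L / F0) + 1) * (e / 2 / (nc (L / F0) + 1)))).
  by apply: ler_pM; rewrite ?nc_ge0// lerDl.
by rewrite mulrC divfK// gt_eqF.
Qed.

End limits.

Section complex_derivative.
Context {R : realType}.
Implicit Types (f g : R[i] -> R[i]) (z w : R[i]).

(** The norm of [R[i]] takes its values in [R[i]]; this filter gives the same neighbourhoods with
    real radii, so that estimates stay in [R]. *)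
Definition cnbhs z : set_system R[i] :=
  [set A | exists2 d : R, 0 < d & forall w, nc (w - z) < d -> A w].

Global Instance cnbhs_filter z : Filter (cnbhs z).
Proof.
constructor.
- by exists 1.
- move=> A B [d d0 Hd] [e e0 He]; exists (Num.min d e); first by rewrite lt_min d0.
  by move=> w; rewrite lt_min => /andP[/Hd ? /He ?].
- by move=> A B AB [d d0 Hd]; exists d => // w /Hd /AB.
Qed.

Definition hasder f z L := gder (cnbhs 0) id (fun h => f (z + h)) (f z) L.

Lemma clim_id0 : clim (cnbhs (0 : R[i])) id 0.
Proof. by move=> e e0; exists e => // w /ltW. Qed.

Lemma hasderP f z L : hasder f z L <-> (forall e, 0 < e -> exists2 d, 0 < d &
  forall h, nc h < d -> nc (f (z + h) - f z - h * L) <= e * nc h).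
Proof.
split=> [H e /H [d d0 K]|H e /H [d d0 K]]; exists d => // h.
  by move=> hd; apply: K; rewrite subr0.
by rewrite subr0; exact: K.
Qed.

Lemma hasder_cont f z L : hasder f z L -> clim (cnbhs z) f (f z).
Proof.
move=> /(gder_clim clim_id0) H e /H [d d0 K]; exists d => // w wd.
by have := K (w - z); rewrite subr0 /= subrKC; apply.
Qed.

Lemma hasder_comp (T : Type) (G : set_system T) {FG : Filter G} inc F F0 L f M :
  clim G inc 0 -> gder G inc F F0 L -> hasder f F0 M -> gder G inc (fun x => f (F x)) (f F0) (L * M).
Proof.
move=> inc0 dF /hasderP df e e0.
have K0 (c : R[i]) : 0 < nc c + 1 by rewrite ltr_wpDl ?nc_ge0.
have e1 : 0 < e / 2 / (nc L + 1) by rewrite !divr_gt0.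
have e2 : 0 < e / 2 / (nc M + 1) by rewrite !divr_gt0.
have [d d0 H] := df _ e1.
have d2 : 0 < d / 2 by rewrite divr_gt0.
have c2 : G [set x | nc (F x - F0) <= d / 2] by exact: (gder_clim inc0 dF).
apply: filterS3 (dF _ ltr01) (dF _ e2) c2 => x /= h1 h2 h3.
have := H (F x - F0); rewrite subrKC => /(_ _)/wrap[|K].
  by rewrite (le_lt_trans h3)// ltr_pdivrMr// ltr_pMr// ltr1n.
have -> : f (F x) - f F0 - inc x * (L * M) =
  (f (F x) - f F0 - (F x - F0) * M) + (F x - F0 - inc x * L) * M by ring.
have i0 := nc_ge0 (inc x).
rewrite (le_trans (ncD _ _))// [leRHS](_ : _ = e / 2 * nc (inc x) + e / 2 * nc (inc x)); last by field.
rewrite lerD//.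
  apply: (le_trans K); apply: (@le_trans _ _ (e / 2 / (nc L + 1) * ((nc L + 1) * nc (inc x)))); last first.
    by rewrite mulrA divfK// gt_eqF.
  apply: ler_wpM2l; first exact: ltW.
  rewrite -[F x - F0](subrK (inc x * L)) (le_trans (ncD _ _))// ncM.
  by have : 0 <= nc (inc x) by []; move: h1; rewrite mul1r; set A := nc _; set B := nc _; lra.
rewrite ncM.
apply: (@le_trans _ _ (e / 2 / (nc M + 1) * nc (inc x) * (nc M + 1))).
  by apply: ler_pM; rewrite ?nc_ge0// lerDl.
by rewrite mulrAC divfK// gt_eqF.
Qed.

Lemma hasder_cst c z : hasder (fun=> c) z 0.
Proof. exact: gder_cst. Qed.

Lemma hasder_id z : hasder id z 1.
Proof. exact: gder_inc. Qed.

Lemma hasderD f g z L M : hasder f z L -> hasder g z M ->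
  hasder (fun w => f w + g w) z (L + M).
Proof. exact: gderD. Qed.

Lemma hasderM f g z L M : hasder f z L -> hasder g z M ->
  hasder (fun w => f w * g w) z (L * g z + f z * M).
Proof. by move=> fL gM; exact: (gderM clim_id0 fL gM). Qed.

Lemma hasderZ c f z L : hasder f z L -> hasder (fun w => c * f w) z (c * L).
Proof. by move=> /(hasderM (hasder_cst c z)); rewrite mul0r add0r. Qed.

Lemma hasderN f z L : hasder f z L -> hasder (fun w => - f w) z (- L).
Proof.
by move=> /(hasderZ (-1)); rewrite mulN1r; under eq_fun do rewrite mulN1r.
Qed.

Lemma hasderB f g z L M : hasder f z L -> hasder g z M ->
  hasder (fun w => f w - g w) z (L - M).
Proof. by move=> fL /hasderN gM; exact: hasderD. Qed.

Lemma hasderV f z L : f z != 0 -> hasder f z L ->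
  hasder (fun w => (f w)^-1) z (- L / f z ^+ 2).
Proof. by move=> f0 fL; exact: (gderV clim_id0 f0 fL). Qed.

Lemma hasder_eq f z L M : hasder f z L -> L = M -> hasder f z M.
Proof. by move=> + <-. Qed.

Lemma hasderX n z : hasder (fun w => w ^+ n) z (n%:R * z ^+ n.-1).
Proof.
elim: n => [|n IH].
  by rewrite mul0r; under eq_fun do rewrite expr0; exact: hasder_cst.
under eq_fun do rewrite exprS.
apply: hasder_eq (hasderM (hasder_id z) IH) _.
case: n {IH} => [|n] /=; first by rewrite expr0 mul0r mulr0 addr0 mulr1.
by rewrite -(natr1 n.+1) exprS; ring.
Qed.

Lemma cderP (F : R -> R[i]) t L : cder F t L <->
  gder (nbhs (0 : R)) (fun h : R => h%:C) (fun h => F (t + h)) (F t) L.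
Proof.
split=> H e /H.
  move=> [d d0 K]; have := @nbhsx_ballx R R 0 d d0; apply: filterS => h.
  by rewrite /ball /= sub0r normrN => hd; rewrite /= ncC; exact: K.
move=> /nbhs_ballP [d /= d0 K]; exists d => // h hd.
by have := K h; rewrite /ball /= sub0r normrN ncC; apply.
Qed.

Lemma clim_ofreal0 : clim (nbhs (0 : R)) (fun h : R => h%:C) 0.
Proof.
move=> e e0; have := @nbhsx_ballx R R 0 e e0; apply: filterS => h.
by rewrite /ball /= sub0r normrN subr0 ncC => /ltW.
Qed.

Lemma cder_cst (c : R[i]) (t : R) : cder (fun=> c) t 0.
Proof. by apply/cderP; exact: gder_cst. Qed.

Lemma cder_ofreal (t : R) : cder (fun s : R => s%:C) t 1.
Proof.
by apply/cderP; apply: gder_ext (gder_inc _ t%:C) => x; rewrite rmorphD.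
Qed.

Lemma cderD (F G : R -> R[i]) t L M : cder F t L -> cder G t M -> cder (fun s => F s + G s) t (L + M).
Proof. by move=> /cderP ? /cderP ?; apply/cderP; exact: gderD. Qed.

Lemma cderM (F G : R -> R[i]) t L M : cder F t L -> cder G t M ->
  cder (fun s => F s * G s) t (L * G t + F t * M).
Proof. by move=> /cderP ? /cderP ?; apply/cderP; exact: (gderM clim_ofreal0). Qed.

Lemma cder_comp f (F : R -> R[i]) t L M : cder F t L -> hasder f (F t) M -> cder (fun s => f (F s)) t (L * M).
Proof. by move=> /cderP ? ?; apply/cderP; exact: (hasder_comp clim_ofreal0). Qed.

Lemma cder_eq (F : R -> R[i]) t L M : cder F t L -> L = M -> cder F t M.
Proof. by move=> + <-. Qed.

Lemma is_derive_small (f : R -> R) (t l : R) : is_derive t 1 f l -> forall e, 0 < e ->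
  exists2 d, 0 < d & forall h, `|h| < d -> `|f (t + h) - f t - h * l| <= e * `|h|.
Proof.
move=> [df dl] e e0; move: df; rewrite /derivable => /cvg_ex[/= l' H].
have ll : l' = l by rewrite -dl; apply/esym/cvg_lim.
move: H => /cvgrPdist_le /(_ e e0); rewrite ll => /nbhs_ballP [d /= d0 K].
exists d => // h hd; have [->|h0] := eqVneq h 0.
  by rewrite addr0 subrr mul0r subr0 normr0 mulr0.
have := K h; rewrite /ball /= sub0r normrN => /(_ hd h0).
have -> : h%:A = h :> R by exact: mulr1.
rewrite /GRing.scale /= (addrC h t) => Q.
have -> : f (t + h) - f t - h * l = - (h * (l - h^-1 * (f (t + h) - f t))) by field.
by rewrite normrN normrM mulrC ler_wpM2r.
Qed.

Lemma cder_expi (t : R) : cder expi t ('i * expi t).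
Proof.
move=> e e0; have e2 : 0 < e / 2 by rewrite divr_gt0.
have [d d0 H] := is_derive_small (is_derive_cos t) e2.
have [d' d'0 H'] := is_derive_small (is_derive_sin t) e2.
exists (Num.min d d'); first by rewrite lt_min d0.
move=> h; rewrite lt_min => /andP[hd hd']; rewrite (le_trans (nc_le_re_im _))//.
rewrite [e](splitr e) mulrDl lerD// ?creB ?cimB ?creM ?cimM /=.
  by apply: le_trans (H h hd); rewrite le_eqVlt; apply/orP; left; apply/eqP; congr (`| _ |); ring.
by apply: le_trans (H' h hd'); rewrite le_eqVlt; apply/orP; left; apply/eqP; congr (`| _ |); ring.
Qed.

Lemma ccontP a b (F : R -> R[i]) : ccont a b F <->
  (forall t, a <= t <= b -> clim (within `[a, b] (nbhs t)) F (F t)).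
Proof.
split=> H t tab e e0.
  have [d d0 K] := H t tab e e0; have := @nbhsx_ballx R R t d d0; apply: filterS => s.
  by rewrite /ball /= distrC => st /=; rewrite in_itv /= => sab; exact: K.
have /nbhs_ballP[d /= d0 K] := H t tab e e0; exists d => // s sab st.
by apply: K => /=; rewrite ?in_itv// /ball /= distrC.
Qed.

Lemma cder_ccont a b (F F' : R -> R[i]) : (forall t, a <= t <= b -> cder F t (F' t)) -> ccont a b F.
Proof.
move=> H t /H/cder_cont K e /K[d d0 Q]; exists d => // s _; exact: Q.
Qed.

Lemma ccont_comp a b f (F : R -> R[i]) : ccont a b F ->
  (forall t, a <= t <= b -> clim (cnbhs (F t)) f (f (F t))) -> ccont a b (fun t => f (F t)).
Proof.
move=> cF cf t tab e e0; have [d d0 H] := cf t tab e e0.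
have d2 : 0 < d / 2 by rewrite divr_gt0.
have [d' d'0 H'] := cF t tab _ d2; exists d' => // s sab sd; apply: H.
by rewrite (le_lt_trans (H' s sab sd))// ltr_pdivrMr// ltr_pMr// ltr1n.
Qed.

Lemma ccontD a b (F G : R -> R[i]) : ccont a b F -> ccont a b G -> ccont a b (fun t => F t + G t).
Proof. by move=> /ccontP cF /ccontP cG; apply/ccontP => t tab; apply: climD; auto. Qed.
Lemma ccontM a b (F G : R -> R[i]) : ccont a b F -> ccont a b G -> ccont a b (fun t => F t * G t).
Proof. by move=> /ccontP cF /ccontP cG; apply/ccontP => t tab; apply: climM; auto. Qed.
Lemma ccontB a b (F G : R -> R[i]) : ccont a b F -> ccont a b G -> ccont a b (fun t => F t - G t).
Proof. by move=> /ccontP cF /ccontP cG; apply/ccontP => t tab; apply: climB; auto. Qed.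
Lemma ccont_cst a b (c : R[i]) : ccont a b (fun=> c).
Proof. by apply/ccontP => t tab; exact: clim_cst. Qed.
Lemma ccontZ a b c (F : R -> R[i]) : ccont a b F -> ccont a b (fun t => c * F t).
Proof. by apply: ccontM; exact: ccont_cst. Qed.
Lemma ccontV a b (F : R -> R[i]) : (forall t, a <= t <= b -> F t != 0) -> ccont a b F ->
  ccont a b (fun t => (F t)^-1).
Proof. by move=> F0 /ccontP cF; apply/ccontP => t tab; apply: climV; auto. Qed.
Lemma ccont_expi a b : ccont a b (@expi R).
Proof. by apply: cder_ccont => t _; exact: cder_expi. Qed.
Lemma ccont_ofreal a b : ccont a b (fun t : R => t%:C).
Proof. by apply: cder_ccont => t _; exact: cder_ofreal. Qed.
Lemma cintB a b (F G : R -> R[i]) : ccont a b F -> ccont a b G ->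
  cint a b (fun t => F t - G t) = cint a b F - cint a b G.
Proof.
move=> cF cG; rewrite -[- cint a b G]mulN1r -cintZ// -cintD//; last exact: ccontZ.
by apply: eq_cint => t _; rewrite mulN1r.
Qed.

Lemma derivable_hasder f z : derivable (f : R[i]^o -> R[i]^o) z 1 -> hasder f z (cderiv f z).
Proof.
move=> df; apply/hasderP => e e0.
have : h^-1 *: (f (h *: 1 + z) - f z : R[i]^o) @[h --> (0 : R[i]^o)^'] --> (cderiv f z : R[i]^o).
  by rewrite /cderiv derive1E; exact: df.
move=> /cvgrPdist_le /(_ e%:C); rewrite -[0]/((0 : R)%:C) ltcR => /(_ e0).
move=> /nbhs_ballP [d /= d0 K].
(* A radius that is positive for the order of [R[i]] has imaginary part 0. *)
have dE : d = (complex.Re d)%:C.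
  by apply: complex_ext => //=; move: d0; rewrite ltcE => /andP[/eqP ->].
exists (complex.Re d); first by rewrite -ltcR -dE.
move=> h hd; have [->|h0] := eqVneq h 0.
  by rewrite addr0 subrr mul0r subr0 nc0 mulr0.
have := K h; rewrite /ball /= sub0r normrN => /(_ _ h0)/wrap[|].
  by rewrite norm_nc dE ltcR.
have -> : h%:A = h by exact: mulr1.
rewrite /GRing.scale /= (addrC h z) norm_nc lecR => Q.
have -> : f (z + h) - f z - h * cderiv f z = - (h * (cderiv f z - h^-1 * (f (z + h) - f z))).
  by field.
by rewrite ncN ncM mulrC ler_wpM2r ?nc_ge0.
Qed.

Lemma hasder_cvg f z L : hasder f z L ->
  h^-1 *: (f (h *: 1 + z) - f z : R[i]^o) @[h --> (0 : R[i]^o)^'] --> (L : R[i]^o).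
Proof.
move=> /hasderP df; apply/cvgrPdist_le => e; case: e => e e'.
rewrite ltcE /= => /andP[/eqP -> e0].
have [d d0 H] := df e e0.
apply/nbhs_ballP; exists d%:C; first by rewrite /= -[0]/((0 : R)%:C) ltcR.
move=> h; rewrite /ball /= sub0r normrN norm_nc ltcR => hd h0.
have -> : h%:A = h by exact: mulr1.
rewrite /GRing.scale /= (addrC h z) norm_nc lecR.
have -> : L - h^-1 * (f (z + h) - f z) = - (h^-1 * (f (z + h) - f z - h * L)).
  by field.
by rewrite ncN ncM ncV mulrC ler_pdivrMr ?nc_gt0// H.
Qed.

Lemma hasder_derivable f z L : hasder f z L -> derivable (f : R[i]^o -> R[i]^o) z 1.
Proof. by move=> /hasder_cvg H; apply/cvg_ex; exists L. Qed.

Lemma hasder_cderiv f z L : hasder f z L -> cderiv f z = L.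
Proof. by move=> /hasder_cvg H; rewrite /cderiv derive1E; apply: (@cvg_lim (R[i]^o)) => //; exact: norm_hausdorff. Qed.

End complex_derivative.

(** * Cauchy's formula *)

Section bisection.
Context {R : realType}.

Lemma nested_intervals (x l : nat -> R) : (forall n, 0 <= l n) ->
  (forall n, x n <= x n.+1) -> (forall n, x n.+1 + l n.+1 <= x n + l n) ->
  exists p, forall n, x n <= p <= x n + l n.
Proof.
move=> l0 xi xd.
have mx m n : (m <= n)%N -> x m <= x n by move/subnK <-; elim: (n - m)%N => // k; rewrite addSn => /le_trans; apply.
have md m n : (m <= n)%N -> x n + l n <= x m + l m.
  by move/subnK <-; elim: (n - m)%N => // k IH; rewrite addSn (le_trans (xd _)).
have ub n k : x k <= x n + l n.
  have [kn|nk] := leqP k n; first by rewrite (le_trans (mx _ _ kn))// lerDl.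
  by rewrite (le_trans _ (md _ _ (ltnW nk)))// lerDl.
have hs : has_sup (range x).
  by split; [exists (x 0), 0%N | exists (x 0 + l 0) => _ [k _ <-]].
exists (sup (range x)) => n; apply/andP; split.
  by apply: (ub_le_sup (proj2 hs)); exists n.
by apply: (ge_sup (proj1 hs)) => _ [k _ <-].
Qed.

(** Goursat's subdivision. If the unit square had a value of modulus m > 0, one of its four quarters
    would keep at least m / 4, and so on: nested squares of side l with values at least m l^2 shrink
    to a point, where the second hypothesis with m / 2 is contradicted. *)
Lemma bisection (e : R -> R -> R -> R[i]) :
  (forall x y l, 0 <= x -> 0 <= y -> 0 < l -> x + 2 * l <= 1 -> y + 2 * l <= 1 ->
    e x y (2 * l) = e x y l + e (x + l) y l + e x (y + l) l + e (x + l) (y + l) l) ->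
  (forall p q, 0 <= p <= 1 -> 0 <= q <= 1 -> forall eps, 0 < eps -> exists2 d, 0 < d &
    forall x y l, 0 <= x -> 0 <= y -> x + l <= 1 -> y + l <= 1 ->
      x <= p <= x + l -> y <= q <= y + l -> 0 < l < d -> nc (e x y l) <= eps * l ^+ 2) ->
  e 0 0 1 = 0.
Proof.
move=> add small; apply/nc_eq0/eqP/negP => /negP m0.
set m := nc (e 0 0 1) in m0.
have mp : 0 < m by rewrite lt_def m0 nc_ge0.
pose l (n : nat) : R := 2^-1 ^+ n.
have l0 n : 0 < l n by rewrite exprn_gt0.
have lS n : l n = 2 * l n.+1 by rewrite /l exprS mulrA divff// mul1r.
pose P n (s : R * R) := [/\ 0 <= s.1, 0 <= s.2, s.1 + l n <= 1, s.2 + l n <= 1 &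
  m * l n ^+ 2 <= nc (e s.1 s.2 (l n))].
(* [choice] asks for a total selection: states outside the invariant [P] are sent to an arbitrary
   pair. *)
have step (ns : nat * (R * R)) : exists s', P ns.1 ns.2 ->
    [/\ P ns.1.+1 s', ns.2.1 <= s'.1 <= ns.2.1 + l ns.1.+1 & ns.2.2 <= s'.2 <= ns.2.2 + l ns.1.+1].
  case: ns => n [x y] /=; set h := l n.+1.
  have h0 : 0 < h := l0 _.
  have [[x0 y0 x1 y1 big]|nP] := pselect (P n (x, y)); last by exists (0, 0) => /nP.
  move: x0 y0 x1 y1 big => /=; rewrite lS -/h => x0 y0 x1 y1.
  rewrite add// => big.
  have q (v : R[i]) : nc v <= m * h ^+ 2 \/ m * h ^+ 2 <= nc v.
    by case: (leP (nc v) (m * h ^+ 2)) => [|/ltW]; [left|right].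
  have T := le_trans big (le_trans (ncD _ _) (lerD (le_trans (ncD _ _) (lerD (ncD _ _) (lexx _))) (lexx _))).
  have [H|[H|[H|H]]] : (m * h ^+ 2 <= nc (e x y h)) \/ (m * h ^+ 2 <= nc (e (x + h) y h)) \/
     (m * h ^+ 2 <= nc (e x (y + h) h)) \/ (m * h ^+ 2 <= nc (e (x + h) (y + h) h)).
    have E : m * (2 * h) ^+ 2 = 4 * (m * h ^+ 2) by ring.
    move: T; rewrite E => T.
    case: (q (e x y h)) => A; last by left.
    case: (q (e (x + h) y h)) => B; last by right; left.
    case: (q (e x (y + h) h)) => C; last by right; right; left.
    by right; right; right; lra.
  - by exists (x, y) => _; split=> /=; rewrite -/h; [split; rewrite /= -/h //; lra|apply/andP; split; lra|apply/andP; split; lra].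
  - by exists (x + h, y) => _; split=> /=; rewrite -/h; [split; rewrite /= -/h //; lra|apply/andP; split; lra|apply/andP; split; lra].
  - by exists (x, y + h) => _; split=> /=; rewrite -/h; [split; rewrite /= -/h //; lra|apply/andP; split; lra|apply/andP; split; lra].
  - by exists (x + h, y + h) => _; split=> /=; rewrite -/h; [split; rewrite /= -/h //; lra|apply/andP; split; lra|apply/andP; split; lra].
have [f Hf] := choice step.
pose fix s n := if n is k.+1 then f (k, s k) else (0, 0).
have Ps n : P n (s n).
  elim: n => [|n IH]; first by split; rewrite /= ?/l ?expr0 ?add0r ?expr1n ?mulr1.
  by have [] := Hf (n, s n) IH.
have Ss n : (s n).1 <= (s n.+1).1 <= (s n).1 + l n.+1 /\ (s n).2 <= (s n.+1).2 <= (s n).2 + l n.+1.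
  by have [_ ? ?] := Hf (n, s n) (Ps n).
have [p Hp] : exists p, forall n, (s n).1 <= p <= (s n).1 + l n.
  apply: nested_intervals => n; first exact: ltW.
    by have [/andP[]] := Ss n.
  by have [/andP[_ A] _] := Ss n; rewrite (lS n); lra.
have [q Hq] : exists p, forall n, (s n).2 <= p <= (s n).2 + l n.
  apply: nested_intervals => n; first exact: ltW.
    by have [_ /andP[]] := Ss n.
  by have [_ /andP[_ A]] := Ss n; rewrite (lS n); lra.
have p01 : 0 <= p <= 1 by have := Hp 0%N; rewrite /= /l expr0 add0r.
have q01 : 0 <= q <= 1 by have := Hq 0%N; rewrite /= /l expr0 add0r.
have m2 : 0 < m / 2 by rewrite divr_gt0.
have [d d0 Hd] := small p q p01 q01 _ m2.
have [n nd] : exists n, l n < d.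
  have : (fun n => l n) @ \oo --> 0 by apply: cvg_expr; rewrite ger0_norm// invf_lt1// ltr1n.
  move=> /cvgrPdist_lt /(_ _ d0) [n _ Hn]; exists n.
  by have := Hn n (leqnn n); rewrite /= sub0r normrN gtr0_norm.
have [A B C D E] := Ps n.
have := Hd _ _ _ A B C D (Hp n) (Hq n); rewrite l0 nd => /(_ isT) F.
have := le_trans E F; rewrite ler_pM2r ?exprn_gt0//.
by rewrite leNgt ltr_pdivrMr// ltr_pMr// ltr1n.
Qed.

End bisection.

Section cauchy_formula.
Context {R : realType}.
Implicit Types (f g : R[i] -> R[i]) (z w a : R[i]).

Definition dcont f := forall z, nc z < 1 -> clim (cnbhs z) f (f z).
Definition hol f := forall z, nc z < 1 -> exists L, hasder f z L.

Lemma holP f : holomorphic_on_disk f <-> hol f.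
Proof.
split=> H z.
  by move=> /disk_nc /H /derivable_hasder ?; exists (cderiv f z).
by move=> /disk_nc /H [L]; exact: hasder_derivable.
Qed.

Lemma hol_dcont f : hol f -> dcont f.
Proof. by move=> H z /H [L]; exact: hasder_cont. Qed.

Lemma clim_id z : clim (cnbhs z) id z.
Proof. by move=> e e0; exists e => // w /ltW. Qed.

Lemma expi_lip (s t : R) : nc (expi s - expi t) <= 2 * `|s - t|.
Proof.
wlog st : s t / t <= s.
  by move=> W; have [/W//|/ltW/W] := leP t s; rewrite ncBC distrC.
move: st; rewrite le_eqVlt => /predU1P[->|ts]; first by rewrite !subrr nc0 normr0 mulr0.
rewrite -(@cint_FTC R t s expi (fun u => 'i * expi u)) //.
- rewrite ger0_norm; last by rewrite subr_ge0 ltW.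
  rewrite -[2]mulr1; apply: cint_bound; first exact: ltW.
    by apply: ccontZ; exact: ccont_expi.
  by move=> u _; rewrite ncM nc_expi mulr1 ncE /= expr0n add0r expr1n sqrtr1.
- by move=> u _; exact: cder_expi.
- exact: ccont_expi.
- by apply: ccontZ; exact: ccont_expi.
Qed.

Variables (r : R) (a : R[i]).
Hypotheses (r0 : 0 < r) (r1 : r < 1) (ar : nc a < r).

Let E (t : R) : R[i] := r%:C * expi t.
Let D t := E t - a.
(* Cauchy's formula at [a] follows by contracting the circle [E] to [a] along
   [Phi]: the closed form [f(Phi) dPhi / (Phi - a)] is integrated along the
   boundary of rectangles in the parameters [p, t], which bisection shows to be 0. *)
Let Phi (p t : R) := a + p%:C * D t.
Let K t := E t / D t.

Let ncE' t : nc (E t) = r.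
Proof. by rewrite ncM nc_expi mulr1 ncC_ge0// ltW. Qed.

Let D_le t : nc (D t) <= 2.
Proof. by apply: (le_trans (ncB _ _)); rewrite ncE'; move: ar r1; lra. Qed.

Let D_ge t : r - nc a <= nc (D t).
Proof. by rewrite -(ncE' t) nc_subl. Qed.

Let D0 t : D t != 0.
Proof.
by apply/eqP => h; have := D_ge t; rewrite h nc0 leNgt subr_gt0 ar.
Qed.

Let Phi_disk p t : 0 <= p <= 1 -> nc (Phi p t) < 1.
Proof.
move=> /andP[p0 p1]; apply: le_lt_trans r1.
have -> : Phi p t = (1 - p)%:C * a + p%:C * E t by rewrite /Phi /D rmorphB rmorph1; ring.
rewrite (le_trans (ncD _ _))// (ncM _ a) (ncM _ (E t)) ncE' !ncC_ge0 ?subr_ge0//.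
have : (1 - p) * nc a <= (1 - p) * r by rewrite ler_wpM2l ?subr_ge0// ltW.
lra.
Qed.

Let ccont_E u v : ccont u v E.
Proof. by apply: ccontZ; exact: ccont_expi. Qed.

Let ccont_D u v : ccont u v D.
Proof. have := ccontB (@ccont_E u v) (ccont_cst a); exact. Qed.

Let ccont_K u v : ccont u v K.
Proof. have := ccontM (@ccont_E u v) (ccontV (fun t _ => D0 t) (@ccont_D u v)); exact. Qed.

Let kap := r / (r - nc a).

Let K_le t : nc (K t) <= kap.
Proof.
rewrite /K ncM ncV ncE' ler_wpM2l ?(ltW r0)// lef_pV2 ?posrE ?subr_gt0//.
by rewrite (lt_le_trans _ (D_ge t))// subr_gt0.
Qed.

(** The two components of the form g(Phi) dPhi / (Phi - a). Along [p] the quotient dPhi / (Phi - a)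
    is dp / p, and along [t] it is ['i * K t] dt, which does not depend on [p]. *)
Let H g t p1 p2 := cint p1 p2 (fun p => g (Phi p t) / p%:C).
Let V g p t1 t2 := cint t1 t2 (fun t => g (Phi p t) * ('i * K t)).

Let ccont_H g t p1 p2 : dcont g -> 0 < p1 -> p2 <= 1 ->
  ccont p1 p2 (fun p => g (Phi p t) / p%:C).
Proof.
move=> cg h1 h2; apply: ccontM.
  apply: ccont_comp => [|p /andP[q1 q2]].
    by have := ccontD (ccont_cst a) (ccontM (@ccont_ofreal _ p1 p2) (ccont_cst (D t))); exact.
  by apply/cg/Phi_disk; rewrite (le_trans (ltW h1) q1) (le_trans q2 h2).
apply: ccontV; last exact: ccont_ofreal.
move=> p /andP[q1 _].
by rewrite (fmorph_eq0 (real_complex R)) gt_eqF// (lt_le_trans h1).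
Qed.

Let ccont_gPhi g p t1 t2 : dcont g -> 0 <= p <= 1 -> ccont t1 t2 (fun t => g (Phi p t)).
Proof.
move=> cg p01; apply: ccont_comp => [|t _]; last by apply/cg/Phi_disk.
by have := ccontD (ccont_cst a) (ccontZ p%:C (@ccont_D t1 t2)); exact.
Qed.

Let ccont_V g p t1 t2 : dcont g -> 0 <= p <= 1 -> ccont t1 t2 (fun t => g (Phi p t) * ('i * K t)).
Proof. by move=> cg p01; have := ccontM (@ccont_gPhi g p t1 t2 cg p01) (ccontZ 'i (@ccont_K t1 t2)); exact. Qed.

Let Phi_diff p t p' t' : 0 <= p' <= 1 ->
  nc (Phi p t - Phi p' t') <= 2 * `|p - p'| + 2 * `|t - t'|.
Proof.
move=> /andP[p0 p1].
have -> : Phi p t - Phi p' t' = (p - p')%:C * D t + p'%:C * (r%:C * (expi t - expi t')).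
  by rewrite /Phi /D /E rmorphB; ring.
rewrite (le_trans (ncD _ _))// lerD//.
  by rewrite ncM ncC mulrC ler_wpM2r.
rewrite !ncM !ncC_ge0// ?(ltW r0)// mulrA (le_trans _ (expi_lip _ _))//.
by rewrite ler_piMl ?nc_ge0// mulr_ile1// ltW.
Qed.

Let boundary g p1 p2 t1 t2 := (H g t2 p1 p2 - H g t1 p1 p2) - (V g p2 t1 t2 - V g p1 t1 t2).

(** The constant [c] and the centre cancel between opposite sides, and both differences integrate to
    (p2 - p1) L r (e^(i t2) - e^(i t1)). *)
Let boundary_affine c L p1 p2 t1 t2 : 0 < p1 -> p1 < p2 -> p2 <= 1 -> t1 < t2 ->
  boundary (fun z => c + z * L) p1 p2 t1 t2 = 0.
Proof.
move=> h1 h12 h2 t12.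
have cg : dcont (fun z => c + z * L).
  by move=> z _; have := climD (clim_cst c) (climM (clim_id z) (clim_cst L)); exact.
have p01 p : p1 <= p <= p2 -> 0 <= p <= 1.
  by move=> /andP[u v]; rewrite (le_trans (ltW h1) u) (le_trans v h2).
have q1 : 0 <= p1 <= 1 by rewrite p01// lexx ltW.
have q2 : 0 <= p2 <= 1 by rewrite p01// lexx ltW.
have cH t := @ccont_H _ t p1 p2 cg h1 h2.
have cV p := @ccont_V _ p t1 t2 cg.
rewrite /boundary /H /V -cintB; [|exact: (cH t2)|exact: (cH t1)].
rewrite -[X in _ - X]cintB; [|exact: (cV p2)|exact: (cV p1)].
rewrite (@eq_cint R p1 p2 _ (fun=> L * r%:C * (expi t2 - expi t1))); last first.
  move=> p /andP[u v]; rewrite /Phi /D /E.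
  have p0 : p%:C != 0 by rewrite (fmorph_eq0 (real_complex R)) gt_eqF// (lt_le_trans h1).
  by field.
rewrite (@eq_cint R t1 t2 _ (fun t => (p2 - p1)%:C * L * r%:C * ('i * expi t))); last first.
  move=> t _; rewrite /Phi /K rmorphB /=; have := D0 t; rewrite /E => dt; field; exact: dt.
rewrite (@cint_FTC R p1 p2 (fun p => p%:C * (L * r%:C * (expi t2 - expi t1))))//; last 3 first.
- move=> p _; apply: cder_eq (cderM (cder_ofreal p) (cder_cst _ _)) _.
  by rewrite mul1r mulr0 addr0.
- by apply: ccontM; [exact: ccont_ofreal|exact: ccont_cst].
- exact: ccont_cst.
rewrite (@cint_FTC R t1 t2 (fun t => (p2 - p1)%:C * L * r%:C * expi t))//; last 3 first.
- by move=> t _; apply: cder_mulC (cder_expi t).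
- by apply: ccontZ; exact: ccont_expi.
- by do 2 apply: ccontZ; exact: ccont_expi.
by rewrite rmorphB; ring.
Qed.

Let boundaryD g h p1 p2 t1 t2 : dcont g -> dcont h -> 0 < p1 -> p1 < p2 -> p2 <= 1 ->
  boundary (fun z => g z + h z) p1 p2 t1 t2 = boundary g p1 p2 t1 t2 + boundary h p1 p2 t1 t2.
Proof.
move=> cg ch h1 h12 h2.
have q1 : 0 <= p1 <= 1 by rewrite (ltW h1) (le_trans (ltW h12)).
have q2 : 0 <= p2 <= 1 by rewrite h2 (le_trans (ltW h1) (ltW h12)).
have HD t : H (fun z => g z + h z) t p1 p2 = H g t p1 p2 + H h t p1 p2.
  rewrite /H -cintD; [|exact: (ccont_H _ cg)|exact: (ccont_H _ ch)].
  by apply: eq_cint => p _; rewrite mulrDl.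
have VD p : 0 <= p <= 1 -> V (fun z => g z + h z) p t1 t2 = V g p t1 t2 + V h p t1 t2.
  move=> p01; rewrite /V -cintD; [|exact: (ccont_V cg)|exact: (ccont_V ch)].
  by apply: eq_cint => t _; rewrite mulrDl.
by rewrite /boundary !HD !VD//; ring.
Qed.

(** There are two sides of each kind, each estimated with the factor 2 of [cint_bound]: this is the
    4. *)
Let boundary_small g p1 p2 t1 t2 M : dcont g -> 0 < p1 -> p1 < p2 -> p2 <= 1 -> t1 < t2 ->
  (forall p t, p1 <= p <= p2 -> t1 <= t <= t2 -> nc (g (Phi p t)) <= M) ->
  nc (boundary g p1 p2 t1 t2) <= 4 * M * ((p2 - p1) / p1 + kap * (t2 - t1)).
Proof.
move=> cg h1 h12 h2 t12 gM.
have q1 : 0 <= p1 <= 1 by rewrite (ltW h1) (le_trans (ltW h12)).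
have q2 : 0 <= p2 <= 1 by rewrite h2 (le_trans (ltW h1) (ltW h12)).
have HB t : t1 <= t <= t2 -> nc (H g t p1 p2) <= 2 * (M / p1) * (p2 - p1).
  move=> tt; apply: cint_bound; [exact: ltW|exact: ccont_H|].
  move=> p /andP[u v]; have p0 : 0 < p by rewrite (lt_le_trans h1).
  rewrite ncM ncV ncC_ge0 ?(ltW p0)//; apply: ler_pM; rewrite ?nc_ge0 ?invr_ge0 ?(ltW p0)//.
    by apply: gM => //; rewrite u v.
  by rewrite lef_pV2 ?posrE.
have VB p : p1 <= p <= p2 -> nc (V g p t1 t2) <= 2 * (M * kap) * (t2 - t1).
  move=> pp; apply: cint_bound; [exact: ltW|apply: ccont_V => //|].
    by move: pp => /andP[u v]; rewrite (le_trans (ltW h1) u) (le_trans v h2).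
  move=> t tt; rewrite ncM; apply: ler_pM; rewrite ?nc_ge0//; first exact: gM.
  by rewrite ncM ncE /= expr0n add0r expr1n sqrtr1 mul1r.
rewrite (le_trans (ncB _ _))//.
have e1 : t1 <= t1 <= t2 by rewrite lexx ltW.
have e2 : t1 <= t2 <= t2 by rewrite lexx ltW.
have f1 : p1 <= p1 <= p2 by rewrite lexx ltW.
have f2 : p1 <= p2 <= p2 by rewrite lexx ltW.
have B1 := le_trans (ncB (H g t2 p1 p2) (H g t1 p1 p2)) (lerD (HB _ e2) (HB _ e1)).
have B2 := le_trans (ncB (V g p2 t1 t2) (V g p1 t1 t2)) (lerD (VB _ f2) (VB _ f1)).
apply: le_trans (lerD B1 B2) _.
by rewrite le_eqVlt; apply/orP; left; apply/eqP; field; rewrite gt_eqF.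
Qed.

(** On a small rectangle [f] is affine up to a remainder o(l); the affine part contributes 0 and the
    remainder o(l) times the side. Starting at [s > 0] keeps away from the pole of 1 / p. *)
Let boundary0 f s : hol f -> 0 < s -> s < 1 -> boundary f s 1 0 (2 * pi) = 0.
Proof.
move=> hf s0 s1.
have cf := hol_dcont hf.
pose X := 1 - s; pose Y : R := 2 * pi.
have X0 : 0 < X by rewrite subr_gt0.
have Y0 : 0 < Y by rewrite mulr_gt0 ?pi_gt0.
pose e x y l := boundary f (s + X * x) (s + X * (x + l)) (Y * y) (Y * (y + l)).
suff : e 0 0 1 = 0.
  by rewrite /e !mulr0 !add0r !mulr1 addr0 /X subrKC.
have sX x : 0 <= x -> 0 < s + X * x by move=> x0; rewrite ltr_wpDr// mulr_ge0// ltW.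
have sX1 x : x <= 1 -> s + X * x <= 1.
  by move=> x1; rewrite -[leRHS](subrKC s) lerD2l ger_pMr.
apply: bisection.
  move=> x y l x0 y0 l0 x1 y1.
  have [A B C] : [/\ x < x + l, x + l < x + 2 * l & x + l <= 1] by split; lra.
  have [A' B' C'] : [/\ y < y + l, y + l < y + 2 * l & y + l <= 1] by split; lra.
  have mX u v : u <= v -> s + X * u <= s + X * v by rewrite lerD2l ler_pM2l.
  have mY u v : u <= v -> Y * u <= Y * v by rewrite ler_pM2l.
  have HS t : H f t (s + X * x) (s + X * (x + 2 * l)) =
      H f t (s + X * x) (s + X * (x + l)) + H f t (s + X * (x + l)) (s + X * (x + 2 * l)).
    by apply: cint_split; [rewrite !mX ?(ltW A) ?(ltW B)|apply: ccont_H; auto].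
  have VS p : 0 <= p <= 1 -> V f p (Y * y) (Y * (y + 2 * l)) =
      V f p (Y * y) (Y * (y + l)) + V f p (Y * (y + l)) (Y * (y + 2 * l)).
    by move=> p01; apply: cint_split; [rewrite !mY ?(ltW A') ?(ltW B')|apply: ccont_V].
  have E2 u : u + 2 * l = u + l + l by ring.
  rewrite /e /boundary !HS !VS; last 2 first.
    by rewrite (ltW (sX _ _))// sX1// ltW// (lt_le_trans A).
    by rewrite (ltW (sX _ _)) ?sX1// (le_trans x0)// ltW// (lt_trans A).
  by rewrite !E2; ring.
move=> p q p01 q01 eps eps0.
set z0 := Phi (s + X * p) (Y * q).
have P01 : 0 <= s + X * p <= 1.
  by move: p01 => /andP[u v]; rewrite ltW ?sX//= sX1.
have z01 : nc z0 < 1 by apply: Phi_disk.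
have [L dL] := hf _ z01.
(* A cell of side l has its [Phi]-image within [C1 * l] of [z0], and the weights of its sides add up
   to at most [W * l]. With the 4 of [boundary_small] the remainder is at most its slope times
   [C2 * l ^+ 2], so differentiability is used with [eps / C2]. *)
pose C1 := 2 * X + 2 * Y; pose W := X / s + kap * Y; pose C2 := 4 * C1 * W.
have kap0 : 0 < kap by rewrite divr_gt0 ?subr_gt0.
have C10 : 0 < C1 by rewrite addr_gt0// mulr_gt0.
have W0 : 0 < W.
  have k1 : 0 < X / s by rewrite divr_gt0.
  have k2 : 0 < kap * Y by rewrite mulr_gt0.
  by rewrite addr_gt0.
have C20 : 0 < C2 by rewrite /C2 (mulr_gt0 (mulr_gt0 _ C10)).
have [d d0 Hd] := (hasderP _ _ _).1 dL _ (divr_gt0 eps0 C20).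
exists (d / C1); first by rewrite divr_gt0.
move=> x y l x0 y0 x1 y1 xp yq /andP[l0 ld].
pose Rm z := f z - (f z0 + (z - z0) * L).
have caff : dcont (fun z => (f z0 - z0 * L) + z * L).
  by move=> z _; have := climD (clim_cst (f z0 - z0 * L)) (climM (clim_id z) (clim_cst L)); exact.
have cRm : dcont Rm.
  move=> z z1; apply: climB (cf z z1) _.
  by have := climD (clim_cst (f z0)) (climM (climB (clim_id z) (clim_cst z0)) (clim_cst L)); exact.
have xl : s + X * x < s + X * (x + l) by rewrite ltrD2l ltr_pM2l// ltrDl.
have yl : Y * y < Y * (y + l) by rewrite ltr_pM2l// ltrDl.
have fE : f = (fun z => ((f z0 - z0 * L) + z * L) + Rm z) by apply/funext => z; rewrite /Rm; ring.
rewrite /e {1}fE boundaryD ?boundary_affine ?add0r//; [|exact: sX|exact: sX1|exact: sX|exact: sX1].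
have B := @boundary_small Rm (s + X * x) (s + X * (x + l)) (Y * y) (Y * (y + l)) (eps / C2 * (C1 * l)) cRm
  (sX _ x0) xl (sX1 _ x1) yl.
have {}B := B _; apply: le_trans (B _) _.
  move=> p' t' pp tt; have D1 : nc (Phi p' t' - z0) <= C1 * l.
    apply: le_trans (Phi_diff _ _ _ P01) _.
    have -> : C1 * l = 2 * (X * l) + 2 * (Y * l) by rewrite /C1; ring.
    apply: lerD; rewrite ler_pM2l//.
      move: xp => /andP[xp1 xp2]; move: pp => /andP[pp1 pp2].
      have := ler_wpM2l (ltW X0) xp1; have := ler_wpM2l (ltW X0) xp2.
      by rewrite ler_norml; move: pp1 pp2; rewrite !mulrDr => *; apply/andP; split; lra.
    move: yq => /andP[yq1 yq2]; move: tt => /andP[tt1 tt2].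
    have := ler_wpM2l (ltW Y0) yq1; have := ler_wpM2l (ltW Y0) yq2.
    by rewrite ler_norml; move: tt1 tt2; rewrite !mulrDr => *; apply/andP; split; lra.
  have := Hd (Phi p' t' - z0); rewrite subrKC => /(_ _)/wrap[|Q].
    by rewrite (le_lt_trans D1)// mulrC -ltr_pdivlMr.
  rewrite /Rm opprD addrA (le_trans Q)// ler_wpM2l// ltW// divr_gt0//.
have -> : s + X * (x + l) - (s + X * x) = X * l by ring.
have -> : Y * (y + l) - Y * y = Y * l by ring.
have -> : eps * l ^+ 2 = 4 * (eps / C2 * (C1 * l)) * (W * l).
  by rewrite /C2; field; rewrite ?(gt_eqF W0) ?(gt_eqF C10).
have ge : 0 <= 4 * (eps / C2 * (C1 * l)).
  by apply: ltW; rewrite mulr_gt0// mulr_gt0 ?divr_gt0 ?mulr_gt0.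
rewrite (ler_wpM2l ge)//.
rewrite /W [leRHS]mulrDl -(mulrA kap) lerD2r (mulrAC X).
rewrite (ler_wpM2r (ltW l0))// (ler_wpM2l (ltW X0))//.
by rewrite lef_pV2 ?posrE ?sX// lerDl mulr_ge0// ltW.
Qed.

(** Since [E] is periodic, the sides t = 0 and t = 2 pi cancel, so the integral over the contracted
    circle does not depend on the contraction factor; letting it tend to 0 replaces [f] by its value
    at [a]. The kernel integral on the right is evaluated later, in [cint_kernel]. *)
Lemma cauchy_formula f : hol f ->
  cint 0 (2 * pi) (fun t => f (r%:C * expi t) * (r%:C * expi t / (r%:C * expi t - a))) =
  f a * cint 0 (2 * pi) (fun t => r%:C * expi t / (r%:C * expi t - a)).
Proof.
move=> hf; have cf := hol_dcont hf.
have pi20 : (0 : R) <= 2 * pi by rewrite mulr_ge0 ?pi_ge0.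
have V1 s : 0 < s < 1 -> V f 1 0 (2 * pi) = V f s 0 (2 * pi).
  move=> /andP[s0 s1]; have := boundary0 hf s0 s1; rewrite /boundary.
  have -> : H f (2 * pi) s 1 = H f 0 s 1.
    by apply: eq_cint => p _; rewrite /Phi /D /E expi2pi expi0.
  by rewrite subrr sub0r => /eqP; rewrite oppr_eq0 subr_eq0 => /eqP.
suff VE : V f 1 0 (2 * pi) = f a * cint 0 (2 * pi) (fun t => 'i * K t).
  have i0 : 'i != 0 :> R[i] by rewrite eq_complex /= oner_eq0 andbF.
  have cfE : ccont 0 (2 * pi) (fun t => f (E t)).
    have := @ccont_comp _ 0 (2 * pi) f E (@ccont_E _ _); apply => t _.
    by apply: cf; rewrite ncE'.
  apply: (mulfI i0); rewrite [RHS]mulrCA.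
  rewrite -(cintZ 'i (@ccont_K 0 (2 * pi))) -(cintZ 'i (ccontM cfE (@ccont_K 0 (2 * pi)))).
  rewrite -VE; apply: eq_cint => t _.
  have -> : Phi 1 t = E t by rewrite /Phi rmorph1 mul1r /D subrKC.
  by rewrite mulrCA.
apply: subr0_eq; apply: nc_eq0; apply/eqP; rewrite eq_le nc_ge0 andbT.
apply/ler_addgt0Pl => e e0; rewrite addr0.
have kap0 : 0 < kap by rewrite divr_gt0 ?subr_gt0.
pose M := 2 * kap * (2 * pi).
have M0 : 0 < M by apply: mulr_gt0; apply: mulr_gt0 => //; exact: pi_gt0.
have [d d0 Hd] := cf a (lt_trans ar r1) _ (divr_gt0 e0 M0).
(* As [D] has modulus at most 2, the circle contracted by [s] lies within 2 s < d of [a]. *)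
pose s := Num.min (1 / 2) (d / 3).
have s0 : 0 < s by rewrite lt_min !divr_gt0.
have s1 : s < 1 by rewrite gt_min ltr_pdivrMr// mul1r ltr1n.
have s01 : 0 <= s <= 1 by rewrite !ltW.
have sd3 : s <= d / 3 by rewrite ge_min lexx orbT.
have sd : 2 * s < d by move: sd3; lra.
rewrite (V1 s) ?s0//.
have cK := ccontZ (f a) (ccontZ 'i (@ccont_K 0 (2 * pi))).
have cV := @ccont_V f s 0 (2 * pi) cf s01.
rewrite -cintZ; last exact: (ccontZ 'i (@ccont_K 0 (2 * pi))).
rewrite -(cintB cV cK).
apply: (@le_trans _ _ (2 * (e / M * kap) * (2 * pi - 0))); last first.
  have fe (k p : R) : p != 0 -> k != 0 -> 2 * (e / (2 * k * (2 * p)) * k) * (2 * p) = e.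
    by move=> h1 h2; field; rewrite h1 h2.
  by rewrite subr0 fe// gt_eqF// pi_gt0.
have CB := @cint_bound R 0 (2 * pi) _ (e / M * kap) pi20 (ccontB cV cK).
apply: CB => t _; rewrite -mulrBl ncM; apply: ler_pM; rewrite ?nc_ge0//.
  apply: Hd; rewrite /Phi addrAC subrr add0r ncM ncC_ge0 ?(ltW s0)//.
  by rewrite (le_lt_trans _ sd)// mulrC ler_pM2r.
by rewrite ncM ncE /= expr0n add0r expr1n sqrtr1 mul1r.
Qed.

End cauchy_formula.

(** * Power series *)

Section power_series.
Context {R : realType}.
Implicit Types (c d : nat -> R[i]) (f g : R[i] -> R[i]) (z w : R[i]).

Lemma geom_sum_le (q : R) n : 0 <= q < 1 -> \sum_(k < n) q ^+ k <= (1 - q)^-1.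
Proof.
move=> /andP[q0 q1]; have q10 : 0 < 1 - q by rewrite subr_gt0.
rewrite -[leRHS]mul1r ler_pdivlMr// mulrC.
have -> : (1 - q) * \sum_(k < n) q ^+ k = 1 - q ^+ n.
  elim: n => [|n IH]; first by rewrite big_ord0 mulr0 expr0 subrr.
  by rewrite big_ord_recr /= mulrDr IH exprSr; ring.
by rewrite gerBl exprn_ge0.
Qed.

Lemma natr_geom_le (q : R) n : 0 <= q < 1 -> n%:R * q ^+ n <= (1 - q)^-1.
Proof.
move=> q01; have /andP[q0 q1] := q01; apply: le_trans (geom_sum_le n q01).
rewrite -[n in n%:R]card_ord -sumr_const mulr_suml ler_sum// => i _.
by rewrite mul1r ler_wiXn2l ?(ltW q1)// ltnW.
Qed.

Definition psum c n z := \sum_(k < n) c k * z ^+ k.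

Lemma psumS c n z : psum c n.+1 z = psum c n z + c n * z ^+ n.
Proof. by rewrite /psum big_ord_recr. Qed.

Lemma psumB c d n z : psum (fun k => c k - d k) n z = psum c n z - psum d n z.
Proof. by rewrite /psum -sumrB; apply: eq_bigr => k _; rewrite mulrBl. Qed.

Lemma psum_cauchy c (rho M q : R) z n m : 0 < rho -> 0 <= q < 1 ->
  (forall k, nc (c k) * rho ^+ k <= M) -> nc z <= q * rho ->
  nc (psum c (n + m) z - psum c n z) <= M * (1 - q)^-1 * q ^+ n.
Proof.
move=> r0 q01 cM zq; have /andP[q0 q1] := q01.
rewrite /psum big_split_ord /= addrAC subrr add0r (le_trans (nc_sum _ _))//.
apply: (@le_trans _ _ (\sum_(i < m) M * q ^+ (n + i))).
  apply: ler_sum => i _; rewrite ncM ncX.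
  apply: (@le_trans _ _ (nc (c (n + i)%N) * (q * rho) ^+ (n + i))).
    by rewrite ler_wpM2l ?nc_ge0// lerXn2r// ?nnegrE ?nc_ge0// mulr_ge0// ltW.
  by rewrite exprMn mulrCA mulrC ler_wpM2r ?exprn_ge0.
have M0 : 0 <= M by apply: le_trans (cM 0%N); rewrite mulr_ge0 ?nc_ge0 ?exprn_ge0// ltW.
under eq_bigr do rewrite exprD mulrA.
rewrite -mulr_sumr mulrAC ler_wpM2r ?exprn_ge0// ler_wpM2l//; exact: geom_sum_le.
Qed.

Lemma clim_unique (T : Type) (G : set_system T) {FG : ProperFilter G} (F : T -> R[i]) l m :
  clim G F l -> clim G F m -> l = m.
Proof.
move=> Fl Fm; apply: subr0_eq; apply: nc_eq0; apply/eqP; rewrite eq_le nc_ge0 andbT.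
apply/ler_addgt0Pl => e e0; rewrite addr0.
have e2 : 0 < e / 2 by rewrite divr_gt0.
have Glm : G ([set x | nc (F x - l) <= e / 2] `&` [set x | nc (F x - m) <= e / 2]).
  by apply: filterI; [exact: Fl|exact: Fm].
have [x [/= h1 h2]] := filter_ex Glm.
by rewrite (le_trans (nc_triangle _ _ (F x)))// (splitr e) lerD// ncBC.
Qed.

Lemma clim_nc_le (T : Type) (G : set_system T) {FG : ProperFilter G} (F : T -> R[i]) l B :
  clim G F l -> G [set x | nc (F x) <= B] -> nc l <= B.
Proof.
move=> Fl FB; apply/ler_addgt0Pl => e e0.
have GlB : G ([set x | nc (F x - l) <= e] `&` [set x | nc (F x) <= B]).
  by apply: filterI; [exact: Fl|].
have [x [/= h1 h2]] := filter_ex GlB.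
by rewrite -[l](subrK (F x)) (le_trans (ncD _ _))// lerD// ncBC.
Qed.

Lemma psum_tail c (rho M q : R) z l n : 0 < rho -> 0 <= q < 1 ->
  (forall k, nc (c k) * rho ^+ k <= M) -> nc z <= q * rho ->
  clim \oo (psum c ^~ z) l -> nc (l - psum c n z) <= M * (1 - q)^-1 * q ^+ n.
Proof.
move=> r0 q01 cM zq cl.
have cl' : clim \oo (fun k => psum c k z - psum c n z) (l - psum c n z).
  by apply: climB => //; exact: clim_cst.
apply: (@clim_nc_le _ \oo _ _ _ _ cl'); exists n => // k /= nk.
by rewrite -(subnKC nk); exact: (psum_cauchy _ _ r0 q01 cM zq).
Qed.

Lemma geometric_cauchy (x : nat -> R) (C q : R) : 0 <= q < 1 ->
  (forall n m, `|x (n + m)%N - x n| <= C * q ^+ n) ->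
  exists l, forall e, 0 < e -> \forall n \near \oo, `|x n - l| <= e.
Proof.
move=> /andP[q0 q1] xC.
have C0 : 0 <= C by have := xC 0%N 0%N; rewrite expr0 mulr1; exact: (le_trans (normr_ge0 _)).
have cx : cvg (x @ \oo).
  apply/cauchy_cvgP; apply: cauchy_exP => e e0.
  have : (fun n => q ^+ n) @ \oo --> 0 by apply: cvg_expr; rewrite ger0_norm.
  have C1 : 0 < C + 1 by rewrite ltr_wpDl.
  move=> /cvgrPdist_lt /(_ _ (divr_gt0 e0 C1)) [N _ HN].
  exists (x N); exists N => // n /= Nn; rewrite /ball /= distrC -(subnKC Nn).
  apply: (le_lt_trans (xC _ _)); have := HN N (leqnn N).
  rewrite /= sub0r normrN ger0_norm ?exprn_ge0// ltr_pdivlMr//.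
  by apply: le_lt_trans; rewrite mulrC ler_wpM2l ?exprn_ge0// lerDl.
exists (lim (x @ \oo)) => e e0; move: cx => /cvgrPdist_le /(_ e e0); apply: filterS => n.
by rewrite distrC.
Qed.

Lemma nc_geometric_cauchy (F : nat -> R[i]) (C q : R) : 0 <= q < 1 ->
  (forall n m, nc (F (n + m)%N - F n) <= C * q ^+ n) -> exists l, clim \oo F l.
Proof.
move=> q01 FC.
have [l1 H1] : exists l, forall e, 0 < e -> \forall n \near \oo, `|cre (F n) - l| <= e.
  by apply: (@geometric_cauchy _ C _ q01) => n m; rewrite -creB; exact: le_trans (nc_re _) (FC _ _).
have [l2 H2] : exists l, forall e, 0 < e -> \forall n \near \oo, `|cim (F n) - l| <= e.
  by apply: (@geometric_cauchy _ C _ q01) => n m; rewrite -cimB; exact: le_trans (nc_im _) (FC _ _).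
exists (l1 +i* l2) => e e0; have e2 : 0 < e / 2 by rewrite divr_gt0.
apply: filterS2 (H1 _ e2) (H2 _ e2) => n /= h1 h2.
by rewrite (le_trans (nc_le_re_im _))// creB cimB /= (splitr e) lerD.
Qed.

Lemma psum_cvg c (rho M q : R) z : 0 < rho -> 0 <= q < 1 ->
  (forall k, nc (c k) * rho ^+ k <= M) -> nc z <= q * rho ->
  exists l, clim \oo (psum c ^~ z) l.
Proof.
move=> r0 q01 cM zq; apply: (nc_geometric_cauchy q01) => n m.
exact: (psum_cauchy n m r0 q01 cM zq).
Qed.

(** If all lower coefficients vanish, the term of degree k is minus the tail beyond it, which is
    smaller by a factor of order q when |z| = q rho; take q small. *)
Lemma psum_unique0 c (rho M : R) : 0 < rho -> (forall k, nc (c k) * rho ^+ k <= M) ->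
  (forall z, nc z < rho -> clim \oo (psum c ^~ z) 0) -> forall k, c k = 0.
Proof.
move=> r0 cM c0 k; elim: k {-2}k (leqnn k) => [|n IH] k.
  rewrite leqn0 => /eqP ->.
  apply: (@clim_unique nat \oo _ (psum c ^~ 0)); last by apply: c0; rewrite nc0.
  move=> e e0; exists 1%N => // n; rewrite /=; case: n => // n _.
  rewrite /psum big_ord_recl big1 => [|i _]; last by rewrite expr0n mulr0.
  by rewrite expr0 mulr1 addr0 subrr nc0 ltW.
rewrite leq_eqVlt ltnS => /predU1P[->{k}|]; last exact: IH.
apply: nc_eq0; apply/eqP; rewrite eq_le nc_ge0 andbT leNgt; apply/negP => ck.
set k := n.+1 in ck.
have M0 : 0 <= M by apply: le_trans (cM 0%N); rewrite mulr_ge0 ?nc_ge0 ?exprn_ge0// ltW.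
have D0 : 0 < 4 * (M + 1) by rewrite mulr_gt0// ltr_wpDl.
(* The second bound contradicts the inequality |c_k| rho^k <= 2 M q obtained from the tail. *)
pose q := Num.min (1 / 2) (nc (c k) * rho ^+ k / (4 * (M + 1))).
have P0 : 0 < nc (c k) * rho ^+ k by rewrite mulr_gt0// exprn_gt0.
have q0 : 0 < q by rewrite lt_min divr_gt0//= divr_gt0.
have q12 : q <= 1 / 2 by rewrite ge_min lexx.
have q01 : 0 <= q < 1 by apply/andP; split; lra.
pose z : R[i] := (q * rho)%:C.
have nz : nc z = q * rho by rewrite ncC_ge0// mulr_ge0 ?ltW.
have zr : nc z < rho by rewrite nz -[ltRHS]mul1r ltr_pM2r//; lra.
have zq : nc z <= q * rho by rewrite nz.
have := psum_tail k.+1 r0 q01 cM zq (c0 z zr).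
rewrite psumS (_ : psum c k z = 0); last first.
  by rewrite /psum big1// => i _; rewrite IH ?mul0r// -ltnS.
rewrite !add0r ncN ncM ncX nz exprMn => h.
have h2 : (1 - q)^-1 <= 2 by rewrite -[leRHS]invrK lef_pV2 ?posrE; lra.
have h3 : nc (c k) * rho ^+ k <= M * 2 * q.
  have qk : 0 < q ^+ k by rewrite exprn_gt0.
  rewrite -(ler_pM2r qk); apply: (@le_trans _ _ (M * (1 - q)^-1 * q ^+ k.+1)).
    by apply: le_trans h; rewrite mulrAC mulrA.
  by rewrite exprS mulrA (ler_wpM2r (ltW qk))// (ler_wpM2r (ltW q0))// (ler_wpM2l M0).
have h4 : q <= nc (c k) * rho ^+ k / (4 * (M + 1)) by rewrite ge_min lexx orbT.
move: h4; rewrite ler_pdivlMr// => h4.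
have := mulr_ge0 M0 (ltW q0); lra.
Qed.

(** Radius of convergence at least 1, in the form of Cauchy estimates at every smaller radius. *)
Definition pbound c := forall r : R, 0 < r < 1 -> exists M : R, forall k, nc (c k) * r ^+ k <= M.
Definition pser c f := pbound c /\ forall z, nc z < 1 -> clim \oo (psum c ^~ z) (f z).

Lemma psum_unique c d f (rho M N : R) : 0 < rho ->
  (forall k, nc (c k) * rho ^+ k <= M) -> (forall k, nc (d k) * rho ^+ k <= N) ->
  (forall z, nc z < rho -> clim \oo (psum c ^~ z) (f z)) ->
  (forall z, nc z < rho -> clim \oo (psum d ^~ z) (f z)) -> c = d.
Proof.
move=> r0 cM dN cf df; apply/funext => k; apply: subr0_eq.
apply: (@psum_unique0 (fun k => c k - d k) rho (M + N)) => // [j|z zr].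
  apply: (@le_trans _ _ ((nc (c j) + nc (d j)) * rho ^+ j)).
    by rewrite ler_wpM2r ?ncB// exprn_ge0// ltW.
  by rewrite mulrDl lerD.
have E : (psum (fun k => c k - d k))^~ z = (fun n => psum c n z - psum d n z).
  by apply/funext => n; rewrite psumB.
rewrite E -(subrr (f z)).
have := climB (cf z zr) (df z zr); exact.
Qed.

Lemma pser_unique c d f : pser c f -> pser d f -> c = d.
Proof.
move=> [bc cf] [bd df].
have h : 0 < (2^-1 : R) < 1 by rewrite invr_gt0 ltr0n invf_lt1// ltr1n.
have [M cM] := bc _ h; have [N dN] := bd _ h; have /andP[h0 h1] := h.
by apply: (psum_unique h0 cM dN (f := f)) => z zr; [apply: cf|apply: df]; exact: lt_trans zr h1.
Qed.

(** The factor k is paid for by a slightly larger radius s, because k (r / s)^k is bounded. *)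
Lemma pbound_natr c : pbound c -> pbound (fun k => k%:R * c k).
Proof.
move=> bc r /andP[r0 r1]; pose s := (1 + r) / 2.
have s01 : 0 < s < 1 by rewrite /s; apply/andP; split; lra.
have /andP[s0 s1] := s01; have rs : r < s by rewrite /s; lra.
have [M cM] := bc _ s01; pose q := r / s.
have q01 : 0 <= q < 1 by rewrite divr_ge0 ?(ltW s0) ?(ltW r0)//= ltr_pdivrMr// mul1r.
have M0 : 0 <= M by apply: le_trans (cM 0%N); rewrite mulr_ge0 ?nc_ge0 ?exprn_ge0// ltW.
exists (M * (1 - q)^-1) => k; rewrite ncM.
have -> : nc (k%:R : R[i]) = k%:R by rewrite -(rmorph_nat (real_complex R)) ncC_ge0.
have -> : r = s * q by rewrite /q mulrC divfK// gt_eqF.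
rewrite exprMn (_ : _ * _ = nc (c k) * s ^+ k * (k%:R * q ^+ k)); last by ring.
apply: ler_pM; rewrite ?mulr_ge0 ?nc_ge0 ?exprn_ge0 ?natr_geom_le//; last by case/andP: q01.
exact: ltW.
Qed.

Definition dcoef c k : R[i] := k.+1%:R * c k.+1.

Lemma pbound_dcoef c : pbound c -> pbound (dcoef c).
Proof.
move=> /pbound_natr bc r r01; have [M cM] := bc r r01; have /andP[r0 _] := r01.
by exists (M / r) => k; rewrite ler_pdivlMr// -mulrA -exprSr; exact: cM.
Qed.

Lemma pbound_cvg c z : pbound c -> nc z < 1 -> exists l, clim \oo (psum c ^~ z) l.
Proof.
move=> bc z1; have z0 := nc_ge0 z; pose s := (1 + nc z) / 2.
have s01 : 0 < s < 1 by rewrite /s; apply/andP; split; lra.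
have [M cM] := bc _ s01; have /andP[s0 s1] := s01.
apply: (@psum_cvg c s M (nc z / s)) => //; last by rewrite divfK ?gt_eqF.
by rewrite divr_ge0 ?(ltW s0)//= ltr_pdivrMr// mul1r /s; lra.
Qed.

Lemma pbound_pser c : pbound c -> exists f, pser c f.
Proof.
move=> bc; have H z : exists l, nc z < 1 -> clim \oo (psum c ^~ z) l.
  have [z1|z1] := boolP (nc z < 1); last by exists 0.
  by have [l Hl] := pbound_cvg bc z1; exists l.
by have [f Hf] := choice H; exists f.
Qed.

Lemma clim_shift (F : nat -> R[i]) l : clim \oo F l -> clim \oo (fun n => F n.+1) l.
Proof. by move=> Fl e /Fl [N _ HN]; exists N => // n /= Nn; apply: HN => /=; exact: leqW. Qed.

(** Taylor's formula of order 2 for a monomial. The factor [rho ^+ 2] stands on the left so that the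
    exponent k - 2 does not occur; the recursion multiplies the remainder by z + h and adds k h^2
    z^(k-1). *)
Lemma expr_taylor z h (rho : R) k : nc z + nc h <= rho ->
  nc ((z + h) ^+ k - z ^+ k - h * (k%:R * z ^+ k.-1)) * rho ^+ 2 <= nc h ^+ 2 * (k%:R ^+ 2 * rho ^+ k).
Proof.
move=> zh; have [z0 h0] := (nc_ge0 z, nc_ge0 h).
have rho0 : 0 <= rho by lra.
elim: k => [|k IH].
  by rewrite !expr0 mul0r mulr0 subrr subr0 nc0 mul0r expr0n /= mul0r mulr0.
have E : (z + h) ^+ k.+1 - z ^+ k.+1 - h * (k.+1%:R * z ^+ k) =
    (z + h) * ((z + h) ^+ k - z ^+ k - h * (k%:R * z ^+ k.-1)) + k%:R * h ^+ 2 * z ^+ k.-1.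
  case: k {IH} => [|k]; first by rewrite !expr0 !expr1; ring.
  by rewrite /= -(natr1 k.+1) !exprS; ring.
rewrite /= E; apply: le_trans (ler_wpM2r (sqr_ge0 _) (ncD _ _)) _.
rewrite mulrDl !ncM !ncX (_ : nc (k%:R : R[i]) = k%:R); last first.
  by rewrite -(rmorph_nat (real_complex R)) ncC_ge0.
apply: (@le_trans _ _ (rho * (nc h ^+ 2 * (k%:R ^+ 2 * rho ^+ k)) + nc h ^+ 2 * (k%:R * rho ^+ k.+1))).
  apply: lerD.
    rewrite -mulrA; apply: ler_pM; rewrite ?mulr_ge0 ?nc_ge0 ?sqr_ge0//.
    exact: le_trans (ncD _ _) zh.
  rewrite (_ : k%:R * _ * _ * _ = nc h ^+ 2 * (k%:R * (nc z ^+ k.-1 * rho ^+ 2))); last by ring.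
  rewrite ler_wpM2l ?sqr_ge0//.
  case: k {IH E} => [|k]; first by rewrite !mul0r.
  rewrite ler_wpM2l//= -(addn2 k) exprD ler_wpM2r ?sqr_ge0// lerXn2r ?nnegrE//; lra.
rewrite (_ : rho * _ + _ = nc h ^+ 2 * rho ^+ k.+1 * (k%:R ^+ 2 + k%:R)); last by rewrite (exprS rho); ring.
rewrite (mulrC (k.+1%:R ^+ 2)) mulrA ler_wpM2l ?mulr_ge0 ?sqr_ge0 ?exprn_ge0//.
by rewrite -natr1 -subr_ge0 (_ : _ - _ = k%:R + 1) ?addr_ge0//; ring.
Qed.

Lemma nc_natr n : nc (n%:R : R[i]) = n%:R.
Proof. by rewrite -(rmorph_nat (real_complex R)) ncC_ge0. Qed.

(** The remainders of [expr_taylor] carry k^2, hence two uses of [pbound_natr]. Of the radii |z| <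
    rho < s < 1, the first gap leaves room for z + h and the second makes the remainders
    summable. *)
Lemma pser_hasder c f z : pser c f -> nc z < 1 ->
  exists2 L, clim \oo (psum (dcoef c) ^~ z) L & hasder f z L.
Proof.
move=> [bc cf] z1; have z0 := nc_ge0 z.
have [L HL] := pbound_cvg (pbound_dcoef bc) z1; exists L => //.
pose rho := (1 + nc z) / 2; pose s := (1 + rho) / 2.
have rho0 : 0 < rho by rewrite /rho; lra.
have rhos : rho < s by rewrite /s /rho; lra.
have s01 : 0 < s < 1 by rewrite /s /rho; apply/andP; split; lra.
have [M HM] := pbound_natr (pbound_natr bc) s01.
have /andP[s0 s1] := s01; pose q := rho / s.
have q01 : 0 <= q < 1 by rewrite divr_ge0 ?(ltW rho0) ?(ltW s0)//= ltr_pdivrMr// mul1r.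
have /andP[q0 q1] := q01.
have M0 : 0 <= M by apply: le_trans (HM 0%N); rewrite mulr_ge0 ?nc_ge0.
pose B := M * (1 - q)^-1.
have B0 : 0 <= B by rewrite mulr_ge0// invr_ge0 subr_ge0 ltW.
have est h : nc h < (1 - nc z) / 2 -> nc (f (z + h) - f z - h * L) * rho ^+ 2 <= nc h ^+ 2 * B.
  move=> hd; have zh : nc z + nc h <= rho by rewrite /rho; lra.
  have zh1 : nc (z + h) < 1 by rewrite (le_lt_trans (ncD _ _))//; lra.
  have rho2 : 0 < rho ^+ 2 by rewrite exprn_gt0.
  rewrite -ler_pdivlMr//.
  have lim : clim \oo (fun n => psum c n.+1 (z + h) - psum c n.+1 z - h * psum (dcoef c) n z)
      (f (z + h) - f z - h * L).
    apply: climB; last exact: climZ HL.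
    by apply: climB; [exact: (clim_shift (cf _ zh1))|exact: (clim_shift (cf _ z1))].
  apply: (@clim_nc_le _ \oo _ _ _ _ lim); apply: filterE => n /=; rewrite ler_pdivlMr//.
  have -> : psum c n.+1 (z + h) - psum c n.+1 z - h * psum (dcoef c) n z =
      \sum_(k < n.+1) c k * ((z + h) ^+ k - z ^+ k - h * (k%:R * z ^+ k.-1)).
    have -> : psum (dcoef c) n z = \sum_(k < n.+1) c k * (k%:R * z ^+ k.-1).
      rewrite big_ord_recl mul0r mulr0 add0r; apply: eq_bigr => k _.
      by rewrite /dcoef /= /bump /= add1n; ring.
    by rewrite /psum mulr_sumr -!sumrB; apply: eq_bigr => k _; ring.
  apply: le_trans (ler_wpM2r (ltW rho2) (nc_sum _ _)) _.
  rewrite mulr_suml; apply: (@le_trans _ _ (\sum_(k < n.+1) nc h ^+ 2 * (M * q ^+ k))); last first.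
    rewrite -!mulr_sumr ler_wpM2l ?sqr_ge0// ler_wpM2l//; exact: geom_sum_le.
  apply: ler_sum => k _; rewrite ncM -mulrA.
  apply: le_trans (ler_wpM2l (nc_ge0 _) (expr_taylor k zh)) _.
  rewrite mulrCA ler_wpM2l ?sqr_ge0//.
  have -> : rho = q * s by rewrite /q divfK// gt_eqF.
  have := HM k; rewrite !ncM nc_natr => HMk.
  rewrite exprMn (_ : _ * _ = k%:R * (k%:R * nc (c k)) * s ^+ k * q ^+ k); last by ring.
  by rewrite ler_wpM2r// exprn_ge0.
apply/hasderP => e e0.
have B1 : 0 < B + 1 by rewrite ltr_wpDl.
have rho2 : 0 < rho ^+ 2 by rewrite exprn_gt0.
exists (Num.min ((1 - nc z) / 2) (e * rho ^+ 2 / (B + 1))).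
  rewrite lt_min; apply/andP; split; apply: divr_gt0 => //; first by rewrite subr_gt0.
  by rewrite mulr_gt0.
move=> h; rewrite lt_min => /andP[h1 h2].
rewrite -(ler_pM2r rho2); apply: le_trans (est h h1) _.
rewrite ltr_pdivlMr// in h2.
rewrite expr2 -mulrA (_ : e * _ * _ = nc h * (e * rho ^+ 2)); last by ring.
rewrite ler_wpM2l ?nc_ge0// (le_trans _ (ltW h2))//.
by rewrite ler_wpM2l ?nc_ge0// lerDl.
Qed.

Lemma pser_hol c f : pser c f -> hol f.
Proof. by move=> cf z z1; have [L _ ?] := pser_hasder cf z1; exists L. Qed.

Lemma pser_deriv c f f' : pser c f -> (forall z, nc z < 1 -> hasder f z (f' z)) -> pser (dcoef c) f'.
Proof.
move=> cf df; split; first by apply: pbound_dcoef; case: cf.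
move=> z z1; have [L HL dL] := pser_hasder cf z1.
by rewrite -(hasder_cderiv (df z z1)) (hasder_cderiv dL).
Qed.

Lemma psum0 c n : psum c n.+1 0 = c 0%N.
Proof.
rewrite /psum big_ord_recl big1 => [|i _]; last by rewrite expr0n mulr0.
by rewrite expr0 mulr1 addr0.
Qed.

Lemma pser0 c f : pser c f -> f 0 = c 0%N.
Proof.
move=> [_ cf]; have h : nc (0 : R[i]) < 1 by rewrite nc0.
apply: (clim_unique (cf _ h)) => e e0; exists 1%N => // -[|n] //= _.
by rewrite psum0 subrr nc0 ltW.
Qed.

Lemma pser_ext c f g : pser c f -> (forall z, nc z < 1 -> f z = g z) -> pser c g.
Proof. by move=> [bc cf] fg; split=> // z z1; rewrite -fg//; exact: cf. Qed.

Lemma pser_primitive c f : pser c f -> exists F, [/\ pser (fun k => if k is j.+1 then c j / j.+1%:R else 0) F,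
  F 0 = 0 & forall z, nc z < 1 -> hasder F z (f z)].
Proof.
move=> [bc cf]; set d := (fun k : nat => _).
have bd : pbound d.
  move=> r r01; have [M HM] := bc r r01; have /andP[r0 r1] := r01; exists M => -[|k] /=.
    by rewrite nc0 mul0r; apply: le_trans (HM 0%N); rewrite mulr_ge0 ?nc_ge0.
  apply: le_trans (HM k); rewrite ncM ncV nc_natr; apply: ler_pM; rewrite ?mulr_ge0 ?nc_ge0 ?invr_ge0 ?exprn_ge0 ?(ltW r0)//.
    by rewrite ler_piMr ?nc_ge0// invf_le1// ler1n.
  by rewrite exprS ler_piMl ?exprn_ge0 ?(ltW r0) ?(ltW r1).
have [F dF] := pbound_pser bd; exists F; split=> //; first by rewrite (pser0 dF).
move=> z z1; have [L HL dL] := pser_hasder dF z1.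
suff -> : f z = L by [].
have E : dcoef d = c.
  by apply/funext => k; rewrite /dcoef /d mulrC divfK// pnatr_eq0.
by apply: (clim_unique (cf z z1)); rewrite -E.
Qed.

End power_series.

(** * Taylor expansion *)

Section taylor.
Context {R : realType}.
Implicit Types (c : nat -> R[i]) (f g : R[i] -> R[i]) (z w a : R[i]).

Lemma ccont_bounded (a b : R) (F : R -> R[i]) : a <= b -> ccont a b F ->
  exists M : R, forall t, a <= t <= b -> nc (F t) <= M.
Proof.
move=> ab cF; have cn : {within `[a, b], continuous (fun t => nc (F t))}.
  apply/subspace_continuousP => t /=; rewrite in_itv /= => tab.
  apply/cvgrPdist_le => e e0; have [d d0 H] := cF t tab e e0.
  rewrite near_withinE; near=> s; rewrite /= in_itv /= => sab.
  have sd : `|s - t| < d.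
    by near: s; have := @nbhsx_ballx R R t d d0; apply: filterS => s; rewrite /ball /= distrC.
  have h1 := le_trans (nc_subl (F s) (F t)) (H s sab sd).
  have h2 : nc (F t) - nc (F s) <= e by rewrite (le_trans (nc_subl _ _))// ncBC H.
  by rewrite ler_norml h2 andbT lerNl opprB.
have [x xab xM] := EVT_max ab cn.
by exists (nc (F x)) => t tab; apply: xM; rewrite in_itv.
Unshelve. all: by end_near. Qed.

Lemma cder_conj (F : R -> R[i]) t L : cder F t L -> cder (fun s => cj (F s)) t (cj L).
Proof.
move=> dF e /dF [d d0 H]; exists d => // h /H.
rewrite -nc_conj; congr (nc _ <= _).
by move: (F (t + h)) (F t) L {dF H} => [u v] [u' v'] [k l]; rewrite /=; congr (_ +i* _); ring.
Qed.

Lemma cder_conj_expi (t : R) : cder (fun s => cj (expi s)) t (- 'i * cj (expi t)).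
Proof. by apply: cder_eq (cder_conj (cder_expi t)) _; apply: complex_ext => /=; ring. Qed.

Lemma ccont_conj_expi (a b : R) : ccont a b (fun t => cj (expi t)).
Proof. by apply: cder_ccont => t _; exact: cder_conj_expi. Qed.

Lemma ccontX (a b : R) (F : R -> R[i]) n : ccont a b F -> ccont a b (fun t => F t ^+ n).
Proof. by move=> /ccontP cF; apply/ccontP => t tab; apply: climX; auto. Qed.

Lemma cint_conj_expi k : cint 0 (2 * pi) (fun t : R => cj (expi t) ^+ k.+1) = 0.
Proof.
have pi20 : (0 : R) < 2 * pi by rewrite mulr_gt0 ?pi_gt0.
have i0 : 'i != 0 :> R[i] by rewrite eq_complex /= oner_eq0 andbF.
have k0 : (k.+1%:R : R[i]) != 0 by rewrite pnatr_eq0.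
rewrite (@cint_FTC R 0 (2 * pi) (fun t => (- (k.+1%:R * 'i))^-1 * cj (expi t) ^+ k.+1))//.
- by rewrite expi2pi expi0 subrr.
- move=> t _; apply: cder_eq (cder_mulC _ (cder_comp (cder_conj_expi t) (hasderX k.+1 _))) _.
  by rewrite /= exprS; move: (k.+1%:R : R[i]) k0 => m m0; field; rewrite ?i0 ?m0.
- by apply/ccontZ/ccontX; exact: ccont_conj_expi.
- by apply/ccontX; exact: ccont_conj_expi.
Qed.

Lemma cint1 : cint 0 (2 * pi) (fun=> 1 : R[i]) = (2 * pi)%:C.
Proof.
have pi20 : (0 : R) < 2 * pi by rewrite mulr_gt0 ?pi_gt0.
rewrite (@cint_FTC R 0 (2 * pi) (fun t => t%:C))// ?subr0//.
- by move=> t _; exact: cder_ofreal.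
- exact: ccont_ofreal.
- exact: ccont_cst.
Qed.

(** For F(t) = f(r e^(it)) with f holomorphic this is the Taylor coefficient of f. It is defined for
    any F because [hol_uniform] needs the expansion before f is known to be holomorphic. *)
Definition fourier_coef (F : R -> R[i]) (r : R) k : R[i] :=
  ((2 * pi)^-1)%:C * cint 0 (2 * pi) (fun t => F t * cj (expi t) ^+ k) * (r%:C^-1) ^+ k.

Lemma fourier_coef_le F r M k : 0 < r -> ccont 0 (2 * pi) F ->
  (forall t, 0 <= t <= 2 * pi -> nc (F t) <= M) -> nc (fourier_coef F r k) * r ^+ k <= 2 * M.
Proof.
move=> r0 cF FM; have pi20 : (0 : R) < 2 * pi by rewrite mulr_gt0 ?pi_gt0.
have B : nc (cint 0 (2 * pi) (fun t => F t * cj (expi t) ^+ k)) <= 2 * M * (2 * pi - 0).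
  apply: cint_bound; [exact: ltW| |].
    by apply: ccontM => //; apply: ccontX; exact: ccont_conj_expi.
  by move=> t tt; rewrite ncM ncX nc_conj nc_expi expr1n mulr1 FM.
rewrite /fourier_coef; set I := cint _ _ _ in B *.
rewrite (ncM (_ * _)) (ncM _ I) ncX ncV (ncC_ge0 (ltW r0)) ncC_ge0 ?invr_ge0 ?(ltW pi20)//.
rewrite exprVn divfK ?expf_neq0 ?gt_eqF// ler_pdivrMl//.
by move: B; rewrite subr0 mulrC.
Qed.

(** The Cauchy kernel equals 1 / (1 - w) with w = (a / r) e^(-it) of modulus |a| / r < 1; the
    geometric series is integrated term by term. *)
Lemma fourier_series F r a : 0 < r -> nc a < r -> ccont 0 (2 * pi) F ->
  clim \oo (psum (fourier_coef F r) ^~ a)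
    (((2 * pi)^-1)%:C * cint 0 (2 * pi) (fun t => F t * (r%:C * expi t / (r%:C * expi t - a)))).
Proof.
move=> r0 ar cF; have pi20 : (0 : R) < 2 * pi by rewrite mulr_gt0 ?pi_gt0.
have [M FM] := ccont_bounded (ltW pi20) cF.
have rC : r%:C != 0 by rewrite (fmorph_eq0 (real_complex R)) gt_eqF.
have nE t : nc (r%:C * expi t) = r by rewrite ncM nc_expi mulr1 ncC_ge0// ltW.
have D_ge t : r - nc a <= nc (r%:C * expi t - a) by rewrite -{1}(nE t) nc_subl.
have D0 t : r%:C * expi t - a != 0.
  by apply/eqP => h; have := D_ge t; rewrite h nc0 leNgt subr_gt0 ar.
pose K t := r%:C * expi t / (r%:C * expi t - a).
have cE u v : ccont u v (fun t => r%:C * expi t) by apply: ccontZ; exact: ccont_expi.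
have cK : ccont 0 (2 * pi) K.
  by apply: ccontM => //; apply: ccontV => [t _|]; [exact: D0|apply: ccontB => //; exact: ccont_cst].
pose w t := a / r%:C * cj (expi t).
have cw n : ccont 0 (2 * pi) (fun t => w t ^+ n).
  by apply/ccontX/ccontZ; exact: ccont_conj_expi.
pose q := nc a / r.
have q01 : 0 <= q < 1 by rewrite divr_ge0 ?nc_ge0 ?(ltW r0)//= ltr_pdivrMr// mul1r.
have /andP[q0 q1] := q01.
have nw t : nc (w t) = q by rewrite !ncM nc_conj nc_expi mulr1 ncV ncC_ge0 ?(ltW r0).
have Kw t : K t * (1 - w t) = 1.
  rewrite /K /w; have ee := expi_conjM t.
  have dt := D0 t; move: (expi t) (cj (expi t)) ee dt => u v uv dt.
  apply: (mulIf dt); apply: (mulIf rC); rewrite mul1r.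
  transitivity (r%:C * u * (r%:C - a * v)); first by field; rewrite rC dt.
  transitivity (r%:C * (r%:C * u - a * (v * u))); first by ring.
  by rewrite uv mulr1 mulrC.
pose kap := r / (r - nc a).
have nK t : nc (K t) <= kap.
  rewrite /K ncM ncV nE ler_wpM2l ?(ltW r0)// lef_pV2 ?posrE ?subr_gt0//.
  by rewrite (lt_le_trans _ (D_ge t))// subr_gt0.
(* Each step applies K = 1 + w K once, which moves one more coefficient out of the integral. *)
have step n : cint 0 (2 * pi) (fun t => F t * K t) =
    (2 * pi)%:C * psum (fourier_coef F r) n a + cint 0 (2 * pi) (fun t => F t * (w t ^+ n * K t)).
  elim: n => [|n IH].
    rewrite /psum big_ord0 mulr0 add0r; apply: eq_cint => t _.
    by rewrite expr0 mul1r.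
  have cA : ccont 0 (2 * pi) (fun t => F t * w t ^+ n) by apply: ccontM.
  have cB : ccont 0 (2 * pi) (fun t => F t * (w t ^+ n.+1 * K t)) by apply: ccontM => //; apply: ccontM.
  rewrite IH psumS (mulrDr (2 * pi)%:C) -[RHS]addrA; congr (_ + _).
  have -> : cint 0 (2 * pi) (fun t => F t * (w t ^+ n * K t)) =
      cint 0 (2 * pi) (fun t => F t * w t ^+ n + F t * (w t ^+ n.+1 * K t)).
    apply: eq_cint => t _; rewrite -mulrDr; congr (F t * _).
    by rewrite exprS -[X in X + _]mulr1 -(Kw t); ring.
  rewrite cintD//; congr (_ + _); rewrite /fourier_coef.
  have -> : cint 0 (2 * pi) (fun t => F t * w t ^+ n) =
      (a / r%:C) ^+ n * cint 0 (2 * pi) (fun t => F t * cj (expi t) ^+ n).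
    rewrite -cintZ; last by apply: ccontM => //; apply: ccontX; exact: ccont_conj_expi.
    by apply: eq_cint => t _; rewrite /w exprMn; ring.
  have tp : (2 * pi)%:C * ((2 * pi)^-1)%:C = 1 :> R[i] by rewrite -rmorphM /= mulfV ?gt_eqF.
  by rewrite !mulrA tp mul1r exprMn; ring.
have kap0 : 0 <= kap by rewrite divr_ge0 ?(ltW r0)// subr_ge0 ltW.
have M0 : 0 <= M by apply: le_trans (nc_ge0 (F 0)) (FM _ _); rewrite lexx ltW.
move=> e e0.
have : (fun n => q ^+ n) @ \oo --> 0 by apply: cvg_expr; rewrite ger0_norm.
pose B := 2 * (M * kap) + 1.
have B0 : 0 < B by rewrite ltr_wpDl// mulr_ge0// mulr_ge0.
move=> /cvgrPdist_lt /(_ _ (divr_gt0 e0 B0)); apply: filterS => n.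
rewrite sub0r normrN ger0_norm ?exprn_ge0// ltr_pdivlMr// => qn /=.
rewrite (step n) mulrDr mulrA -rmorphM /= mulVf ?gt_eqF// rmorph1 mul1r opprD addNKr ncN ncM.
rewrite ncC_ge0 ?invr_ge0 ?(ltW pi20)// ler_pdivrMl//.
apply: (@le_trans _ _ (2 * (M * (q ^+ n * kap)) * (2 * pi - 0))).
  apply: cint_bound; [exact: ltW|by apply: ccontM => //; apply: ccontM|move=> t tt].
  rewrite ncM (ncM _ (K t)) ncX nw; apply: ler_pM; rewrite ?nc_ge0 ?FM//.
    by rewrite mulr_ge0 ?nc_ge0 ?exprn_ge0.
  by rewrite ler_wpM2l ?exprn_ge0.
rewrite subr0 mulrC ler_wpM2l ?(ltW pi20)// (le_trans _ (ltW qn))//.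
rewrite /B mulrDr mulr1 (_ : 2 * _ = q ^+ n * (2 * (M * kap))); last by ring.
by rewrite lerDl exprn_ge0.
Qed.

(** Expanding the constant function 1 leaves only the coefficient of degree 0. *)
Lemma cint_kernel r a : 0 < r -> nc a < r ->
  ((2 * pi)^-1)%:C * cint 0 (2 * pi) (fun t : R => r%:C * expi t / (r%:C * expi t - a)) = 1.
Proof.
move=> r0 ar; have pi20 : (0 : R) < 2 * pi by rewrite mulr_gt0 ?pi_gt0.
have c1 : ccont 0 (2 * pi) (fun=> 1 : R[i]) by exact: ccont_cst.
have := fourier_series r0 ar c1.
have -> : cint 0 (2 * pi) (fun t => 1 * (r%:C * expi t / (r%:C * expi t - a))) =
  cint 0 (2 * pi) (fun t : R => r%:C * expi t / (r%:C * expi t - a)).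
  by apply: eq_cint => t _; rewrite mul1r.
move=> H; apply: (clim_unique H) => e e0; exists 1%N => // -[|n] //= _.
rewrite /psum big_ord_recl big1 => [|i _].
  rewrite /fourier_coef !expr0 !mulr1 addr0.
  have -> : cint 0 (2 * pi) (fun t : R => 1 * cj (expi t) ^+ 0) = cint 0 (2 * pi) (fun=> 1).
    by apply: eq_cint => t _; rewrite expr0 mulr1.
  by rewrite cint1 -rmorphM /= mulVf ?gt_eqF// subrr nc0 ltW.
rewrite /fourier_coef lift0.
have -> : cint 0 (2 * pi) (fun t : R => 1 * cj (expi t) ^+ i.+1) =
  cint 0 (2 * pi) (fun t : R => cj (expi t) ^+ i.+1).
  by apply: eq_cint => t _; rewrite mul1r.
by rewrite cint_conj_expi mulr0 !mul0r.
Qed.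

Lemma ccont_circle f r : dcont f -> 0 <= r < 1 -> ccont 0 (2 * pi) (fun t => f (r%:C * expi t)).
Proof.
move=> cf /andP[r0 r1].
have cE : ccont 0 (2 * pi) (fun t : R => r%:C * expi t) by apply: ccontZ; exact: ccont_expi.
by apply: (ccont_comp cE) => t _; apply: cf; rewrite ncM nc_expi mulr1 ncC_ge0.
Qed.

Definition circle_coef f r := fourier_coef (fun t => f (r%:C * expi t)) r.

Lemma hol_circle_series f r z : hol f -> 0 < r < 1 -> nc z < r ->
  clim \oo (psum (circle_coef f r) ^~ z) (f z).
Proof.
move=> hf /andP[r0 r1] zr.
have cF := ccont_circle (hol_dcont hf) (_ : 0 <= r < 1).
have := fourier_series r0 zr (cF _); rewrite (cauchy_formula r0 r1 zr hf) ltW//= => /(_ r1).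
by rewrite mulrCA cint_kernel// mulr1.
Qed.

Lemma hol_circle_coef_bound f r : hol f -> 0 < r < 1 ->
  exists M, forall k, nc (circle_coef f r k) * r ^+ k <= M.
Proof.
move=> hf /andP[r0 r1]; have pi20 : (0 : R) < 2 * pi by rewrite mulr_gt0 ?pi_gt0.
have cF : ccont 0 (2 * pi) (fun t => f (r%:C * expi t)).
  by apply: ccont_circle (hol_dcont hf) _; rewrite ltW.
have [M HM] := ccont_bounded (ltW pi20) cF.
by exists (2 * M) => k; exact: fourier_coef_le.
Qed.

(** Both sequences represent [f] on the smaller disk, so uniqueness of power series applies. *)
Lemma circle_coef_eq f r s : hol f -> 0 < r < 1 -> 0 < s < 1 -> circle_coef f r = circle_coef f s.
Proof.
move=> hf; wlog rs : r s / r <= s.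
  by move=> W r01 s01; have [/W|/ltW/W] := leP r s; [exact|move=> ->].
move=> r01 s01; have /andP[r0 _] := r01.
have [M HM] := hol_circle_coef_bound hf r01; have [N HN] := hol_circle_coef_bound hf s01.
apply: (@psum_unique _ _ _ f r M N) => // [k|z zr|z zr].
- by apply: le_trans (HN k); rewrite ler_wpM2l ?nc_ge0// lerXn2r// nnegrE ltW// (lt_le_trans r0).
- exact: hol_circle_series.
- by apply: hol_circle_series => //; exact: lt_le_trans zr rs.
Qed.

Lemma hol_pser f : hol f -> exists c, pser c f.
Proof.
move=> hf; have h : 0 < (2^-1 : R) < 1 by rewrite invr_gt0 ltr0n invf_lt1// ltr1n.
exists (circle_coef f 2^-1); split=> [r r01|z z1].
  by rewrite (circle_coef_eq hf h r01); exact: hol_circle_coef_bound.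
have z0 := nc_ge0 z; pose s := (1 + nc z) / 2.
have s01 : 0 < s < 1 by rewrite /s; apply/andP; split; lra.
by rewrite (circle_coef_eq hf h s01); apply: hol_circle_series => //; rewrite /s; lra.
Qed.

Lemma pser_circle_coef c f r : pser c f -> 0 < r < 1 -> c = circle_coef f r.
Proof.
move=> cf r01; have hf := pser_hol cf; have /andP[r0 r1] := r01.
have [M HM] := cf.1 r r01; have [N HN] := hol_circle_coef_bound hf r01.
apply: (psum_unique r0 HM HN (f := f)) => z zr; last exact: hol_circle_series.
by apply: cf.2; exact: lt_trans zr r1.
Qed.

Lemma cauchy_estimate c f r M k : pser c f -> 0 < r < 1 ->
  (forall z, nc z = r -> nc (f z) <= M) -> nc (c k) * r ^+ k <= 2 * M.
Proof.
move=> cf r01 fM; have /andP[r0 r1] := r01; rewrite (pser_circle_coef cf r01).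
apply: fourier_coef_le => // [|t _].
  by apply: ccont_circle (hol_dcont (pser_hol cf)) _; rewrite ltW.
by apply: fM; rewrite ncM nc_expi mulr1 ncC_ge0// ltW.
Qed.

Lemma dcont_uniform f : (forall r, 0 < r < 1 -> forall e, 0 < e ->
    exists2 h, dcont h & forall z, nc z <= r -> nc (f z - h z) <= e) -> dcont f.
Proof.
move=> H z z1 e e0; have z0 := nc_ge0 z; pose r := (1 + nc z) / 2.
have r01 : 0 < r < 1 by rewrite /r; apply/andP; split; lra.
have e3 : 0 < e / 3 by rewrite divr_gt0.
have [h ch fh] := H r r01 _ e3; have [d d0 Hd] := ch z z1 _ e3.
exists (Num.min d ((1 - nc z) / 2)); first by rewrite lt_min d0 divr_gt0// subr_gt0.
move=> w; rewrite lt_min => /andP[wd wz] /=.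
have wr : nc w <= r.
  by have := ncD (w - z) z; rewrite subrK /r => /le_trans; apply; lra.
have -> : f w - f z = (f w - h w) + (h w - h z) - (f z - h z) by ring.
have -> : e = e / 3 + e / 3 + e / 3 by field.
apply: (le_trans (ncB _ _)); apply: lerD; last by apply: fh; rewrite /r; lra.
by apply: (le_trans (ncD _ _)); apply: lerD; [exact: fh|exact: Hd].
Qed.

(** Weierstrass' theorem: Cauchy's formula survives uniform limits on a circle, and [fourier_series]
    then expands [f] in a power series inside it. *)
Lemma hol_uniform f : (forall r, 0 < r < 1 -> forall e, 0 < e ->
    exists2 h, hol h & forall z, nc z <= r -> nc (f z - h z) <= e) -> hol f.
Proof.
move=> H; have cf : dcont f.
  by apply: dcont_uniform => r r01 e /(H r r01) [h /hol_dcont ch fh]; exists h.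
move=> z z1; have z0 := nc_ge0 z; pose r := (1 + nc z) / 2.
have r01 : 0 < r < 1 by rewrite /r; apply/andP; split; lra.
have /andP[r0 r1] := r01; have zr : nc z < r by rewrite /r; lra.
have pi20 : (0 : R) < 2 * pi by rewrite mulr_gt0 ?pi_gt0.
have rC : r%:C != 0 by rewrite (fmorph_eq0 (real_complex R)) gt_eqF.
have rle : 0 <= r < 1 by rewrite ltW.
have cF := ccont_circle cf rle.
have series a : nc a < r -> clim \oo (psum (circle_coef f r) ^~ a) (f a).
  move=> ar; have := fourier_series r0 ar cF.
  suff -> : cint 0 (2 * pi) (fun t => f (r%:C * expi t) * (r%:C * expi t / (r%:C * expi t - a))) =
      f a * cint 0 (2 * pi) (fun t => r%:C * expi t / (r%:C * expi t - a)).
    by rewrite mulrCA cint_kernel// mulr1.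
  pose K t := r%:C * expi t / (r%:C * expi t - a).
  have nE t : nc (r%:C * expi t) = r by rewrite ncM nc_expi mulr1 ncC_ge0// ltW.
  have D_ge t : r - nc a <= nc (r%:C * expi t - a) by rewrite -{1}(nE t) nc_subl.
  have D0 t : r%:C * expi t - a != 0.
    by apply/eqP => h; have := D_ge t; rewrite h nc0 leNgt subr_gt0 ar.
  have cE u v : ccont u v (fun t => r%:C * expi t) by apply: ccontZ; exact: ccont_expi.
  have cK : ccont 0 (2 * pi) K.
    by apply: ccontM => //; apply: ccontV => [t _|]; [exact: D0|apply: ccontB => //; exact: ccont_cst].
  have [B KB] := ccont_bounded (ltW pi20) cK.
  have B0 : 0 <= B by apply: le_trans (nc_ge0 (K 0)) (KB _ _); rewrite lexx ltW.
  apply: subr0_eq; apply: nc_eq0; apply/eqP; rewrite eq_le nc_ge0 andbT.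
  apply/ler_addgt0Pl => e e0; rewrite addr0.
  pose W := 4 * B * (2 * pi) + 1.
  have W0 : 0 < W by rewrite ltr_wpDl// (mulr_ge0 _ (ltW pi20))// mulr_ge0.
  have [h hh fh] := H r r01 _ (divr_gt0 e0 W0).
  have ch := ccont_circle (hol_dcont hh) rle.
  have := cauchy_formula r0 r1 ar hh; rewrite -/K => E.
  have -> : cint 0 (2 * pi) (fun t => f (r%:C * expi t) * K t) - f a * cint 0 (2 * pi) K =
      cint 0 (2 * pi) (fun t => (f (r%:C * expi t) - h (r%:C * expi t)) * K t) -
      (f a - h a) * cint 0 (2 * pi) K.
    have -> : cint 0 (2 * pi) (fun t => (f (r%:C * expi t) - h (r%:C * expi t)) * K t) =
       cint 0 (2 * pi) (fun t => f (r%:C * expi t) * K t) - cint 0 (2 * pi) (fun t => h (r%:C * expi t) * K t).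
      rewrite -cintB; [|exact: ccontM|exact: ccontM].
      by apply: eq_cint => t _; rewrite mulrBl.
    by rewrite E; ring.
  apply: (le_trans (ncB _ _)).
  apply: (@le_trans _ _ (2 * (e / W * B) * (2 * pi - 0) + e / W * (2 * B * (2 * pi - 0)))).
    apply: lerD.
      apply: cint_bound; [exact: ltW|apply: ccontM => //; exact: ccontB|move=> t tt].
      rewrite ncM; apply: ler_pM; rewrite ?nc_ge0 ?KB//.
      by apply: fh; rewrite nE.
    rewrite ncM; apply: ler_pM; rewrite ?nc_ge0//; first exact/fh/ltW.
    by apply: cint_bound => //; exact: ltW.
  rewrite subr0 (_ : _ + _ = e / W * (W - 1)); last by rewrite /W; ring.
  have e1 : 0 < e / W by rewrite divr_gt0.
  by rewrite mulrBr mulr1 divfK ?gt_eqF// lerBlDr lerDl ltW.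
have [M HM] := ccont_bounded (ltW pi20) cF.
(* The expansion holds only for |z| < r; rescaling by r brings it to the unit disk, where [pser] is
   defined. *)
pose c k := circle_coef f r k * r%:C ^+ k.
have cg : pser c (fun w => f (r%:C * w)).
  split=> [s /andP[s0 s1]|w w1].
    exists (2 * M) => k; apply: le_trans (fourier_coef_le k r0 cF HM).
    rewrite /c ncM ncX ncC_ge0 ?(ltW r0)// ler_piMr ?exprn_ile1 ?(ltW s0) ?(ltW s1)//.
    by rewrite mulr_ge0 ?nc_ge0// exprn_ge0// ltW.
  have -> : psum c ^~ w = psum (circle_coef f r) ^~ (r%:C * w).
    by apply/funext => n; apply: eq_bigr => k _; rewrite exprMn mulrA.
  by apply: series; rewrite ncM ncC_ge0 ?(ltW r0)// -[ltRHS]mulr1 ltr_pM2l.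
have zr1 : nc (z / r%:C) < 1 by rewrite ncM ncV ncC_ge0 ?(ltW r0)// ltr_pdivrMr// mul1r.
have [L dL] := pser_hol cg zr1.
have dz : hasder (fun w => r%:C^-1 * w) z (r%:C^-1 * 1) := hasderZ _ (hasder_id z).
have E : r%:C^-1 * z = z / r%:C by rewrite mulrC.
rewrite -E in dL.
have := hasder_comp (clim_id0 (R := R)) dz dL => D; exists (r%:C^-1 * 1 * L).
rewrite /hasder; have fE : f z = f (r%:C * (r%:C^-1 * z)) by rewrite mulrA divff// mul1r.
rewrite fE; apply: (gder_ext _ (D (cnbhs_filter 0))) => h.
by rewrite mulrA divff// mul1r.
Qed.

End taylor.

(** * Parseval's identity and the Hardy norm in terms of Taylor coefficients *)

Section parseval.
Context {R : realType}.
Implicit Types (c d : nat -> R[i]) (f g : R[i] -> R[i]) (z w : R[i]).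

Lemma cjM z w : cj (z * w) = cj z * cj w.
Proof. by case: z w => [a b] [a' b'] /=; congr (_ +i* _); ring. Qed.
Lemma cjD z w : cj (z + w) = cj z + cj w.
Proof. by case: z w => [a b] [a' b'] /=; congr (_ +i* _); ring. Qed.
Lemma cjX z n : cj (z ^+ n) = cj z ^+ n.
Proof.
elim: n => [|n IH]; last by rewrite !exprS cjM IH.
by rewrite !expr0 conjc1.
Qed.
Lemma ofrealD (x y : R) : (x + y)%:C = x%:C + y%:C.
Proof. by rewrite rmorphD. Qed.
Lemma ofrealM (x y : R) : (x * y)%:C = x%:C * y%:C.
Proof. by rewrite rmorphM. Qed.
Lemma mulr_cj z : z * cj z = (nc z ^+ 2)%:C.
Proof. by rewrite nc_sqr; case: z => [a b] /=; congr (_ +i* _); ring. Qed.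

Lemma ccont_conj (a b : R) (F : R -> R[i]) : ccont a b F -> ccont a b (fun t => cj (F t)).
Proof.
move=> cF t tt e /(cF t tt) [d d0 H]; exists d => // s ss /(H s ss).
by rewrite -nc_conj; congr (nc _ <= _); case: (F s) (F t) => [u v] [u' v'] /=; congr (_ +i* _); ring.
Qed.

Lemma cint_conj (a b : R) (F : R -> R[i]) : ccont a b F -> cint a b (fun t => cj (F t)) = cj (cint a b F).
Proof.
move=> cF; rewrite /cint /complex_integral; apply: complex_ext => /=.
  by apply: eq_Rintegral => t _; case: (F t).
rewrite -[RHS]mulN1r -RintegralZl//; last exact: ccont_integrable_im.
by apply: eq_Rintegral => t _; case: (F t) => u v /=; rewrite mulN1r.
Qed.

Lemma cint_psum_orth c (r : R) m n : (m <= n)%N ->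
  cint 0 (2 * pi) (fun t => psum c m (r%:C * expi t) * cj (expi t) ^+ n) = 0.
Proof.
have cP k : ccont 0 (2 * pi) (fun t => psum c k (r%:C * expi t)).
  apply/ccontP => t tt; apply: clim_sum => i; apply: climZ; apply: climX; apply: climZ.
  exact: ((ccontP _ _ _).1 (@ccont_expi _ 0 (2 * pi))).
have cE k : ccont 0 (2 * pi) (fun t : R => cj (expi t) ^+ k).
  by apply: ccontX; exact: ccont_conj_expi.
elim: m => [_|m IH mn].
  rewrite -(mul0r (cint 0 (2 * pi) (fun=> 0 : R[i]))) -cintZ; last exact: ccont_cst.
  by apply: eq_cint => t _; rewrite /psum big_ord0 !mul0r.
have -> : cint 0 (2 * pi) (fun t => psum c m.+1 (r%:C * expi t) * cj (expi t) ^+ n) =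
    cint 0 (2 * pi) (fun t => psum c m (r%:C * expi t) * cj (expi t) ^+ n +
      c m * r%:C ^+ m * cj (expi t) ^+ (n - m.+1).+1).
  apply: eq_cint => t _; rewrite psumS mulrDl; congr (_ + _).
  rewrite exprMn -{1}(subnK (ltnW mn)) exprD.
  have e1 : expi t ^+ m * cj (expi t) ^+ m = 1 by rewrite -exprMn mulrC expi_conjM expr1n.
  rewrite (subnSK mn); set x := cj (expi t) ^+ (n - m).
  transitivity (c m * r%:C ^+ m * x * (expi t ^+ m * cj (expi t) ^+ m)); first by ring.
  by rewrite e1 mulr1.
rewrite cintD; [|exact: ccontM|exact: ccontZ].
by rewrite IH ?(ltnW mn)// add0r cintZ// cint_conj_expi mulr0.
Qed.

Lemma cint_psum_sq c (r : R) n : 0 <= r ->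
  cint 0 (2 * pi) (fun t => psum c n (r%:C * expi t) * cj (psum c n (r%:C * expi t))) =
  (2 * pi * \sum_(k < n) nc (c k) ^+ 2 * r ^+ k ^+ 2)%:C.
Proof.
move=> r0.
have cP k : ccont 0 (2 * pi) (fun t => psum c k (r%:C * expi t)).
  apply/ccontP => t tt; apply: clim_sum => i; apply: climZ; apply: climX; apply: climZ.
  exact: ((ccontP _ _ _).1 (@ccont_expi _ 0 (2 * pi))).
have cE k : ccont 0 (2 * pi) (fun t : R => cj (expi t) ^+ k).
  by apply: ccontX; exact: ccont_conj_expi.
elim: n => [|n IH].
  rewrite big_ord0 mulr0; transitivity (0 * cint 0 (2 * pi) (fun=> 0 : R[i])); last by rewrite mul0r.
  rewrite -cintZ; last exact: ccont_cst.
  by apply: eq_cint => t _; rewrite /psum big_ord0 !mul0r.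
have [al alE] : exists al, al = c n * r%:C ^+ n by exists (c n * r%:C ^+ n).
pose S t := psum c n (r%:C * expi t).
pose X t := S t * cj (expi t) ^+ n.
have cX : ccont 0 (2 * pi) X by apply: ccontM; [exact: cP|exact: cE].
have cS : ccont 0 (2 * pi) S by exact: cP.
have iX : cint 0 (2 * pi) X = 0 by exact: cint_psum_orth.
have -> : cint 0 (2 * pi) (fun t => psum c n.+1 (r%:C * expi t) * cj (psum c n.+1 (r%:C * expi t))) =
  cint 0 (2 * pi) (fun t => S t * cj (S t) + (cj al * X t + (al * cj (X t) + (nc al ^+ 2)%:C * 1))).
  apply: eq_cint => t _; rewrite psumS -/(S t) exprMn mulrA -alE /X.
  move: (S t) => y; rewrite !cjD !cjM -mulr_cj mulr1 !cjX conjcK.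
  have e1 : expi t ^+ n * cj (expi t) ^+ n = 1 by rewrite -exprMn mulrC expi_conjM expr1n.
  rewrite -[X in _ = _ + (_ + (_ + X))]mulr1 -e1; ring.
have c1 : ccont 0 (2 * pi) (fun=> 1 : R[i]) by exact: ccont_cst.
have k4 : ccont 0 (2 * pi) (fun t => (nc al ^+ 2)%:C * 1 : R[i]) by exact: ccont_cst.
have k3 : ccont 0 (2 * pi) (fun t => al * cj (X t)) by apply: ccontZ; exact: ccont_conj.
have k2 : ccont 0 (2 * pi) (fun t => cj al * X t) by exact: ccontZ.
have k1 : ccont 0 (2 * pi) (fun t => S t * cj (S t)) by apply: ccontM => //; exact: ccont_conj.
rewrite cintD//; last by apply: ccontD => //; exact: ccontD.
rewrite cintD//; last by exact: ccontD.
rewrite cintD// !cintZ//; last exact: ccont_conj.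
rewrite cint_conj// iX conjc0 !mulr0 !add0r cint1 IH big_ord_recr /=.
move: (2 * pi) => P; rewrite mulrDr ofrealD; congr (_ + _).
rewrite -ofrealM; congr (_%:C); rewrite alE ncM ncX ncC_ge0// exprMn; ring.
Qed.

Lemma clim_psum_sq c f (r : R) : pser c f -> 0 <= r < 1 ->
  clim \oo (fun n => cint 0 (2 * pi) (fun t => psum c n (r%:C * expi t) * cj (psum c n (r%:C * expi t))))
    (cint 0 (2 * pi) (fun t => f (r%:C * expi t) * cj (f (r%:C * expi t)))).
Proof.
move=> cf r01; have /andP[r0 r1] := r01; have pi20 : (0 : R) < 2 * pi by rewrite mulr_gt0 ?pi_gt0.
have cP k : ccont 0 (2 * pi) (fun t => psum c k (r%:C * expi t)).
  apply/ccontP => t tt; apply: clim_sum => i; apply: climZ; apply: climX; apply: climZ.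
  exact: ((ccontP _ _ _).1 (@ccont_expi _ 0 (2 * pi))).
have cF := ccont_circle (hol_dcont (pser_hol cf)) r01.
have [B HB] := ccont_bounded (ltW pi20) cF.
pose s := (1 + r) / 2; have s01 : 0 < s < 1 by rewrite /s; apply/andP; split; lra.
have /andP[s0 s1] := s01; have [M HM] := cf.1 s s01.
pose q := r / s.
have q01 : 0 <= q < 1 by rewrite divr_ge0 ?(ltW s0)//= ltr_pdivrMr// mul1r /s; lra.
have /andP[q0 q1] := q01.
have M0 : 0 <= M by apply: le_trans (HM 0%N); rewrite mulr_ge0 ?nc_ge0.
pose D := M * (1 - q)^-1.
have D0 : 0 <= D by rewrite mulr_ge0// invr_ge0 subr_ge0 ltW.
have B0 : 0 <= B by apply: le_trans (nc_ge0 _) (HB 0 _); rewrite lexx ltW.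
have nE t : nc (r%:C * expi t) = r by rewrite ncM nc_expi mulr1 ncC_ge0.
have tail n t : nc (f (r%:C * expi t) - psum c n (r%:C * expi t)) <= D * q ^+ n.
  apply: (psum_tail n s0 q01 HM); first by rewrite nE /q divfK// gt_eqF.
  by apply: cf.2; rewrite nE.
move=> e e0.
have : (fun n => q ^+ n) @ \oo --> 0 by apply: cvg_expr; rewrite ger0_norm.
pose W := 2 * (D * (2 * B + D)) * (2 * pi) + 1.
have DB0 : 0 <= 2 * B + D by rewrite addr_ge0// mulr_ge0.
have W0 : 0 < W by rewrite ltr_wpDl// (mulr_ge0 _ (ltW pi20))// (mulr_ge0 _ (mulr_ge0 D0 DB0)).
move=> /cvgrPdist_lt /(_ _ (divr_gt0 e0 W0)); apply: filterS => n.
have qn0 : 0 <= q ^+ n by rewrite exprn_ge0.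
rewrite sub0r normrN ger0_norm// ltr_pdivlMr// => qn /=.
rewrite ncBC -cintB; [|by apply: ccontM => //; exact: ccont_conj|by apply: ccontM => //; exact: ccont_conj].
apply: (@le_trans _ _ (2 * (D * q ^+ n * (2 * B + D)) * (2 * pi - 0))).
  apply: cint_bound; first exact: ltW.
    by apply: ccontB; apply: ccontM => //; apply: ccont_conj => //.
  move=> t tt; have := tail n t; have := HB t tt.
  move: (f _) (psum c n _) => x y xB xy.
  have -> : x * cj x - y * cj y = (x - y) * cj x + y * cj (x - y).
    by case: x y {xB xy} => [u v] [u' v'] /=; congr (_ +i* _); ring.
  have yB : nc y <= B + D.
    rewrite -[y](subrK x) addrC (le_trans (ncD _ _))// lerD// ncBC (le_trans xy)//.
    by rewrite ler_piMr// exprn_ile1// ltW.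
  rewrite (le_trans (ncD _ _))// !ncM !nc_conj.
  apply: (@le_trans _ _ (D * q ^+ n * B + (B + D) * (D * q ^+ n))).
    by apply: lerD; apply: ler_pM; rewrite ?nc_ge0.
  by rewrite le_eqVlt; apply/orP; left; apply/eqP; ring.
apply: le_trans (ltW qn); rewrite subr0.
have -> : q ^+ n * W = 2 * (D * q ^+ n * (2 * B + D)) * (2 * pi) + q ^+ n by rewrite /W; ring.
by rewrite lerDl.
Qed.

Lemma mean_squareE f (r : R) : dcont f -> 0 <= r < 1 -> mean_square f r =
  ((2 * pi)^-1 * cre (cint 0 (2 * pi) (fun t => f (r%:C * expi t) * cj (f (r%:C * expi t)))))%:E.
Proof.
move=> cf r01; have cF := ccont_circle cf r01.
have cFF := ccontM cF (ccont_conj cF).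
rewrite EFinM /mean_square; congr (_ * _)%E.
rewrite cint_re /Rintegral fineK; last first.
  by apply: integrable_fin_num => //; exact: (ccont_integrable_re cFF).
by apply: eq_integral => t _; rewrite mulr_cj.
Qed.

(** Parseval for polynomials, then uniform convergence on the circle. The mean is described as the
    least upper bound of the partial sums, which is the form needed to compare bounds. *)
Lemma mean_square_series c f (r : R) : pser c f -> 0 <= r < 1 -> exists m : R,
  [/\ mean_square f r = m%:E,
      forall n, \sum_(k < n) nc (c k) ^+ 2 * r ^+ k ^+ 2 <= m &
      forall B, (forall n, \sum_(k < n) nc (c k) ^+ 2 * r ^+ k ^+ 2 <= B) -> m <= B].
Proof.
move=> cf r01; have /andP[r0 r1] := r01; have pi20 : (0 : R) < 2 * pi by rewrite mulr_gt0 ?pi_gt0.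
rewrite (mean_squareE (hol_dcont (pser_hol cf)) r01).
set J := cre _; exists ((2 * pi)^-1 * J).
have lim e : 0 < e -> \forall n \near \oo, `|2 * pi * (\sum_(k < n) nc (c k) ^+ 2 * r ^+ k ^+ 2) - J| <= e.
  move=> /(clim_psum_sq cf r01); apply: filterS => n /=.
  by rewrite cint_psum_sq// => /(le_trans (nc_re _)); rewrite creB.
split=> // [n|B HB].
  rewrite ler_pdivlMl//; apply/ler_addgt0Pl => e /lim [N _ HN].
  have := HN (maxn N n) (leq_maxl _ _); rewrite /= ler_distl => /andP[_ H].
  rewrite [leRHS]addrC; apply: le_trans H; rewrite ler_pM2l//.
  rewrite -(subnKC (leq_maxr N n)) big_split_ord /= lerDl sumr_ge0// => i _.
  by rewrite mulr_ge0 ?sqr_ge0.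
rewrite ler_pdivrMl//; apply/ler_addgt0Pl => e /lim [N _ HN].
have := HN N (leqnn N); rewrite /= distrC ler_distl => /andP[_ H].
by rewrite [leRHS]addrC; apply: (le_trans H); rewrite lerD2r ler_pM2l// HB.
Qed.

Lemma h2norm_leP f (M : R) : 0 <= M -> (h2norm f <= M%:E)%E <->
  (forall r, 0 <= r < 1 -> (mean_square f r <= (M ^+ 2)%:E)%E).
Proof.
move=> M0; rewrite /h2norm; set S := ereal_sup _.
have S0 : (0 <= S)%E.
  apply: (@le_trans _ _ (mean_square f 0)).
    rewrite /mean_square mule_ge0//; first by rewrite lee_fin invr_ge0 mulr_ge0// pi_ge0.
    by apply: integral_ge0 => t _; rewrite lee_fin sqr_ge0.
  by apply: ereal_sup_ubound; exists 0 => //=; rewrite in_itv /= lexx ltr01.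
have -> : (S `^ 2^-1 <= M%:E)%E <-> (S <= (M ^+ 2)%:E)%E.
  case: S S0 => [s| |]//; last by rewrite poweRyr//; split; rewrite leye_eq.
  rewrite lee_fin poweR_EFin !lee_fin => s0; rewrite powR12_sqrt//; split=> [h|h].
    by rewrite -(sqr_sqrtr s0) lerXn2r// nnegrE sqrtr_ge0.
  by rewrite -[M]ger0_norm// -sqrtr_sqr ler_wsqrtr.
split=> [h r r01|h].
  by apply: le_trans h; apply: ereal_sup_ubound; exists r => //=; rewrite in_itv.
apply: ge_ereal_sup => x [r /= r01 <-]; apply: h.
by move: r01; rewrite in_itv.
Qed.

Lemma bernoulli_le (x : R) n : 0 <= x <= 1 -> 1 - n%:R * (1 - x) <= x ^+ n.
Proof.
move=> /andP[x0 x1]; elim: n => [|n IH]; first by rewrite mul0r subr0 expr0.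
rewrite exprS; apply: le_trans (ler_wpM2l x0 IH).
rewrite -natr1 -subr_ge0 (_ : _ - _ = n%:R * (1 - x) ^+ 2); last by ring.
by rewrite mulr_ge0 ?sqr_ge0.
Qed.

(** One direction compares the weights r^(2k) with 1. For the other, a fixed partial sum loses at
    most a multiple of 1 - r at radius r, by Bernoulli's inequality. *)
Lemma h2norm_series c f (M : R) : pser c f -> 0 <= M -> (h2norm f <= M%:E)%E <->
  (forall n, \sum_(k < n) nc (c k) ^+ 2 <= M ^+ 2).
Proof.
move=> cf M0; rewrite h2norm_leP//; split=> H.
  move=> n; apply/ler_addgt0Pl => e e0; rewrite addrC.
  (* By Bernoulli, r^(2k) >= 1 - 2 k h for r = 1 - h, so [C * h] bounds the loss of the n-th partial
     sum at radius r. *)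
  pose C := \sum_(k < n) nc (c k) ^+ 2 * (k * 2)%:R.
  have C0 : 0 <= C by rewrite sumr_ge0// => k _; rewrite mulr_ge0 ?sqr_ge0.
  pose h := Num.min 1 (e / (C + 1)).
  have h0 : 0 < h by rewrite lt_min ltr01 divr_gt0// ltr_wpDl.
  have h1 : h <= 1 by rewrite ge_min lexx.
  have r01 : 0 <= 1 - h < 1 by rewrite subr_ge0 h1 ltrBlDr ltrDl.
  have [m [mE Hm _]] := mean_square_series cf r01.
  have := H _ r01; rewrite mE lee_fin => mM.
  have Ce : C * h <= e.
    have : h <= e / (C + 1) by rewrite ge_min lexx orbT.
    rewrite ler_pdivlMr ?ltr_wpDl// => he; apply: le_trans he.
    by rewrite mulrDr mulr1 mulrC lerDl ltW.
  apply: (@le_trans _ _ (m + C * h)); last by rewrite lerD.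
  rewrite -lerBlDr; apply: le_trans (Hm n); rewrite /C mulr_suml -sumrB ler_sum// => k _.
  rewrite -mulrA -{1}[nc _ ^+ 2]mulr1 -mulrBr ler_wpM2l ?sqr_ge0// -exprM.
  have x01 : 0 <= 1 - h <= 1 by move: r01 => /andP[-> /ltW].
  by have := bernoulli_le (k * 2) x01; rewrite (_ : 1 - (1 - h) = h)//; ring.
move=> r r01; have [m [-> _ Hm]] := mean_square_series cf r01.
rewrite lee_fin; apply: Hm => n; apply: le_trans (H n); rewrite ler_sum// => k _.
have /andP[r0 r1] := r01.
by rewrite ler_piMr ?sqr_ge0// exprn_ile1 ?exprn_ge0// exprn_ile1// ltW.
Qed.

End parseval.

(** * Rules for bounding Hardy norms *)

Section hardy_norm.
Context {R : realType}.
Implicit Types (c d : nat -> R[i]) (f g : R[i] -> R[i]) (z w : R[i]).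

Lemma hol_ext f g : (forall z, nc z < 1 -> f z = g z) -> hol f -> hol g.
Proof.
move=> fg hf z z1; have [L /hasderP dL] := hf z z1; exists L; apply/hasderP => e /dL [d d0 H].
exists (Num.min d (1 - nc z)); first by rewrite lt_min d0 subr_gt0.
move=> h; rewrite lt_min => /andP[hd hz]; rewrite -!fg ?H//.
by rewrite (le_lt_trans (ncD _ _))// addrC -ltrBrDr.
Qed.

Lemma hol_cst (a : R[i]) : hol (fun=> a).
Proof. by move=> z _; exists 0; exact: hasder_cst. Qed.
Lemma hol_id : hol (@id R[i]).
Proof. by move=> z _; exists 1; exact: hasder_id. Qed.
Lemma holD f g : hol f -> hol g -> hol (fun z => f z + g z).
Proof. by move=> hf hg z z1; have [L ?] := hf z z1; have [M ?] := hg z z1; exists (L + M); exact: hasderD. Qed.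
Lemma holB f g : hol f -> hol g -> hol (fun z => f z - g z).
Proof. by move=> hf hg z z1; have [L ?] := hf z z1; have [M ?] := hg z z1; exists (L - M); exact: hasderB. Qed.
Lemma holM f g : hol f -> hol g -> hol (fun z => f z * g z).
Proof.
move=> hf hg z z1; have [L fL] := hf z z1; have [M gM] := hg z z1.
by exists (L * g z + f z * M); exact: hasderM.
Qed.
Lemma holZ a f : hol f -> hol (fun z => a * f z).
Proof. by apply: holM; exact: hol_cst. Qed.
Lemma holX n : hol (fun z => z ^+ n).
Proof. by move=> z _; exists (n%:R * z ^+ n.-1); exact: hasderX. Qed.
Lemma holV f : (forall z, nc z < 1 -> f z != 0) -> hol f -> hol (fun z => (f z)^-1).
Proof.
by move=> f0 hf z z1; have [L ?] := hf z z1; exists (- L / f z ^+ 2); apply: hasderV => //; exact: f0.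
Qed.

Lemma hol_cderiv f z : hol f -> nc z < 1 -> hasder f z (cderiv f z).
Proof. by move=> hf /hf [L dL]; rewrite (hasder_cderiv dL). Qed.

Lemma cderiv_hol f : hol f -> hol (cderiv f).
Proof.
move=> hf; have [c cf] := hol_pser hf.
by apply: (@pser_hol _ (dcoef c)); apply: pser_deriv cf _ => z z1; exact: hol_cderiv.
Qed.

Lemma pserD c d f g : pser c f -> pser d g -> pser (fun k => c k + d k) (fun z => f z + g z).
Proof.
move=> [bc cf] [bd dg]; split=> [r r01|z z1].
  have [M HM] := bc r r01; have [N HN] := bd r r01; exists (M + N) => k; have /andP[r0 _] := r01.
  apply: (@le_trans _ _ ((nc (c k) + nc (d k)) * r ^+ k)).
    by rewrite ler_wpM2r ?exprn_ge0 ?(ltW r0)// ncD.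
  by rewrite mulrDl lerD.
rewrite (_ : _ ^~ z = (fun n => psum c n z + psum d n z)); first exact: climD (cf z z1) (dg z z1).
by apply/funext => n; rewrite /psum -big_split; apply: eq_bigr => k _; rewrite mulrDl.
Qed.

Lemma pserZ a c f : pser c f -> pser (fun k => a * c k) (fun z => a * f z).
Proof.
move=> [bc cf]; split=> [r r01|z z1].
  have [M HM] := bc r r01; exists (nc a * M) => k.
  by rewrite ncM -mulrA ler_wpM2l ?nc_ge0.
rewrite (_ : _ ^~ z = (fun n => a * psum c n z)); first exact: climZ (cf z z1).
by apply/funext => n; rewrite /psum mulr_sumr; apply: eq_bigr => k _; rewrite mulrA.
Qed.

Lemma pserB c d f g : pser c f -> pser d g -> pser (fun k => c k - d k) (fun z => f z - g z).
Proof.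
move=> cf /(pserZ (-1)) dg; have := pserD cf dg.
rewrite (_ : (fun k => c k + -1 * d k) = fun k => c k - d k); last first.
  by apply/funext => k; rewrite mulN1r.
by rewrite (_ : (fun z => f z + -1 * g z) = fun z => f z - g z)//; apply/funext => z; rewrite mulN1r.
Qed.

Lemma pser_shift c f N : pser c f ->
  pser (fun k => if (k < N)%N then 0 else c (k - N)%N) (fun z => z ^+ N * f z).
Proof.
move=> [bc cf]; split=> [r r01|z z1].
  have [M HM] := bc r r01; have /andP[r0 r1] := r01; exists M => k.
  case: ltnP => [_|Nk].
    by rewrite nc0 mul0r; apply: le_trans (HM 0%N); rewrite mulr_ge0 ?nc_ge0.
  apply: le_trans (HM (k - N)%N); rewrite ler_wpM2l ?nc_ge0//.
  by rewrite ler_wiXn2l ?leq_subr ?(ltW r0) ?(ltW r1).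
have lim := climZ (z ^+ N) (cf z z1).
move=> e /lim [K _ HK]; exists (N + K)%N => // n /= NKn.
have Nn : (N <= n)%N by apply: leq_trans NKn; exact: leq_addr.
have Kn : (K <= n - N)%N by rewrite leq_subRL.
suff -> : psum (fun k => if (k < N)%N then 0 else c (k - N)%N) n z = z ^+ N * psum c (n - N) z by exact: HK.
rewrite -{1}(subnKC Nn) /psum big_split_ord /= big1 ?add0r => [|i _]; last by rewrite ltn_ord mul0r.
rewrite mulr_sumr; apply: eq_bigr => i _.
by rewrite ltnNge leq_addr /= addKn exprD; ring.
Qed.

Lemma pser_tail c f n : pser c f ->
  pser (fun k => if (k < n)%N then 0 else c k) (fun z => f z - psum c n z).
Proof.
move=> [bc cf]; split=> [r r01|z z1].
  have [M HM] := bc r r01; exists M => k; case: ltnP => // _.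
  have /andP[r0 _] := r01.
  by rewrite nc0 mul0r; apply: le_trans (HM 0%N); rewrite mulr_ge0 ?nc_ge0.
have lim := climB (cf z z1) (clim_cst (psum c n z)).
move=> e /lim [K _ HK]; exists (n + K)%N => // m /= nm.
have nm' : (n <= m)%N by apply: leq_trans nm; exact: leq_addr.
suff -> : psum (fun k => if (k < n)%N then 0 else c k) m z = psum c m z - psum c n z.
  by apply: HK => /=; apply: leq_trans nm; exact: leq_addl.
rewrite -(subnKC nm') /psum !big_split_ord /= big1 ?add0r => [|i _]; last by rewrite ltn_ord mul0r.
rewrite addrAC subrr add0r; apply: eq_bigr => i _.
by rewrite ltnNge leq_addr.
Qed.

Lemma pser_cst (a : R[i]) : pser (fun k => if k is 0%N then a else 0) (fun=> a).
Proof.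
split=> [r /andP[r0 r1]|z z1].
  by exists (nc a) => -[|k]; rewrite ?expr0 ?mulr1// nc0 mul0r nc_ge0.
move=> e e0; exists 1%N => // -[|n] //= _.
rewrite /psum big_ord_recl big1 => [|i _]; last by rewrite mul0r.
by rewrite /= expr0 mulr1 addr0 subrr nc0 ltW.
Qed.

(** Norms enter only as real upper bounds, so no finiteness of an extended real has to be carried
    along. *)
Definition hn f (M : R) := (h2norm f <= M%:E)%E.

Lemma hn_weak f A B : A <= B -> hn f A -> hn f B.
Proof. by move=> AB fA; rewrite /hn (le_trans fA)// lee_fin. Qed.

Lemma h2norm_ext f g : (forall z, nc z < 1 -> f z = g z) -> h2norm f = h2norm g.
Proof.
move=> fg; rewrite /h2norm; congr (ereal_sup _ `^ _)%E; apply/seteqP.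
have E r : `[0, 1[%classic r -> mean_square f r = mean_square g r.
  rewrite /= in_itv /= => /andP[r0 r1]; rewrite /mean_square; congr (_ * _)%E.
  by apply: eq_integral => t _; rewrite fg// ncM nc_expi mulr1 ncC_ge0.
by split=> _ [r r01 <-]; exists r => //; rewrite E.
Qed.

Lemma hn_le f g K A : dcont f -> dcont g -> 0 <= K -> 0 <= A ->
  (forall z, nc z < 1 -> nc (f z) <= K * nc (g z)) -> hn g A -> hn f (K * A).
Proof.
move=> cf cg K0 A0 fg /(h2norm_leP _ A0) gA; apply/h2norm_leP; first exact: mulr_ge0.
move=> r r01; have /andP[r0 r1] := r01; have := gA r r01; rewrite !mean_squareE// !lee_fin => H.
have pi20 : (0 : R) < 2 * pi by rewrite mulr_gt0 ?pi_gt0.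
rewrite exprMn; apply: le_trans (ler_wpM2l (sqr_ge0 K) H).
rewrite mulrCA ler_wpM2l ?invr_ge0 ?(ltW pi20)//.
have kf := ccont_circle cf r01; have kg := ccont_circle cg r01.
have kff := ccont_integrable_re (ccontM kf (ccont_conj kf)).
have kgg := ccont_integrable_re (ccontM kg (ccont_conj kg)).
rewrite !cint_re -RintegralZl//; apply: le_Rintegral => //.
  by apply: eq_integrable (integrableZl _ (K ^+ 2) kgg).
move=> t _; rewrite !mulr_cj /= -exprMn lerXn2r ?nnegrE ?mulr_ge0 ?nc_ge0//.
by apply: fg; rewrite ncM nc_expi mulr1 ncC_ge0.
Qed.

Lemma hn_sup f K : dcont f -> 0 <= K -> (forall z, nc z < 1 -> nc (f z) <= K) -> hn f K.
Proof.
move=> cf K0 fK; rewrite -[K]mulr1; apply: (@hn_le f (fun=> 1)) => //.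
- by apply: hol_dcont; exact: hol_cst.
- by move=> z /fK; rewrite nc1 mulr1.
apply/(h2norm_series (pser_cst 1) ler01) => -[|n]; first by rewrite big_ord0.
rewrite big_ord_recl big1 => [|i _]; last by rewrite nc0 expr0n.
by rewrite /= nc1 addr0.
Qed.

(** Obtained on coefficients from |x + y|^2 <= 2 |x|^2 + 2 |y|^2; the factor 2 replaces the sharp
    triangle inequality and accounts for the numerical constants of later estimates. *)
Lemma hnD f g A B : hol f -> hol g -> 0 <= A -> 0 <= B -> hn f A -> hn g B ->
  hn (fun z => f z + g z) (2 * (A + B)).
Proof.
move=> /hol_pser[c cf] /hol_pser[d dg] A0 B0 /(h2norm_series cf A0) HA /(h2norm_series dg B0) HB.
apply/(h2norm_series (pserD cf dg)) => [|n]; first by rewrite mulr_ge0// addr_ge0.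
apply: (@le_trans _ _ (2 * A ^+ 2 + 2 * B ^+ 2)); last first.
  by rewrite -subr_ge0 (_ : _ - _ = 2 * A ^+ 2 + 2 * B ^+ 2 + 8 * (A * B)) ?addr_ge0 ?mulr_ge0 ?sqr_ge0//; ring.
apply: le_trans (lerD (ler_wpM2l _ (HA n)) (ler_wpM2l _ (HB n))) => //.
rewrite !mulr_sumr -big_split ler_sum// => k _ /=.
apply: (@le_trans _ _ ((nc (c k) + nc (d k)) ^+ 2)).
  by rewrite lerXn2r ?nnegrE ?addr_ge0 ?nc_ge0// ncD.
by rewrite -subr_ge0 (_ : _ - _ = (nc (c k) - nc (d k)) ^+ 2) ?sqr_ge0//; ring.
Qed.

Lemma hnN f A : hol f -> 0 <= A -> hn f A -> hn (fun z => - f z) A.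
Proof.
move=> hf A0 fA; rewrite -[A]mul1r; apply: hn_le fA => //; last 1 first.
- by move=> z _; rewrite ncN mul1r.
- apply: hol_dcont; apply: hol_ext (holZ (-1) hf) => z _; exact: mulN1r.
- exact: hol_dcont.
Qed.

Lemma hnB f g A B : hol f -> hol g -> 0 <= A -> 0 <= B -> hn f A -> hn g B ->
  hn (fun z => f z - g z) (2 * (A + B)).
Proof.
move=> hf hg A0 B0 fA gB; apply: hnD => //; last exact: hnN.
by apply: hol_ext (holZ (-1) hg) => z _; exact: mulN1r.
Qed.

(** Cauchy and Schwarz for the coefficients against the powers of z, in the form of the weighted
    inequality 2 a x <= a^2 l + x^2 / l, with l chosen at the end. It turns norm convergence into
    pointwise convergence and limits the growth towards the circle. *)
Lemma hn_point f M z : hol f -> 0 < M -> hn f M -> nc z < 1 ->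
  nc (f z) ^+ 2 * (1 - nc z) <= M ^+ 2.
Proof.
move=> hf M0 fM z1; have [c cf] := hol_pser hf.
have HM := (h2norm_series cf (ltW M0)).1 fM; have z0 := nc_ge0 z.
have z10 : 0 < 1 - nc z by rewrite subr_gt0.
pose G := (1 - nc z)^-1; have G0 : 0 < G by rewrite invr_gt0.
have amgm l : 0 < l -> 2 * nc (f z) <= M ^+ 2 * l + G / l.
  move=> l0; rewrite -ler_pdivlMl//.
  apply: (@clim_nc_le _ _ \oo _ _ _ _ (cf.2 z z1)); apply: filterE => n /=.
  rewrite ler_pdivlMl//; apply: le_trans (ler_wpM2l _ (nc_sum _ _)) _ => //.
  apply: (@le_trans _ _ (\sum_(k < n) (nc (c k) ^+ 2 * l + nc z ^+ k / l))).
    rewrite mulr_sumr ler_sum// => k _; rewrite ncM ncX.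
    set a := nc (c k); set x := nc z ^+ k.
    have x01 : 0 <= x <= 1 by rewrite exprn_ge0//= exprn_ile1// ltW.
    have /andP[x0 x1] := x01.
    apply: (@le_trans _ _ (a ^+ 2 * l + x ^+ 2 / l)); last first.
      rewrite lerD2l ler_wpM2r ?invr_ge0 ?(ltW l0)//.
      by rewrite expr2 ler_piMr.
    rewrite -subr_ge0 (_ : _ - _ = (a * l - x) ^+ 2 / l); last by field; rewrite gt_eqF.
    by rewrite mulr_ge0 ?sqr_ge0 ?invr_ge0 ?(ltW l0).
  have q01 : 0 <= nc z < 1 by rewrite z0.
  rewrite big_split /= -!mulr_suml; apply: lerD.
    by rewrite ler_wpM2r ?(ltW l0)// HM.
  by rewrite ler_wpM2r ?invr_ge0 ?(ltW l0)//; exact: (geom_sum_le n q01).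
have [->|f0] := eqVneq (nc (f z)) 0; first by rewrite expr0n mul0r sqr_ge0.
have fp : 0 < nc (f z) by rewrite lt_def f0 nc_ge0.
have M2 : 0 < M ^+ 2 by rewrite exprn_gt0.
(* For this weight the first term becomes |f(z)| and is absorbed by the left side. *)
have := amgm (nc (f z) / M ^+ 2) (divr_gt0 fp M2).
rewrite mulrCA divff ?gt_eqF// mulr1 invf_div => H.
have H2 : nc (f z) <= G * M ^+ 2 / nc (f z) by rewrite -mulrA; move: H; lra.
by move: H2; rewrite ler_pdivlMr// => /(ler_wpM2r (ltW z10)); rewrite -expr2 (mulrAC G) mulVf ?gt_eqF// mul1r.
Qed.

(** Choose n with the n-th partial square sum within [e ^+ 2] of the supremum; the remaining
    coefficients then have square sum at most [e ^+ 2]. *)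
Lemma hn_tail c f M e : pser c f -> 0 <= M -> hn f M -> 0 < e ->
  exists n, hn (fun z => f z - psum c n z) e.
Proof.
move=> cf M0 /(h2norm_series cf M0) HM e0.
pose s n := \sum_(k < n) nc (c k) ^+ 2.
have hs : has_sup (range s).
  by split; [exists (s 0%N), 0%N | exists (M ^+ 2) => _ [n _ <-]; exact: HM].
have e2 : 0 < e ^+ 2 by rewrite exprn_gt0.
have [_ [n _ <-] Hn] := sup_adherent e2 hs; exists n.
apply/(h2norm_series (pser_tail n cf) (ltW e0)) => m.
have sm k : s k <= sup (range s) by apply: (ub_le_sup (proj2 hs)); exists k.
apply: (@le_trans _ _ (s (n + m)%N - s n)); last first.
  by have := sm (n + m)%N; move: Hn; lra.
rewrite /s big_split_ord /= addrAC subrr add0r.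
have [mn|nm] := leqP m n.
  rewrite big1 ?sumr_ge0// => i _; first by rewrite sqr_ge0.
  by rewrite (leq_trans (ltn_ord i) mn) nc0 expr0n.
have [j ->] : exists j, m = (n + j)%N by exists (m - n)%N; rewrite subnKC// ltnW.
rewrite big_split_ord /= big1 ?add0r => [|i _]; last by rewrite ltn_ord nc0 expr0n.
rewrite (addnC n j) big_split_ord /=.
rewrite (eq_bigr (fun i : 'I_j => nc (c (n + i)%N) ^+ 2)) => [|i _]; last by rewrite ltnNge leq_addr.
by rewrite lerDl sumr_ge0// => i _; rewrite sqr_ge0.
Qed.

Lemma H2P f : H2 f <-> hol f /\ exists2 M, 0 < M & hn f M.
Proof.
rewrite /H2 /=; split=> [[/holP hf fy]|[/holP hf [M _ fM]]]; split=> //; last first.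
  by rewrite (le_lt_trans fM)// ltry.
have f0 : (0 <= h2norm f)%E by rewrite /h2norm poweR_ge0.
rewrite -ge0_fin_numE// in fy; exists (fine (h2norm f) + 1); first by rewrite ltr_wpDl// fine_ge0.
by rewrite /hn -{1}(fineK fy) lee_fin lerDl.
Qed.

End hardy_norm.

(** * Peak functions and the disk algebra *)

Section peaks.
Context {R : realType}.
Implicit Types (c d : nat -> R[i]) (b f g F : R[i] -> R[i]) (z w zeta xi : R[i]) (delta eta : R).

Lemma geometric_clim (a z : R[i]) : nc (a * z) < 1 ->
  clim \oo (psum (fun k => a ^+ k) ^~ z) (1 - a * z)^-1.
Proof.
move=> az1 e e0; set w := a * z in az1 *.
have w1 : 1 - w != 0.
  by apply/eqP => /subr0_eq E; move: az1; rewrite -E nc1 ltxx.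
have E n : psum (fun k => a ^+ k) n z = (1 - w ^+ n) * (1 - w)^-1.
  apply: (mulIf w1); rewrite mulfVK//.
  rewrite /psum; elim: n => [|n IH]; first by rewrite big_ord0 mul0r expr0 subrr.
  by rewrite big_ord_recr /= mulrDl IH -exprMn -/w exprS; ring.
have n0 := nc_ge0 w; have p0 : 0 < nc (1 - w) by exact: nc_gt0.
have : (fun n => nc w ^+ n) @ \oo --> 0 by apply: cvg_expr; rewrite ger0_norm.
move=> /cvgrPdist_lt /(_ _ (mulr_gt0 e0 p0)); apply: filterS => n.
rewrite sub0r normrN ger0_norm ?exprn_ge0// => /ltW H /=.
rewrite E (_ : _ - _ = - (w ^+ n * (1 - w)^-1)); last by ring.
by rewrite ncN ncM ncX ncV ler_pdivrMr.
Qed.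

Definition peak zeta delta z : R[i] := delta%:C / (1 + delta%:C - cj zeta * z).

Lemma peak_denom_ge zeta delta z : nc zeta = 1 -> 0 < delta -> nc z <= 1 ->
  delta <= nc (1 + delta%:C - cj zeta * z).
Proof.
move=> z1 d0 zz; have := nc_subl (1 + delta%:C) (cj zeta * z).
rewrite ncM nc_conj z1 mul1r -[1 + _]/((1 : R)%:C + delta%:C) -ofrealD ncC_ge0 ?addr_ge0 ?(ltW d0)//.
by move=> /(le_trans _); apply; rewrite lerBrDr; lra.
Qed.

Lemma peak_denom_neq0 zeta delta z : nc zeta = 1 -> 0 < delta -> nc z <= 1 ->
  1 + delta%:C - cj zeta * z != 0.
Proof.
move=> z1 d0 zz; apply/eqP => E; have := peak_denom_ge z1 d0 zz.
by rewrite E nc0 leNgt d0.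
Qed.

(** With w = conj zeta z the squared moduli differ by delta^2 + 2 delta (1 - Re w). This gives the
    decay of the peak away from [zeta]. *)
Lemma peak_denom_far zeta delta z : nc zeta = 1 -> 0 < delta -> nc z <= 1 ->
  nc (z - zeta) <= nc (1 + delta%:C - cj zeta * z).
Proof.
move=> z1 d0 zz.
have -> : nc (z - zeta) = nc (1 - cj zeta * z).
  rewrite ncBC -[LHS]mul1r -{1}z1 -(nc_conj zeta) -ncM; congr nc.
  by rewrite mulrBr (mulrC _ zeta) mulr_cj z1 expr1n.
have w1 : nc (cj zeta * z) <= 1 by rewrite ncM nc_conj z1 mul1r.
move: (cj zeta * z) w1 => w w1.
have r1 : cre w <= 1 by rewrite (le_trans (ler_norm _))// (le_trans (nc_re _)).
rewrite -(@ler_pXn2r _ 2)// ?nnegrE ?nc_ge0// !nc_sqr !creB !cimB !creD !cimD /=.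
rewrite -subr_ge0 (_ : _ - _ = delta ^+ 2 + 2 * delta * (1 - cre w)); last by ring.
by rewrite addr_ge0 ?sqr_ge0// mulr_ge0 ?subr_ge0// mulr_ge0// ltW.
Qed.

Lemma peak_le1 zeta delta z : nc zeta = 1 -> 0 < delta -> nc z <= 1 -> nc (peak zeta delta z) <= 1.
Proof.
move=> z1 d0 zz; have := peak_denom_ge z1 d0 zz => H.
by rewrite ncM ncV ncC_ge0 ?(ltW d0)// ler_pdivrMr ?mul1r// (lt_le_trans d0).
Qed.

Lemma peak_far zeta delta z : nc zeta = 1 -> 0 < delta -> nc z <= 1 ->
  nc (peak zeta delta z) * nc (z - zeta) <= delta.
Proof.
move=> z1 d0 zz; have h1 := peak_denom_ge z1 d0 zz; have h2 := peak_denom_far z1 d0 zz.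
have D0 := lt_le_trans d0 h1.
rewrite ncM ncV ncC_ge0 ?(ltW d0)// mulrAC ler_pdivrMr// ler_wpM2l// ltW//.
Qed.

Lemma peak_hol zeta delta : nc zeta = 1 -> 0 < delta -> hol (peak zeta delta).
Proof.
move=> z1 d0; apply: holM; first exact: hol_cst.
apply: holV => [z /ltW zz|]; first exact: peak_denom_neq0.
by apply: holB; [exact: hol_cst|apply: holZ; exact: hol_id].
Qed.

Lemma peak_ratio zeta delta : nc zeta = 1 -> 0 < delta ->
  nc (cj zeta / (1 + delta%:C)) = (1 + delta)^-1.
Proof.
move=> z1 d0; rewrite ncM nc_conj z1 mul1r ncV -[1 + _]/((1 : R)%:C + delta%:C) -ofrealD.
by rewrite ncC_ge0// addr_ge0// ltW.
Qed.

Lemma peakE zeta delta z : nc zeta = 1 -> 0 < delta -> nc z <= 1 ->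
  peak zeta delta z = delta%:C / (1 + delta%:C) * (1 - cj zeta / (1 + delta%:C) * z)^-1.
Proof.
move=> z1 d0 zz; have D0 := peak_denom_neq0 z1 d0 zz.
have d1 : 1 + delta%:C != 0 :> R[i].
  by rewrite -[1 + _]/((1 : R)%:C + delta%:C) -ofrealD (fmorph_eq0 (real_complex R)) gt_eqF// addr_gt0.
have -> : 1 - cj zeta / (1 + delta%:C) * z = (1 + delta%:C - cj zeta * z) / (1 + delta%:C).
  by field.
by rewrite /peak; move: D0; set D := 1 + delta%:C - _ => D0; field; rewrite D0 d1.
Qed.

Lemma peak_coef_bound zeta delta k : nc zeta = 1 -> 0 < delta ->
  nc (delta%:C / (1 + delta%:C) * (cj zeta / (1 + delta%:C)) ^+ k) = delta * (1 + delta)^-1 ^+ k.+1.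
Proof.
move=> z1 d0; rewrite ncM ncX peak_ratio// ncM ncV.
rewrite -[1 + delta%:C]/((1 : R)%:C + delta%:C) -ofrealD !ncC_ge0 ?addr_ge0 ?(ltW d0)//.
by rewrite exprS mulrA.
Qed.

Lemma peak_clim zeta delta z : nc zeta = 1 -> 0 < delta -> nc z <= 1 ->
  clim \oo (psum (fun k => delta%:C / (1 + delta%:C) * (cj zeta / (1 + delta%:C)) ^+ k) ^~ z) (peak zeta delta z).
Proof.
move=> z1 d0 zz; rewrite peakE//.
have H : nc (cj zeta / (1 + delta%:C) * z) < 1.
  rewrite ncM peak_ratio//; apply: (@le_lt_trans _ _ ((1 + delta)^-1)).
    by rewrite ler_piMr// invr_ge0 addr_ge0// ltW.
  by rewrite invf_lt1 ?addr_gt0// ltrDl.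
rewrite (_ : _ ^~ z = (fun n => delta%:C / (1 + delta%:C) *
    psum (fun k => (cj zeta / (1 + delta%:C)) ^+ k) n z)); first exact: climZ (geometric_clim H).
by apply/funext => n; rewrite /psum mulr_sumr; apply: eq_bigr => k _; rewrite mulrA.
Qed.

Lemma peak_pser zeta delta : nc zeta = 1 -> 0 < delta ->
  pser (fun k => delta%:C / (1 + delta%:C) * (cj zeta / (1 + delta%:C)) ^+ k) (peak zeta delta).
Proof.
move=> z1 d0; split=> [r /andP[r0 r1]|z /ltW zz]; last exact: peak_clim.
have q1 : (1 + delta)^-1 <= 1 by rewrite invf_le1 ?addr_gt0// lerDl ltW.
have q0 : 0 <= (1 + delta)^-1 by rewrite invr_ge0 addr_ge0// ltW.
exists delta => k; rewrite peak_coef_bound//.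
by rewrite -mulrA ler_piMr ?(ltW d0)// mulr_ile1 ?exprn_ge0 ?exprn_ile1 ?(ltW r0) ?(ltW r1).
Qed.

(** The coefficients are geometric, and their square sum is at most delta / (2 + delta). *)
Lemma peak_hn zeta delta : nc zeta = 1 -> 0 < delta -> hn (peak zeta delta) (Num.sqrt delta).
Proof.
move=> z1 d0; apply/(h2norm_series (peak_pser z1 d0)); first exact: sqrtr_ge0.
move=> n; rewrite sqr_sqrtr ?(ltW d0)//.
have D0 : 0 < 1 + delta by rewrite addr_gt0.
pose q := (1 + delta)^-1.
have q0 : 0 < q by rewrite invr_gt0.
have q1 : q < 1 by rewrite invf_lt1// ltrDl.
have qq : 0 <= q ^+ 2 < 1 by rewrite exprn_ge0 ?(ltW q0)//= exprn_ilt1 ?(ltW q0).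
under eq_bigr do rewrite peak_coef_bound// exprMn exprAC (exprS ((1 + delta)^-1 ^+ 2)) mulrA.
rewrite -mulr_sumr; apply: le_trans (ler_wpM2l _ (geom_sum_le n qq)) _.
  by rewrite mulr_ge0 ?sqr_ge0.
have -> : delta ^+ 2 * (1 + delta)^-1 ^+ 2 / (1 - q ^+ 2) = delta / (2 + delta).
  have h1 : 2 + delta != 0 by rewrite gt_eqF// addr_gt0.
  have h2 : 1 + delta != 0 by rewrite gt_eqF.
  have h3 : delta != 0 by rewrite gt_eqF.
  have -> : 1 - q ^+ 2 = delta * (2 + delta) / (1 + delta) ^+ 2 by rewrite /q; field.
  by field; rewrite h1 h2 h3.
by rewrite ler_pdivrMr ?addr_gt0// ler_peMr ?(ltW d0)//; lra.
Qed.

(** Polynomial approximation on the closed disk is the form that reduces commutators to monomials;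
    it also fixes the values on the circle, in particular at [xi]. *)
Definition disk_algebra b := forall e : R, 0 < e ->
  exists c n, forall z, nc z <= 1 -> nc (b z - psum c n z) <= e.

Lemma psum_poly c n z : psum c n z = (\poly_(i < n) c i).[z].
Proof. by rewrite horner_poly. Qed.

Lemma poly_psum (p : {poly R[i]}) z : p.[z] = psum (fun i => p`_i) (size p) z.
Proof. by rewrite horner_coef. Qed.

Lemma psum_bounded c n : exists2 B : R, 0 < B & forall z, nc z <= 1 -> nc (psum c n z) <= B.
Proof.
exists (\sum_(k < n) nc (c k) + 1); first by rewrite ltr_wpDl// sumr_ge0// => k _; exact: nc_ge0.
move=> z z1; rewrite (le_trans (nc_sum _ _))// (@le_trans _ _ (\sum_(k < n) nc (c k)))// ?lerDl//.
by rewrite ler_sum// => k _; rewrite ncM ncX ler_piMr ?nc_ge0// exprn_ile1 ?nc_ge0.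
Qed.

Lemma disk_algebra_bounded b : disk_algebra b ->
  exists2 B : R, 0 < B & forall z, nc z <= 1 -> nc (b z) <= B.
Proof.
move=> /(_ 1 ltr01) [c [n H]]; have [B B0 HB] := psum_bounded c n.
exists (1 + B) => [|z z1]; first by rewrite addr_gt0.
by rewrite -[b z](subrK (psum c n z)) (le_trans (ncD _ _))// lerD ?H ?HB.
Qed.

Lemma disk_algebra_psum c n : disk_algebra (psum c n).
Proof. by move=> e e0; exists c, n => z _; rewrite subrr nc0 ltW. Qed.

Lemma disk_algebra_poly (p : {poly R[i]}) : disk_algebra (fun z => p.[z]).
Proof.
by move=> e e0; exists (fun i => p`_i), (size p) => z _; rewrite poly_psum subrr nc0 ltW.
Qed.

Lemma disk_algebraD b f : disk_algebra b -> disk_algebra f -> disk_algebra (fun z => b z + f z).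
Proof.
move=> hb hf e e0; have e2 : 0 < e / 2 by rewrite divr_gt0.
have [c [n H]] := hb _ e2; have [d [m K]] := hf _ e2.
pose p := \poly_(i < n) c i + \poly_(i < m) d i.
exists (fun i => p`_i), (size p) => z z1; rewrite -poly_psum hornerD -!psum_poly.
rewrite (_ : _ - _ = (b z - psum c n z) + (f z - psum d m z)); last by ring.
by rewrite (le_trans (ncD _ _))// (splitr e) lerD ?H ?K.
Qed.

Lemma disk_algebraM b f : disk_algebra b -> disk_algebra f -> disk_algebra (fun z => b z * f z).
Proof.
move=> hb hf e e0; have [B B0 HB] := disk_algebra_bounded hb.
have eB : 0 < e / 2 / B by rewrite !divr_gt0.
have [d [m K]] := hf _ eB; have [D D0 HD] := psum_bounded d m.
have eD : 0 < e / 2 / D by rewrite !divr_gt0.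
have [c [n H]] := hb _ eD.
pose p := \poly_(i < n) c i * \poly_(i < m) d i.
exists (fun i => p`_i), (size p) => z z1; rewrite -poly_psum hornerM -!psum_poly.
rewrite (_ : _ - _ = b z * (f z - psum d m z) + (b z - psum c n z) * psum d m z); last by ring.
rewrite (le_trans (ncD _ _))// (splitr e) !ncM lerD//.
  apply: (@le_trans _ _ (B * (e / 2 / B))); last by rewrite mulrC divfK// gt_eqF.
  by apply: ler_pM; rewrite ?nc_ge0 ?HB ?K.
apply: (@le_trans _ _ (e / 2 / D * D)); last by rewrite divfK// gt_eqF.
by apply: ler_pM; rewrite ?nc_ge0 ?HD ?H.
Qed.

Lemma disk_algebra_cst (a : R[i]) : disk_algebra (fun=> a).
Proof. by have := disk_algebra_poly a%:P; under eq_fun do rewrite hornerC. Qed.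

Lemma disk_algebraX n : disk_algebra (fun z => z ^+ n).
Proof. by have := disk_algebra_poly 'X^n; under eq_fun do rewrite hornerXn. Qed.

Lemma disk_algebra_peak zeta delta : nc zeta = 1 -> 0 < delta -> disk_algebra (peak zeta delta).
Proof.
move=> z1 d0 e e0.
pose c k := delta%:C / (1 + delta%:C) * (cj zeta / (1 + delta%:C)) ^+ k : R[i].
pose q := (1 + delta)^-1.
have D0 : 0 < 1 + delta by rewrite addr_gt0.
have q0 : 0 < q by rewrite invr_gt0.
have q1 : q < 1 by rewrite invf_lt1// ltrDl.
have q01 : 0 <= q < 1 by rewrite (ltW q0).
have cM k : nc (c k) * (1 + delta) ^+ k <= delta.
  rewrite peak_coef_bound// -mulrA ler_piMr ?(ltW d0)// exprS -mulrA -exprMn mulVf ?gt_eqF//.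
  by rewrite expr1n mulr1 ltW.
pose D := delta * (1 - q)^-1.
have DD : 0 < D + 1 by rewrite ltr_wpDl// mulr_ge0 ?(ltW d0)// invr_ge0 subr_ge0 ltW.
have : (fun n => q ^+ n) @ \oo --> 0 by apply: cvg_expr; rewrite ger0_norm ?(ltW q0).
move=> /cvgrPdist_lt /(_ _ (divr_gt0 e0 DD)) [N _ /(_ N (leqnn N))].
rewrite /= sub0r normrN ger0_norm ?exprn_ge0 ?(ltW q0)// ltr_pdivlMr// => HN.
exists c, N => z zz.
have zq : nc z <= q * (1 + delta) by rewrite mulVf ?gt_eqF.
apply: le_trans (psum_tail N D0 q01 cM zq (peak_clim z1 d0 zz)) _.
apply: le_trans (ltW HN); rewrite -/D [leRHS]mulrDr mulr1 mulrC lerDl.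
by rewrite exprn_ge0// ltW.
Qed.

Lemma disk_algebra_clim b z : disk_algebra b -> nc z <= 1 ->
  clim (within [set w | nc w <= 1] (cnbhs z)) b (b z).
Proof.
move=> hb z1 e e0; have e3 : 0 < e / 3 by rewrite divr_gt0.
have [c [n H]] := hb _ e3.
have cP : clim (cnbhs z) (psum c n) (psum c n z).
  by apply: clim_sum => i; apply: climZ; apply: climX; exact: clim_id.
have [d d0 K] := cP _ e3; exists d => // w wd /= w1.
have -> : b w - b z = (b w - psum c n w) + (psum c n w - psum c n z) - (b z - psum c n z) by ring.
have -> : e = e / 3 + e / 3 + e / 3 by field.
apply: (le_trans (ncB _ _)); apply: lerD; last exact: H.
by apply: (le_trans (ncD _ _)); apply: lerD; [exact: H|exact: K].
Qed.

Lemma psum_hol c n : hol (psum c n).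
Proof.
elim: n => [|n IH]; first by apply: hol_ext (hol_cst 0) => z _; rewrite /psum big_ord0.
by apply: hol_ext (holD IH (holZ (c n) (holX n))) => z _; rewrite psumS.
Qed.

Lemma disk_algebra_hol b : disk_algebra b -> hol b.
Proof.
move=> hb; apply: hol_uniform => r /andP[_ r1] e /hb [c [n H]]; exists (psum c n); first exact: psum_hol.
by move=> z zr; apply: H; rewrite (le_trans zr)// ltW.
Qed.

(* The peak at [xi] is small in [H^2] and takes the value 1 at [xi], so [F] is
   approximated in norm by functions of the disk algebra vanishing at [xi]. *)
Lemma hn_concentrated F M xi e : hol F -> 0 < M -> hn F M -> nc xi = 1 -> 0 < e ->
  exists2 kappa, 0 < kappa & forall b, hol b -> (forall z, nc z < 1 -> nc (b z) <= 3) ->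
    (forall z, nc z < 1 -> kappa <= nc (z - xi) -> nc (b z) <= kappa) ->
    hn (fun z => b z * F z) e.
Proof.
move=> hF M0 FM x1 e0; have [c cF] := hol_pser hF.
pose e1 := e / 30; have e10 : 0 < e1 by rewrite divr_gt0.
have [n Hn] := hn_tail cF (ltW M0) FM e10.
pose P := psum c n; pose p0 := nc (P xi).
have p00 : 0 <= p0 := nc_ge0 _.
(* The peak has norm at most sqrt eta, so after multiplication by P(xi) it stays below e1. *)
pose eta := (e1 / (p0 + 1)) ^+ 2.
have p10 : 0 < p0 + 1 by rewrite ltr_wpDl.
have eta0 : 0 < eta by rewrite exprn_gt0// divr_gt0.
pose phi z := P z - P xi * peak xi eta z.
have dphi : disk_algebra phi.
  have h := disk_algebraD (disk_algebra_psum c n)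
    (disk_algebraM (disk_algebra_cst (- P xi)) (disk_algebra_peak x1 eta0)).
  by move=> t /h; under eq_exists => c' do under eq_exists => n' do under eq_forall => z do rewrite mulNr.
have [B B0 HB] := disk_algebra_bounded dphi.
have phi0 : phi xi = 0.
  have E : peak xi eta xi = 1.
    rewrite /peak mulrC (mulrC (cj xi)) mulr_cj x1 expr1n addrAC subrr add0r mulVf//.
    by rewrite (fmorph_eq0 (real_complex R)) gt_eqF.
  by rewrite /phi E mulr1 subrr.
have x1' : nc xi <= 1 by rewrite x1.
have [d d0 Hd] := disk_algebra_clim dphi x1' e10.
(* Within d of [xi], |b| <= 3 and |phi| <= e1; elsewhere |b| <= e1 / B and |phi| <= B. *)
exists (Num.min (d / 2) (e1 / B)); first by rewrite lt_min !divr_gt0.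
move=> b hb b3 bk.
have hP : hol P := psum_hol c n.
have hpk := peak_hol x1 eta0.
have hphi := disk_algebra_hol dphi.
have H1 : hn (fun z => b z * phi z) (3 * e1).
  apply: hn_sup; [exact/hol_dcont/holM|by rewrite mulr_ge0// ltW|].
  move=> z z1; rewrite ncM; have [dz|zd] := leP d (nc (z - xi)).
    apply: (@le_trans _ _ (e1 / B * B)); last by rewrite divfK ?gt_eqF// ler_peMl ?(ltW e10)// ler1n.
    apply: ler_pM; rewrite ?nc_ge0 ?(HB _ (ltW z1))//.
    apply: le_trans (bk z z1 _) _; last by rewrite ge_min lexx orbT.
    by rewrite ge_min; apply/orP; left; apply: le_trans dz; rewrite ler_pdivrMr// ler_peMr ?(ltW d0)// ler1n.
  apply: ler_pM; rewrite ?nc_ge0 ?b3//.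
  by have := Hd z zd (ltW z1); rewrite /= phi0 subr0.
have H2 : hn (fun z => P xi * peak xi eta z) e1.
  apply: (@hn_weak _ _ (p0 * Num.sqrt eta)).
    rewrite /eta sqrtr_sqr ger0_norm; last by rewrite divr_ge0// ltW.
    by rewrite mulrCA ler_piMr ?(ltW e10)// ler_pdivrMr// mul1r lerDl.
  apply: (hn_le _ _ _ _ _ (peak_hn x1 eta0)).
  - exact/hol_dcont/holZ.
  - exact/hol_dcont.
  - exact: p00.
  - exact: sqrtr_ge0.
  - by move=> z _; rewrite ncM.
have H3 := hnD (holZ (P xi) hpk) (holB hF hP) (ltW e10) (ltW e10) H2 Hn.
have H4 : hn (fun z => b z * (P xi * peak xi eta z + (F z - P z))) (3 * (2 * (e1 + e1))).
  apply: (hn_le _ _ _ _ _ H3).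
  - by apply/hol_dcont/holM => //; apply: holD; [exact: holZ|exact: holB].
  - by apply/hol_dcont/holD; [exact: holZ|exact: holB].
  - by [].
  - by rewrite mulr_ge0// addr_ge0// ltW.
  - by move=> z z1; rewrite ncM ler_wpM2r ?nc_ge0 ?b3.
have h5 := holM hb hphi.
have h6 := holM hb (holD (holZ (P xi) hpk) (holB hF hP)).
have p3 : 0 <= 3 * e1 by rewrite mulr_ge0// ltW.
have p6 : 0 <= 3 * (2 * (e1 + e1)) by rewrite !mulr_ge0// addr_ge0// ltW.
have := hnD h5 h6 p3 p6 H1 H4.
rewrite /hn (@h2norm_ext _ _ (fun z => b z * F z)) => [H|z _]; last by rewrite /phi; ring.
apply: hn_weak H; rewrite /e1; lra.
Qed.

End peaks.

(** * The Volterra operator *)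

Section volterra_operator.
Context {R : realType}.
Implicit Types (c d : nat -> R[i]) (b f h : R[i] -> R[i]) (z w : R[i]).

Lemma hol_bounded f (r : R) : hol f -> 0 < r < 1 ->
  exists2 B : R, 0 < B & forall z, nc z <= r -> nc (f z) <= B.
Proof.
move=> hf /andP[r0 r1]; have [c cf] := hol_pser hf.
pose s := (1 + r) / 2; have s01 : 0 < s < 1 by rewrite /s; apply/andP; split; lra.
have /andP[s0 s1] := s01; have [M HM] := cf.1 s s01.
pose q := r / s.
have q01 : 0 <= q < 1 by rewrite divr_ge0 ?(ltW r0) ?(ltW s0)//= ltr_pdivrMr// mul1r /s; lra.
have M0 : 0 <= M by apply: le_trans (HM 0%N); rewrite mulr_ge0 ?nc_ge0.
have /andP[q0 q1] := q01.
exists (M * (1 - q)^-1 + 1).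
  by rewrite ltr_wpDl// mulr_ge0// invr_ge0 subr_ge0 ltW.
move=> z zr; have zq : nc z <= q * s by rewrite divfK// gt_eqF.
have z1 : nc z < 1 by exact: le_lt_trans zr r1.
have := psum_tail 0 s0 q01 HM zq (cf.2 z z1).
by rewrite /psum big_ord0 subr0 expr0 mulr1 => /le_trans; apply; rewrite lerDl.
Qed.

Variable g : R[i] -> R[i].
Hypothesis hg : hol g.
Let V := volterra g.

Let hg' : hol (cderiv g) := cderiv_hol hg.

Lemma nc_scale (t : R) z : 0 <= t <= 1 -> nc (t%:C * z) <= nc z.
Proof. by move=> /andP[t0 t1]; rewrite ncM ncC_ge0// ler_piMl ?nc_ge0. Qed.

Lemma ccont_ray f z : dcont f -> nc z < 1 -> ccont 0 1 (fun t => f (t%:C * z)).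
Proof.
move=> cf z1; have cr : ccont 0 1 (fun t : R => t%:C * z).
  by apply: ccontM; [exact: ccont_ofreal|exact: ccont_cst].
by apply: (ccont_comp cr) => t tt; apply: cf; exact: le_lt_trans (nc_scale z tt) z1.
Qed.

Lemma volterra_ccont f z : hol f -> nc z < 1 ->
  ccont 0 1 (fun t => f (t%:C * z) * cderiv g (t%:C * z) * z).
Proof.
move=> hf z1; apply: ccontM; last exact: ccont_cst.
by apply: ccontM; apply: ccont_ray => //; exact: hol_dcont.
Qed.

(** The power series of f g' has a primitive vanishing at 0, and the fundamental theorem along the
    segment identifies it with the integral defining [V f]. All regularity of [V f] comes from
    here. *)
Lemma volterra_primitive f : hol f -> exists F, [/\ hol F, F 0 = 0,
  (forall z, nc z < 1 -> hasder F z (f z * cderiv g z)) & forall z, nc z < 1 -> V f z = F z].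
Proof.
move=> hf; have [c cf] := hol_pser (holM hf hg'); have [F [dF F0 HF]] := pser_primitive cf.
exists F; split=> //; first exact: pser_hol dF.
move=> z z1; rewrite /V /volterra -/(cint 0 1 _).
rewrite (@cint_FTC R 0 1 (fun t => F (t%:C * z)))//.
- by rewrite mul1r mul0r F0 subr0.
- move=> t /andP[t0 t1].
  have tz : nc (t%:C * z) < 1 by apply: le_lt_trans z1; apply: nc_scale; rewrite !ltW.
  have dt : cder (fun s : R => s%:C * z) t (1 * z + t%:C * 0) := cderM (cder_ofreal t) (cder_cst z t).
  by apply: cder_eq (cder_comp dt (HF _ tz)) _; ring.
- by apply: ccont_ray => //; apply: hol_dcont; exact: pser_hol dF.
- exact: volterra_ccont.
Qed.

Lemma volterra_hol f : hol f -> hol (V f).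
Proof.
by move=> hf; have [F [hF _ _ E]] := volterra_primitive hf; apply: hol_ext hF => z /E ->.
Qed.

Lemma volterra0 f : hol f -> V f 0 = 0.
Proof. by move=> hf; have [F [_ F0 _ E]] := volterra_primitive hf; rewrite E ?nc0. Qed.

Lemma volterra_cderiv f z : hol f -> nc z < 1 -> cderiv (V f) z = f z * cderiv g z.
Proof.
move=> hf z1; have [F [_ _ HF E]] := volterra_primitive hf.
apply: hasder_cderiv; apply/hasderP => e e0; have [d d0 H] := (hasderP _ _ _).1 (HF z z1) e e0.
exists (Num.min d (1 - nc z)); first by rewrite lt_min d0 subr_gt0.
move=> k; rewrite lt_min => /andP[kd kz]; rewrite !E ?H//.
by rewrite (le_lt_trans (ncD _ _))// addrC -ltrBrDr.
Qed.

Lemma volterra_bound f z B : hol f -> nc z < 1 ->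
  (forall w, nc w <= nc z -> nc (f w * cderiv g w) <= B) -> nc (V f z) <= 2 * B.
Proof.
move=> hf z1 H; rewrite /V /volterra -/(cint 0 1 _).
have := @cint_bound R 0 1 _ B ler01 (volterra_ccont hf z1); rewrite subr0 mulr1; apply.
move=> t tt; rewrite ncM -[B]mulr1; apply: ler_pM; rewrite ?nc_ge0 ?(ltW z1)//.
by apply: H; exact: nc_scale.
Qed.

(** Both derivatives are f g' up to the factor z^N; comparing their coefficients gives the
    relation. *)
Lemma volterra_shift_coef f F d N : hol f -> pser F (V f) -> pser d (V (fun z => z ^+ N * f z)) ->
  (forall j, (j <= N)%N -> d j = 0) /\ forall k, (N + k)%:R * d (N + k)%N = k%:R * F k.
Proof.
move=> hf pF pd; have hf' := holM (holX N) hf.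
have dF := pser_deriv pF (fun z => hol_cderiv (volterra_hol hf)).
have dd := pser_deriv pd (fun z => hol_cderiv (volterra_hol hf')).
have sF := pser_shift N dF.
have E : dcoef d = (fun k => if (k < N)%N then 0 else dcoef F (k - N)%N).
  apply: pser_unique dd (pser_ext sF _) => z z1.
  by rewrite !volterra_cderiv// mulrA.
have d0 : d 0%N = 0 by rewrite -(pser0 pd) volterra0.
have E' j : j.+1%:R * d j.+1 = if (j < N)%N then 0 else (j - N).+1%:R * F (j - N).+1.
  by move: E => /(congr1 (@^~ j)).
split=> [[//|j] jN|[|k]].
- have := E' j; rewrite jN => /eqP; rewrite mulf_eq0 pnatr_eq0 /= => /eqP //.
- rewrite addn0 mul0r; case: N {pd hf' dd sF E} E' => [|N] E'; first by rewrite mul0r.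
  by rewrite E' ltnSn.
- by rewrite addnS E' ltnNge leq_addr /= addKn.
Qed.

Lemma volterra_coef0 f F : hol f -> pser F (V f) -> F 0%N = 0.
Proof. by move=> hf pF; rewrite -(pser0 pF) volterra0. Qed.

(** The coefficients of [V f] are multiplied by k / (N + k): at most n / N for k < n, and at most 1
    on the tail, which is small in norm already. *)
Lemma hn_volterra_shift f M e : hol f -> 0 < M -> hn (V f) M -> 0 < e ->
  exists N, hn (V (fun z => z ^+ N * f z)) e.
Proof.
move=> hf M0 fM e0; have [F pF] := hol_pser (volterra_hol hf).
have e2 : 0 < e / 2 by rewrite divr_gt0.
have [n Hn] := hn_tail pF (ltW M0) fM e2.
have Tn := (h2norm_series (pser_tail n pF) (ltW e2)).1 Hn.
have HM := (h2norm_series pF (ltW M0)).1 fM.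
(* So large that the first n coefficients contribute at most (n / N) M <= e / 2. *)
pose N := (Num.truncn (2 * n%:R * M / e)).+1.
have HN : n%:R * M <= N%:R * (e / 2).
  have : 2 * n%:R * M / e <= N%:R by rewrite ltW// truncnS_gt.
  by rewrite ler_pdivrMr//; lra.
have N0 : 0 < N%:R :> R by rewrite ltr0n.
exists N; have [d pd] := hol_pser (volterra_hol (holM (holX N) hf)).
have [dz dS] := volterra_shift_coef hf pF pd.
apply/(h2norm_series pd (ltW e0)) => m.
have dk k : nc (d (N + k)%N) ^+ 2 <= (n%:R / N%:R) ^+ 2 * nc (F k) ^+ 2 +
    nc (if (k < n)%N then 0 else F k) ^+ 2.
  have nk : (N + k)%:R * nc (d (N + k)%N) = k%:R * nc (F k).
    by rewrite -!nc_natr -!ncM dS.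
  have Nk0 : 0 < (N + k)%:R :> R by rewrite ltr0n.
  have dE : nc (d (N + k)%N) = k%:R / (N + k)%:R * nc (F k).
    have Nkn : (N + k)%:R != 0 :> R by rewrite gt_eqF.
    by apply: (mulfI Nkn); rewrite nk mulrA (mulrCA (N + k)%:R) divff// mulr1.
  case: ltnP => kn.
    rewrite nc0 expr0n addr0 -exprMn lerXn2r ?nnegrE ?mulr_ge0 ?nc_ge0 ?invr_ge0//.
    rewrite dE ler_wpM2r ?nc_ge0//; apply: ler_pM; rewrite ?invr_ge0// ?ler_nat ?(ltnW kn)//.
    by rewrite lef_pV2 ?posrE// ler_nat leq_addr.
  apply: (@le_trans _ _ (nc (F k) ^+ 2)); last by rewrite lerDr mulr_ge0 ?sqr_ge0.
  rewrite lerXn2r ?nnegrE ?nc_ge0// dE ler_piMl ?nc_ge0// ler_pdivrMr// mul1r ler_nat.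
  exact: leq_addl.
apply: (@le_trans _ _ (\sum_(j < N + m) nc (d j) ^+ 2)).
  by rewrite (addnC N) big_split_ord lerDl sumr_ge0// => i _; rewrite sqr_ge0.
rewrite big_split_ord /= big1 ?add0r => [|i _]; last by rewrite dz ?nc0 ?expr0n// ltnW.
apply: le_trans; first by apply: ler_sum => k _; exact: dk.
rewrite big_split -mulr_sumr /=.
apply: (@le_trans _ _ ((e / 2) ^+ 2 + (e / 2) ^+ 2)); last first.
  rewrite -subr_ge0 (_ : _ - _ = e ^+ 2 / 2); last by field.
  by rewrite divr_ge0 ?sqr_ge0.
apply: lerD; last exact: Tn.
apply: le_trans (ler_wpM2l (sqr_ge0 _) (HM m)) _.
have nM : n%:R / N%:R * M <= e / 2 by rewrite mulrAC ler_pdivrMr// [leRHS]mulrC.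
rewrite -exprMn lerXn2r// nnegrE ?(ltW e2)//.
by rewrite (mulr_ge0 _ (ltW M0))// divr_ge0.
Qed.

Definition comm b f z := V (fun w => b w * f w) z - b z * V f z.

Lemma comm_hol b f : hol b -> hol f -> hol (comm b f).
Proof. by move=> hb hf; apply: holB; [exact/volterra_hol/holM|apply: holM => //; exact: volterra_hol]. Qed.

(** A flat f is at most 2 kappa on the disk of radius 1 / 2, hence [V f] is of order kappa there,
    and Cauchy's estimates at this radius bound the first K coefficients. *)
Lemma volterra_flat_coef K : exists2 C : R, 0 < C & forall f F kappa, hol f -> pser F (V f) -> 0 <= kappa ->
  (forall z, nc z < 1 -> nc (f z) * (1 - nc z) <= kappa) ->
  forall k, (k < K)%N -> nc (F k) <= C * kappa.
Proof.
have h12 : 0 < (1 / 2 : R) < 1 by apply/andP; split; lra.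
have [B B0 HB] := hol_bounded hg' h12.
exists (2 ^+ K * (8 * B)) => [|f F kappa hf pF k0 ff k kK]; first by rewrite mulr_gt0 ?exprn_gt0 ?mulr_gt0.
have cB := @cauchy_estimate _ F (V f) (1 / 2) (4 * B * kappa) k pF h12.
have : nc (F k) * (1 / 2) ^+ k <= 2 * (4 * B * kappa).
  apply: cB => z zE; rewrite (_ : 4 * B * kappa = 2 * (2 * kappa * B)); last by ring.
  apply: volterra_bound => // [|w]; rewrite zE; first by lra.
  move=> w2; have w1 : nc w < 1 by lra.
  rewrite ncM; apply: ler_pM; rewrite ?nc_ge0 ?HB//.
  have := ff w w1; have : nc (f w) * (1 / 2) <= nc (f w) * (1 - nc w).
    by rewrite ler_wpM2l ?nc_ge0//; lra.
  lra.
rewrite mul1r exprVn ler_pdivrMr ?exprn_gt0// => /le_trans; apply.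
rewrite (_ : 2 * (4 * B * kappa) = 8 * B * kappa); last by ring.
rewrite -[leRHS]mulrA [leLHS]mulrC ler_wpM2r//; last by rewrite ler_weXn2l ?ler1n// ltnW.
by rewrite (mulr_ge0 _ k0)// mulr_ge0// ltW.
Qed.

(** The coefficients of the commutator have modulus N |F_k| / (N + k). For k >= K the factor is at
    most N / K; the K lower ones are small by [volterra_flat_coef]. *)
Lemma hn_comm_monomial N M e : 0 < M -> 0 < e -> exists2 kappa, 0 < kappa &
  forall f, hol f -> hn (V f) M -> (forall z, nc z < 1 -> nc (f z) * (1 - nc z) <= kappa) ->
  hn (comm (fun z => z ^+ N) f) e.
Proof.
move=> M0 e0; have e2 : 0 < e / 2 by rewrite divr_gt0.
pose K := (Num.truncn (2 * N%:R * M / e)).+1.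
have HK : N%:R * M <= K%:R * (e / 2).
  have : 2 * N%:R * M / e <= K%:R by rewrite ltW// truncnS_gt.
  by rewrite ler_pdivrMr//; lra.
have K0 : 0 < K%:R :> R by rewrite ltr0n.
have [C C0 HC] := volterra_flat_coef K.
exists (e / 2 / (K%:R * C)); first by rewrite divr_gt0// mulr_gt0.
move=> f hf fM ff; have [F pF] := hol_pser (volterra_hol hf).
have HM := (h2norm_series pF (ltW M0)).1 fM.
have [d pd] := hol_pser (volterra_hol (holM (holX N) hf)).
have [dz dS] := volterra_shift_coef hf pF pd.
have pa := pserB pd (pser_shift N pF).
apply/(h2norm_series pa (ltW e0)) => m.
pose a k := d k - (if (k < N)%N then 0 else F (k - N)%N).
change (\sum_(k < m) nc (a k) ^+ 2 <= e ^+ 2).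
(* The division by K makes the K low coefficients contribute (e / 2)^2 altogether. *)
have Fk k : (k < K)%N -> nc (F k) ^+ 2 <= (e / 2) ^+ 2 / K%:R.
  move=> kK; have := HC f F _ hf pF _ ff k kK; rewrite divr_ge0 ?(ltW e2) ?mulr_ge0 ?(ltW K0) ?(ltW C0)// => /(_ isT).
  rewrite (_ : C * _ = e / 2 / K%:R); last by field; rewrite !gt_eqF.
  move=> H; apply: (@le_trans _ _ ((e / 2 / K%:R) ^+ 2)).
    by rewrite lerXn2r ?nnegrE ?nc_ge0// divr_ge0 ?(ltW e2) ?(ltW K0).
  rewrite exprMn ler_wpM2l ?sqr_ge0// expr2 ler_piMl ?invr_ge0 ?(ltW K0)//.
  by rewrite invf_le1// ler1n.
have ak k : nc (a (N + k)%N) ^+ 2 <= (N%:R / K%:R) ^+ 2 * nc (F k) ^+ 2 +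
    (if (k < K)%N then (e / 2) ^+ 2 / K%:R else 0).
  have aE : (N + k)%:R * a (N + k)%N = - (N%:R * F k).
    by rewrite /a ltnNge leq_addr /= addKn mulrBr dS natrD; ring.
  have naE : (N + k)%:R * nc (a (N + k)%N) = N%:R * nc (F k).
    by rewrite -!nc_natr -!ncM aE ncN.
  case: ltnP => kK.
    apply: (@le_trans _ _ (nc (F k) ^+ 2)); last first.
      by apply: le_trans (Fk k kK) _; rewrite lerDr mulr_ge0 ?sqr_ge0.
    rewrite lerXn2r ?nnegrE ?nc_ge0//.
    (* For N = k = 0 the relation [naE] is empty, but the coefficient vanishes because [V] produces
       functions vanishing at 0. *)
    have [Nk0|Nk] := posnP (N + k)%N.
      move: Nk0 => /eqP; rewrite addn_eq0 => /andP[/eqP N0 /eqP k0].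
      have : a (N + k)%N = 0.
        by rewrite /a ltnNge leq_addr /= addKn k0 addn0 dz// (volterra_coef0 hf pF) subrr.
      by move=> ->; rewrite nc0 nc_ge0.
    have Nk0 : 0 < (N + k)%:R :> R by rewrite ltr0n.
    rewrite -(ler_pM2l Nk0) naE ler_wpM2r ?nc_ge0// ler_nat leq_addr//.
  rewrite addr0 -exprMn lerXn2r ?nnegrE ?mulr_ge0 ?nc_ge0 ?invr_ge0//.
  rewrite mulrAC ler_pdivlMr// -naE mulrC ler_wpM2r ?nc_ge0// ler_nat.
  by rewrite (leq_trans kK)// leq_addl.
apply: (@le_trans _ _ (\sum_(j < N + m) nc (a j) ^+ 2)).
  by rewrite (addnC N) big_split_ord lerDl sumr_ge0// => i _; rewrite sqr_ge0.
rewrite big_split_ord /= big1 ?add0r => [|i _]; last first.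
  by rewrite /a ltn_ord subr0 dz ?nc0 ?expr0n// ltnW.
apply: le_trans; first by apply: ler_sum => k _; exact: ak.
rewrite big_split -mulr_sumr /=.
apply: (@le_trans _ _ ((e / 2) ^+ 2 + (e / 2) ^+ 2)); last first.
  rewrite -subr_ge0 (_ : _ - _ = e ^+ 2 / 2); last by field.
  by rewrite divr_ge0 ?sqr_ge0.
apply: lerD.
  apply: le_trans (ler_wpM2l (sqr_ge0 _) (HM m)) _.
  have nM : N%:R / K%:R * M <= e / 2 by rewrite mulrAC ler_pdivrMr// [leRHS]mulrC.
  rewrite -exprMn lerXn2r// nnegrE ?(ltW e2)//.
  by rewrite (mulr_ge0 _ (ltW M0))// divr_ge0.
set T := (e / 2) ^+ 2.
have T0 : 0 <= T by rewrite sqr_ge0.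
have cnt n : \sum_(k < n) (if (k < K)%N then T / K%:R else 0) <= (minn n K)%:R * (T / K%:R).
  elim: n => [|n IH]; first by rewrite big_ord0 min0n mul0r.
  rewrite big_ord_recr /=; case: ltnP => nK.
    have -> : minn n.+1 K = n.+1 by apply/minn_idPl.
    rewrite -natr1 mulrDl mul1r lerD2r; apply: le_trans IH _.
    by rewrite ler_wpM2r ?divr_ge0 ?(ltW K0)// ler_nat geq_minl.
  have -> : minn n.+1 K = K by apply/minn_idPr/leqW.
  by rewrite addr0; apply: le_trans IH _; rewrite ler_wpM2r ?divr_ge0 ?(ltW K0)// ler_nat geq_minr.
apply: le_trans (cnt m) _.
apply: (@le_trans _ _ (K%:R * (T / K%:R))); first by rewrite ler_wpM2r ?divr_ge0 ?(ltW K0)// ler_nat geq_minr.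
by rewrite mulrC divfK ?gt_eqF.
Qed.

End volterra_operator.

(** * Mean oscillation on an arc *)

Section oscillation.
Context {R : realType}.
Implicit Types (f g G u : R[i] -> R[i]) (z w : R[i]).
Local Notation mu := (@lebesgue_measure R).

Lemma Rintegral_translate (phi : R -> R) (a d : R) : 0 <= d -> {within `[a, a + d], continuous phi} ->
  (\int[mu]_(t in `[a, a + d]) phi t = \int[mu]_(s in `[0%R, d]) phi (s + a))%R.
Proof.
move=> d0 cphi; pose F (s : R) := s + a.
have dF (s : R) : is_derive s 1 F 1.
  have := is_deriveD (is_derive_id s 1) (is_derive_cst a s 1).
  by rewrite addr0.
have F'E : F^`()%classic = cst 1 by apply/funext => s; rewrite derive1E derive_val.
have := @integration_by_substitution_increasing R F phi 0 d d0.
rewrite /F add0r (addrC d) => H; rewrite /Rintegral (H _ _ _ _ _ cphi) => //.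
- by congr fine; apply: eq_integral => s _; rewrite /= -/F F'E /= mulr1.
- by move=> x y _ _ xy; rewrite ltrD2r.
- by rewrite -/F F'E => x _; exact: cvg_cst.
- by rewrite -/F F'E; exact: is_cvg_cst.
- by rewrite -/F F'E; exact: is_cvg_cst.
- have cF : continuous F by move=> s; apply: differentiable_continuous; apply/derivable1_diffP; case: (dF s).
  by split => [s _| |]; [case: (dF s)|apply: cvg_at_right_filter; exact: cF|apply: cvg_at_left_filter; exact: cF].
Qed.

Lemma pser_rotate c G (a : R) : pser c G -> pser (fun k => c k * expi a ^+ k) (fun z => G (expi a * z)).
Proof.
move=> [bc cG]; split=> [r r01|z z1].
  by have [M HM] := bc r r01; exists M => k; rewrite ncM ncX nc_expi expr1n mulr1.
rewrite (_ : _ ^~ z = psum c ^~ (expi a * z)); first by apply: cG; rewrite ncM nc_expi mul1r.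
by apply/funext => n; apply: eq_bigr => k _; rewrite exprMn mulrA.
Qed.

(** The arc may lie anywhere on the line of angles; rotating [G] preserves the moduli of its
    coefficients, hence its norm, and moves the arc inside [0, 2 pi]. *)
Lemma arc_mean_square G kappa (r a d : R) : hol G -> 0 <= kappa -> hn G kappa -> 0 <= r < 1 ->
  0 <= d <= 2 * pi ->
  (\int[mu]_(t in `[a, a + d]) nc (G (r%:C * expi t)) ^+ 2)%R <= 2 * pi * kappa ^+ 2.
Proof.
move=> hG k0 Gk r01 /andP[d0 d2]; have [c cG] := hol_pser hG.
have pi20 : (0 : R) < 2 * pi by rewrite mulr_gt0 ?pi_gt0.
have cR := pser_rotate a cG.
pose H z := G (expi a * z).
have Hk : hn H kappa.
  apply/(h2norm_series cR k0) => n; have := (h2norm_series cG k0).1 Gk n.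
  by under [X in _ -> X <= _]eq_bigr do rewrite ncM ncX nc_expi expr1n mulr1.
have hH : hol H := pser_hol cR.
have kH := ccont_circle (hol_dcont hH) r01.
have kHH := ccont_integrable_re (ccontM kH (ccont_conj kH)).
have := (h2norm_leP H k0).1 Hk r r01; rewrite mean_squareE ?lee_fin; [|exact: hol_dcont|by []].
rewrite ler_pdivrMl// cint_re => /(le_trans _); apply.
have E t : nc (G (r%:C * expi (t + a))) ^+ 2 = cre (H (r%:C * expi t) * cj (H (r%:C * expi t))).
  by rewrite mulr_cj /H expiD; congr (nc (G _) ^+ 2); ring.
rewrite Rintegral_translate//; last first.
  have cc : ccont a (a + d) (fun t => G (r%:C * expi t)).
    have cE : ccont a (a + d) (fun t : R => r%:C * expi t) by apply: ccontZ; exact: ccont_expi.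
    apply: (ccont_comp cE) => t _; apply: (hol_dcont hG).
    by move: r01 => /andP[r0 r1]; rewrite ncM nc_expi mulr1 ncC_ge0.
  have := ccont_re (ccontM cc (ccont_conj cc)).
  by rewrite (_ : _ \o _ = (fun t => nc (G (r%:C * expi t)) ^+ 2))//; apply/funext => t /=; rewrite mulr_cj.
have -> : (\int[mu]_(s in `[0%R, d]) nc (G (r%:C * expi (s + a))) ^+ 2 =
    \int[mu]_(t in `[0%R, d]) cre (H (r%:C * expi t) * cj (H (r%:C * expi t))))%R.
  by apply: eq_Rintegral => t _; exact: E.
rewrite /Rintegral fine_le//.
- apply: integrable_fin_num => //; apply: integrableS kHH => //.
  by apply: subset_itv; rewrite bnd_simp.
- exact: integrable_fin_num.
- apply: ge0_subset_integral => //.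
  + by case/integrableP: kHH.
  + by move=> t _; rewrite lee_fin mulr_cj /= sqr_ge0.
  + by apply: subset_itv; rewrite bnd_simp.
Qed.

Variable g : R[i] -> R[i].
Hypothesis hg : hol g.
Variables (a d kappa : R).
Hypotheses (d0 : 0 < d) (d1 : d <= 1) (kappa0 : 0 < kappa).

Let zeta : R[i] := expi a.
Definition test_fun (z : R[i]) : R[i] := (Num.sqrt d)^-1%:C * peak zeta d z.

Let z1 : nc zeta = 1. Proof. exact: nc_expi. Qed.
Let F := volterra g test_fun.
Hypothesis small : hn (fun z => peak zeta d z * F z) kappa.

Lemma test_fun_hol : hol test_fun.
Proof. by apply: holZ; exact: peak_hol. Qed.

Let hF : hol F := volterra_hol hg test_fun_hol.
Let sd := Num.sqrt d.
Let sd0 : 0 < sd. Proof. by rewrite sqrtr_gt0. Qed.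
Let sdd : sd * sd = d. Proof. by rewrite -expr2 sqr_sqrtr// ltW. Qed.
Let q z : R[i] := sd^-1%:C * (1 + d%:C - cj zeta * z).
(* As [test_fun] and [q] are inverse to each other and [F' = test_fun * g'], the
   derivative of [h] is [- F * q'], which no longer involves [g']. *)
Let h z := g z - F z * q z.
Let z0 : R[i] := (1 - d)%:C * zeta.

Let sdC : sd%:C != 0 :> R[i].
Proof. by rewrite (fmorph_eq0 (real_complex R)) gt_eqF. Qed.

Let h_der z : nc z < 1 -> hasder h z (F z * (cj zeta * sd^-1%:C)).
Proof.
move=> zz; have dg := hol_cderiv hg zz; have dF := hol_cderiv hF zz.
have dq : hasder q z (sd^-1%:C * (0 - cj zeta * 1)).
  apply: hasderZ; apply: hasderB; first exact: hasder_cst.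
  by apply: hasderZ; exact: hasder_id.
apply: hasder_eq (hasderB dg (hasderM dF dq)) _.
rewrite volterra_cderiv//; last exact: test_fun_hol.
have D0 := peak_denom_neq0 z1 d0 (ltW zz).
have -> : test_fun z * cderiv g z * q z = cderiv g z; last by ring.
have E : test_fun z * q z = 1.
  rewrite /test_fun /q /peak -/sd.
  have -> : d%:C = sd%:C * sd%:C :> R[i] by rewrite -ofrealM sdd.
  have -> : sd^-1%:C = sd%:C^-1 :> R[i] by rewrite fmorphV.
  by move: D0; rewrite -sdd ofrealM => D0; field; rewrite sdC D0.
by rewrite mulrAC E mul1r.
Qed.

Let near_zeta w : nc w < 1 -> nc (w - zeta) <= 3 * d -> nc (1 + d%:C - cj zeta * w) <= 4 * d.
Proof.
move=> w1 wz.
have -> : 1 + d%:C - cj zeta * w = d%:C + cj zeta * (zeta - w).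
  by rewrite mulrBr (mulrC (cj zeta) zeta) mulr_cj z1 expr1n; ring.
by rewrite (le_trans (ncD _ _))// ncM nc_conj z1 mul1r ncC_ge0 ?(ltW d0)// ncBC; lra.
Qed.

(** Within [3 * d] of [zeta] the peak has modulus at least 1 / 4, so smallness of its product with
    [F] passes to [F]. *)
Let F_le w : nc w < 1 -> nc (w - zeta) <= 3 * d -> nc (F w) <= 4 * nc (peak zeta d w * F w).
Proof.
move=> w1 wz; have nz := near_zeta w1 wz; have D0 := peak_denom_neq0 z1 d0 (ltW w1).
have Dp := nc_gt0 D0.
rewrite ncM mulrA ler_peMl ?nc_ge0// /peak ncM ncV ncC_ge0 ?(ltW d0)//.
by rewrite mulrA ler_pdivlMr// mul1r.
Qed.

(** [h] is integrated along a path from z to the interior point [z0]; its derivative is a multiple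
    of [F], which [hn_point] controls in terms of the distance to the circle. *)
Let h_dist z : nc z < 1 -> nc (z - zeta) <= 3 * d -> nc (h z - h z0) <= 64 * kappa.
Proof.
move=> zz zd.
have nz0 : nc z0 = 1 - d by rewrite ncM z1 mulr1 ncC_ge0// subr_ge0.
have z0d : nc (z0 - zeta) = d.
  rewrite (_ : z0 - zeta = - (d%:C * zeta)); last first.
    by rewrite /z0 -[1 - d]/(1 + - d) ofrealD rmorphN rmorph1; ring.
  by rewrite ncN ncM z1 mulr1 ncC_ge0// ltW.
(* The path starts possibly very near the circle. Since 1 - |w t| >= t^2 d, the value of [F] at w t
   is of order kappa / (t sqrt d); the quadratic parametrisation has speed proportional to t, which
   cancels this singularity uniformly in z. *)
pose w t : R[i] := z + t%:C ^+ 2 * (z0 - z).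
have wE t : w t = (1 - t ^+ 2)%:C * z + (t ^+ 2)%:C * z0.
  by rewrite /w -[1 - _]/(1 + - _) ofrealD rmorphN rmorph1 rmorphXn; ring.
have t2 (t : R) : 0 <= t <= 1 -> 0 <= t ^+ 2 <= 1.
  by move=> /andP[t0 t1]; rewrite sqr_ge0 exprn_ile1.
have w_le t : 0 <= t <= 1 -> nc (w t) <= (1 - t ^+ 2) * nc z + t ^+ 2 * (1 - d).
  move=> /t2/andP[s0 s1]; rewrite wE (le_trans (ncD _ _))//.
  by rewrite (ncM _ z) (ncM _ z0) nz0 !ncC_ge0 ?subr_ge0.
have w1 t : 0 <= t <= 1 -> nc (w t) < 1.
  move=> tt; have := w_le t tt; have /andP[s0 s1] := t2 t tt => W.
  have [->|tn0] := eqVneq t 0; first by rewrite /w rmorph0 expr0n mul0r addr0.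
  have sp : 0 < t ^+ 2 by rewrite lt_def s0 andbT sqrf_eq0.
  have := mulr_gt0 sp d0; have : (1 - t ^+ 2) * nc z <= (1 - t ^+ 2) * 1.
    by rewrite ler_wpM2l ?subr_ge0// ltW.
  by move: W; rewrite mulrBr; lra.
have w_far t : 0 <= t <= 1 -> t ^+ 2 * d <= 1 - nc (w t).
  move=> tt; have := w_le t tt; have /andP[s0 s1] := t2 t tt.
  have : (1 - t ^+ 2) * nc z <= (1 - t ^+ 2) * 1 by rewrite ler_wpM2l ?subr_ge0// ltW.
  by rewrite mulrBr; lra.
have wz t : 0 <= t <= 1 -> nc (w t - zeta) <= 3 * d.
  move=> tt; have /andP[s0 s1] := t2 t tt.
  have -> : w t - zeta = (1 - t ^+ 2)%:C * (z - zeta) + (t ^+ 2)%:C * (z0 - zeta).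
    by rewrite wE -[1 - _]/(1 + - _) ofrealD rmorphN rmorph1 rmorphXn; ring.
  rewrite (le_trans (ncD _ _))// (ncM _ (z - zeta)) (ncM _ (z0 - zeta)) z0d !ncC_ge0 ?subr_ge0//.
  apply: (@le_trans _ _ ((1 - t ^+ 2) * (3 * d) + t ^+ 2 * (3 * d))); last by rewrite -mulrDl subrK mul1r.
  apply: lerD; first by rewrite ler_wpM2l ?subr_ge0.
  by rewrite ler_wpM2l//; move: d0; lra.
have Fw t : 0 <= t <= 1 -> t * nc (F (w t)) <= 4 * kappa / sd.
  move=> tt; have [t0 _] := andP tt; have W1 := w1 t tt.
  have hpF := holM (peak_hol z1 d0) hF.
  have P := hn_point hpF kappa0 small W1.
  set x := nc (peak zeta d (w t) * F (w t)) in P.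
  have x0 : 0 <= x := nc_ge0 _.
  have tx : t * x * sd <= kappa.
    rewrite -(@ler_pXn2r _ 2)// ?nnegrE ?(ltW kappa0)//; last first.
      by rewrite (mulr_ge0 _ (ltW sd0))// mulr_ge0.
    apply: le_trans P; rewrite (_ : (t * x * sd) ^+ 2 = x ^+ 2 * (t ^+ 2 * d)); last by rewrite -sdd; ring.
    by rewrite ler_wpM2l ?sqr_ge0// w_far.
  rewrite ler_pdivlMr//; have FL := F_le W1 (wz t tt); rewrite -/x in FL.
  have : t * nc (F (w t)) * sd <= t * (4 * x) * sd.
    by rewrite ler_wpM2r ?(ltW sd0)// ler_wpM2l.
  lra.
pose h' t := 2%:R * t%:C * (z0 - z) * (F (w t) * (cj zeta * sd^-1%:C)).
have dw t : cder w t (2%:R * t%:C * (z0 - z)).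
  apply: cder_eq (cderD (cder_cst z t) (cderM (cderM (cder_ofreal t) (cder_ofreal t)) (cder_cst (z0 - z) t))) _.
  by ring.
have cw : ccont 0 1 w by apply: cder_ccont => t _; exact: dw.
have ch : ccont 0 1 (fun t => h (w t)).
  by apply: cder_ccont => t tt; apply: cder_comp (dw t) (h_der (w1 t tt)).
have cFw : ccont 0 1 (fun t => F (w t)).
  by have := @ccont_comp _ 0 1 F w cw; apply => t tt; apply: (hol_dcont hF); exact: w1.
have ch' : ccont 0 1 h'.
  have := ccontM (ccontM (ccontZ 2%:R (@ccont_ofreal _ 0 1)) (ccont_cst (z0 - z)))
    (ccontM cFw (ccont_cst (cj zeta * sd^-1%:C))); exact.
have FTC : cint 0 1 h' = h (w 1) - h (w 0).
  apply: (@cint_FTC R 0 1 (fun t => h (w t)) h' ltr01 _ ch ch') => t /andP[t0 t1].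
  by apply: cder_comp (dw t) (h_der (w1 t _)); rewrite !ltW.
have w0E : w 0 = z by rewrite /w rmorph0 expr0n mul0r addr0.
have w1E : w 1 = z0 by rewrite /w rmorph1 expr1n mul1r; ring.
rewrite ncBC -w1E -w0E -FTC.
have := @cint_bound R 0 1 h' (32 * kappa) ler01 ch'; rewrite subr0 mulr1 => B.
rewrite (_ : 64 * kappa = 2 * (32 * kappa)); last by ring.
apply: B => t tt; have [t0 t1] := andP tt.
have zz0 : nc (z0 - z) <= 4 * d.
  by have := nc_triangle z0 z zeta; rewrite z0d (ncBC zeta z) => /le_trans; apply; lra.
have -> : nc (h' t) = 2 * nc (z0 - z) * (t * nc (F (w t))) / sd.
  rewrite /h' (ncM _ (F (w t) * _)) (ncM _ (z0 - z)) (ncM _ t%:C) nc_natr ncC_ge0// (ncM (F (w t))).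
  by rewrite (ncM (cj zeta)) nc_conj z1 mul1r ncC_ge0 ?invr_ge0 ?(ltW sd0)//; ring.
rewrite ler_pdivrMr//.
apply: (@le_trans _ _ (2 * (4 * d) * (4 * kappa / sd))).
  apply: ler_pM; rewrite ?mulr_ge0 ?nc_ge0//; last exact: Fw.
  by rewrite ler_pM2l.
rewrite le_eqVlt; apply/orP; left; apply/eqP; rewrite -sdd; field; by rewrite gt_eqF.
Qed.

(** The term [F * q] is linear in the small quantity x; 16 sqrt d x <= 8 kappa + 8 (d / kappa) x^2
    makes it quadratic, ready for the mean square bound over the arc. *)
Let pointwise z : nc z < 1 -> nc (z - zeta) <= 3 * d ->
  nc (g z - h z0) <= 72 * kappa + 8 * (d / kappa) * nc (peak zeta d z * F z) ^+ 2.
Proof.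
move=> zz zd; set x := nc (peak zeta d z * F z).
have x0 : 0 <= x := nc_ge0 _.
have -> : g z - h z0 = (h z - h z0) + F z * q z by rewrite /h; ring.
apply: (le_trans (ncD _ _)).
have A := h_dist zz zd.
have B : nc (F z * q z) <= 16 * sd * x.
  rewrite ncM; apply: (@le_trans _ _ (4 * x * (4 * sd))); last by rewrite le_eqVlt; apply/orP; left; apply/eqP; ring.
  apply: ler_pM; rewrite ?nc_ge0//; first exact: F_le.
  rewrite /q ncM ncC_ge0 ?invr_ge0 ?(ltW sd0)// ler_pdivrMl// (le_trans (near_zeta zz zd))//.
  by rewrite le_eqVlt -{1}sdd; apply/orP; left; apply/eqP; ring.
have C : 16 * sd * x <= 8 * kappa + 8 * (d / kappa) * x ^+ 2.
  rewrite -subr_ge0 (_ : _ - _ = 8 / kappa * (kappa - sd * x) ^+ 2).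
    by rewrite mulr_ge0 ?sqr_ge0// divr_ge0 ?(ltW kappa0).
  by rewrite -sdd; field; rewrite gt_eqF //.
lra.
Qed.

(** The angle contributes at most 2 d and the radius at most d. *)
Let arc_near (r t : R) : 1 - d <= r < 1 -> a <= t <= a + d -> nc (r%:C * expi t - zeta) <= 3 * d.
Proof.
move=> /andP[rd r1] /andP[ta td]; have r0 : 0 <= r by move: d1; lra.
have -> : r%:C * expi t - zeta = r%:C * (expi t - zeta) - (1 - r)%:C * zeta.
  by rewrite -[1 - r]/(1 + - r) ofrealD rmorphN rmorph1; ring.
rewrite (le_trans (ncB _ _))// !ncM z1 mulr1 !ncC_ge0 ?subr_ge0 ?(ltW r1)//.
have E := expi_lip t a; have : `|t - a| <= d by rewrite ger0_norm ?subr_ge0//; lra.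
have : r * nc (expi t - zeta) <= nc (expi t - zeta) by rewrite ler_piMl ?nc_ge0 ?(ltW r1).
rewrite -/zeta in E; lra.
Qed.

(** Integrating [pointwise] gives 72 kappa d + 8 (d / kappa) 2 pi kappa^2. The bound and the centre
    do not depend on the radius, which permits the limit r -> 1. *)
Lemma oscillation_radius (r : R) : d <= 2 * pi -> 1 - d <= r < 1 ->
  (\int[mu]_(t in `[a, (a + d)%R]) (nc (g (r%:C * expi t) - h z0))%:E <=
   (d * (72 + 16 * pi) * kappa)%:E)%E.
Proof.
move=> d2 rd; have /andP[rd1 r1] := rd; have r0 : 0 <= r by move: d1; lra.
have r01 : 0 <= r < 1 by rewrite r0.
pose G z := peak zeta d z * F z; have hG : hol G := holM (peak_hol z1 d0) hF.
have AM := @arc_mean_square G kappa r a d hG (ltW kappa0) small r01.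
have cc f : hol f -> ccont a (a + d) (fun t => f (r%:C * expi t)).
  move=> hf; have cE : ccont a (a + d) (fun t : R => r%:C * expi t) by apply: ccontZ; exact: ccont_expi.
  by apply: (ccont_comp cE) => t _; apply: (hol_dcont hf); rewrite ncM nc_expi mulr1 ncC_ge0.
have iG : mu.-integrable `[a, a + d] (EFin \o (fun t => nc (G (r%:C * expi t)) ^+ 2)).
  have := ccont_integrable_re (ccontM (cc G hG) (ccont_conj (cc G hG))).
  by rewrite (_ : (fun t => cre (_ * _)) = (fun t => nc (G (r%:C * expi t)) ^+ 2))//; apply/funext => t; rewrite mulr_cj.
pose B t := 72 * kappa + 8 * (d / kappa) * nc (G (r%:C * expi t)) ^+ 2.
have i1 : mu.-integrable `[a, a + d] (EFin \o (fun _ : R => 72 * kappa)).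
  by apply: (ccont_integrable_re (F := fun=> (72 * kappa)%:C)); exact: ccont_cst.
have i2 : mu.-integrable `[a, a + d] (EFin \o (fun t => 8 * (d / kappa) * nc (G (r%:C * expi t)) ^+ 2)).
  by apply: eq_integrable (integrableZl _ (8 * (d / kappa)) iG).
have iB : mu.-integrable `[a, a + d] (EFin \o B) by apply: eq_integrable (integrableD _ i1 i2).
have hgc : hol (fun z => g z - h z0) by apply: holB => //; exact: hol_cst.
apply: (@le_trans _ _ (\int[mu]_(t in `[a, (a + d)%R]) (B t)%:E)%E).
  apply: ge0_le_integral => //.
  - by move=> t _; rewrite lee_fin nc_ge0.
  - have c := ccont_integrable_re (ccontM (cc _ hgc) (ccont_conj (cc _ hgc))).
    have /integrableP[mc _] := c.
    apply/measurable_EFinP.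
    rewrite (_ : (fun t => nc _) = Num.sqrt \o (fun t => cre ((g (r%:C * expi t) - h z0) * cj (g (r%:C * expi t) - h z0)))).
      apply: measurableT_comp; last exact/measurable_EFinP.
      by apply: continuous_measurable_fun; exact: sqrt_continuous.
    by apply/funext => t /=; rewrite mulr_cj /= sqrtr_sqr ger0_norm ?nc_ge0.
  - by case/integrableP: iB.
  - move=> t; rewrite /= in_itv /= => tt; rewrite lee_fin; apply: pointwise.
      by rewrite ncM nc_expi mulr1 ncC_ge0.
    exact: arc_near.
have -> : (\int[mu]_(t in `[a, (a + d)%R]) (B t)%:E)%E = (\int[mu]_(t in `[a, a + d]) B t)%R%:E.
  by rewrite /Rintegral fineK//; exact: integrable_fin_num.
rewrite lee_fin RintegralD// Rintegral_cst//= lebesgue_measure_itv /= lte_fin ltrDl d0 -EFinB /=.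
rewrite RintegralZl//; have d02 : 0 <= d <= 2 * pi by rewrite ltW.
have := ler_wpM2l (_ : 0 <= 8 * (d / kappa)) (AM d02) => /(_ _)/wrap[|H].
  by rewrite mulr_ge0// divr_ge0 ?(ltW d0) ?(ltW kappa0).
apply: le_trans (lerD (lexx _) H) _.
rewrite le_eqVlt; apply/orP; left; apply/eqP.
by move: (pi) => p; field; rewrite gt_eqF //.
Qed.

Lemma oscillation_center : d <= 2 * pi -> exists c, forall r : R, 1 - d <= r < 1 ->
  (\int[mu]_(t in `[a, (a + d)%R]) (nc (g (r%:C * expi t) - c))%:E <=
   (d * (72 + 16 * pi) * kappa)%:E)%E.
Proof. by move=> d2; exists (h z0) => r; exact: oscillation_radius. Qed.

End oscillation.

(** * Passage to the boundary values and to the mean over the arc *)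

Section boundary.
Context {R : realType}.
Implicit Types (f g u : R[i] -> R[i]) (z w c : R[i]).
Local Notation mu := (@lebesgue_measure R).

Lemma cvg_clim (T : Type) (G : set_system T) {FG : Filter G} (F : T -> R[i]) (l : R[i]) :
  ((F x : R[i]^o) @[x --> G] --> (l : R[i]^o)) <-> clim G F l.
Proof.
split=> [/cvgrPdist_le H e e0|H].
  have := H e%:C; rewrite -[0]/((0 : R)%:C) ltcR => /(_ e0); apply: filterS => x /=.
  by rewrite norm_nc lecR ncBC.
apply/cvgrPdist_le => -[e e']; rewrite ltcE /= => /andP[/eqP -> e0].
by apply: filterS (H e e0) => x /=; rewrite norm_nc lecR ncBC.
Qed.

Lemma measurable_nc (T : Type) (d : measure_display) (X : measurableType d) (D : set X) (F : X -> R[i]) :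
  measurable_fun D (fun t => cre (F t)) -> measurable_fun D (fun t => cim (F t)) ->
  measurable_fun D (fun t => nc (F t)).
Proof.
move=> mr mi; rewrite (_ : (fun t => nc _) = Num.sqrt \o (fun t => cre (F t) ^+ 2 + cim (F t) ^+ 2)).
  apply: measurableT_comp; first by apply: continuous_measurable_fun; exact: sqrt_continuous.
  by apply: measurable_funD; exact: measurable_funX.
by apply/funext => t; rewrite ncE.
Qed.

Lemma boundary_sequence f u t : clim (1 : R)^'- (fun r => f (r%:C * expi t)) (u (expi t)) ->
  forall r_ : nat -> R, (forall n, r_ n < 1) -> r_ n @[n --> \oo] --> (1 : R) ->
  clim \oo (fun n => f ((r_ n)%:C * expi t)) (u (expi t)).
Proof.
move=> H r_ r1 rl e /H; rewrite /at_left /within /= => /nbhs_ballP[d /= d0 K].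
move/cvgrPdist_lt : rl => /(_ d d0); apply: filterS => n rd; apply: K => //=.
Qed.

Lemma nc_cvg (F : nat -> R[i]) l : clim \oo F l -> (nc (F n))%:E @[n --> \oo] --> (nc l)%:E.
Proof.
move=> H; apply: cvg_EFin; first by apply: nearW.
apply/cvgrPdist_le => e /H; apply: filterS => n /= h.
have h1 := le_trans (nc_subl (F n) l) h.
have h2 : nc l - nc (F n) <= e by rewrite (le_trans (nc_subl _ _))// ncBC.
by rewrite ler_norml h2 andbT lerNl opprB.
Qed.

Lemma limn_einf_le (v : nat -> \bar R) (B : \bar R) : (forall n, (v n <= B)%E) -> (limn_einf v <= B)%E.
Proof.
move=> vB; rewrite limn_einf_lim; apply: lime_le; first exact: is_cvg_einfs.
apply: nearW => n; apply: le_trans (vB n); apply: ereal_inf_lbound.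
by exists n => //=.
Qed.

Lemma circle_measurable_nc u c : circle_measurable u ->
  measurable_fun setT (fun t => nc (u (expi t) - c)).
Proof.
move=> [mr mi]; apply: (@measurable_nc unit).
  by under eq_fun do rewrite creB; apply: measurable_funB => //; exact: measurable_cst.
by under eq_fun do rewrite cimB; apply: measurable_funB => //; exact: measurable_cst.
Qed.

(** Fatou's lemma along radii increasing to 1, off the null set where the radial limit fails. *)
Lemma boundary_fatou g u c (a d B : R) : hol g -> boundary_values g u -> 0 < d <= 1 ->
  (forall r : R, 1 - d <= r < 1 ->
    (\int[mu]_(t in `[a, (a + d)%R]) (nc (g (r%:C * expi t) - c))%:E <= B%:E)%E) ->
  (\int[mu]_(t in `[a, (a + d)%R]) (nc (u (expi t) - c))%:E <= B%:E)%E.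
Proof.
move=> hg [[mr mi] [A [mA A0 AH]]] /andP[d0 d1] H.
have mu_c := circle_measurable_nc c (conj mr mi).
pose D := `[a, a + d]%classic `\` A.
have mI : measurable (`[a, a + d]%classic : set R) by exact: measurable_itv.
have mD : measurable D by exact: measurableD.
pose r_ n : R := 1 - d / n.+2%:R.
have n0 n : 0 < d / n.+2%:R by rewrite divr_gt0.
have r1 n : r_ n < 1 by rewrite /r_ ltrBlDr ltrDl.
have rd n : 1 - d <= r_ n by rewrite lerD2l lerN2 ler_pdivrMr// ler_peMr ?(ltW d0)// ler1n.
have rl : r_ n @[n --> \oo] --> (1 : R).
  apply/cvgrPdist_lt => e e0; near=> n.
  rewrite /r_ opprB addrC subrK ger0_norm ?(ltW (n0 n))// ltr_pdivrMr// mulrC -ltr_pdivrMr//.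
  apply: (@lt_trans _ _ n%:R); last by rewrite ltr_nat.
  by near: n; exact: nbhs_infty_gtr.
have me : measurable_fun `[a, a + d]%classic (fun t => (nc (u (expi t) - c))%:E).
  by apply/measurable_EFinP; exact: measurable_funTS mu_c.
rewrite (ge0_negligible_integral mA mI me) //; last first.
  by move=> t _; rewrite lee_fin nc_ge0.
rewrite -/D.
pose f_ n t := (nc (g ((r_ n)%:C * expi t) - c))%:E.
have r01 n : 0 <= r_ n < 1 by rewrite r1 andbT (le_trans _ (rd n))// subr_ge0.
have cc n : ccont a (a + d) (fun t => g ((r_ n)%:C * expi t) - c).
  apply: ccontB; last exact: ccont_cst.
  have cE : ccont a (a + d) (fun t : R => (r_ n)%:C * expi t) by apply: ccontZ; exact: ccont_expi.
  apply: (ccont_comp cE) => t _; apply: (hol_dcont hg).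
  by have /andP[p0 p1] := r01 n; rewrite ncM nc_expi mulr1 ncC_ge0.
have mf n : measurable_fun `[a, a + d]%classic (f_ n).
  apply/measurable_EFinP; apply: (@measurable_nc unit).
    by have /integrableP[/measurable_EFinP] := ccont_integrable_re (cc n).
  by have /integrableP[/measurable_EFinP] := ccont_integrable_im (cc n).
have fE t : D t -> (nc (u (expi t) - c))%:E = limn_einf (f_ ^~ t).
  move=> [_ At].
  have bv : clim (1 : R)^'- (fun r => g (r%:C * expi t)) (u (expi t)).
    apply/cvg_clim; apply: contrapT => nb; apply: At; exact: AH.
  suff /cvg_limn_einf_sup[->] : f_ ^~ t @ \oo --> (nc (u (expi t) - c))%:E by [].
  apply: nc_cvg; apply: climB; last exact: clim_cst.
  exact: boundary_sequence bv _ r1 rl.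
apply: (@le_trans _ _ (\int[mu]_(t in D) limn_einf (f_ ^~ t))%E).
  by rewrite le_eqVlt; apply/orP; left; apply/eqP; apply: eq_integral => t; rewrite inE => /fE.
have mfD n : measurable_fun D (f_ n) by apply: measurable_funS (mf n) => // t [].
have f_ge0 n t : D t -> (0 <= f_ n t)%E by rewrite lee_fin nc_ge0.
apply: le_trans (fatou mu mD mfD f_ge0) _.
apply: limn_einf_le => n; apply: le_trans (H (r_ n) _); last by rewrite rd r1.
apply: ge0_subset_integral => //; first exact: mf.
  by move=> t _; rewrite lee_fin nc_ge0.
by move=> t [].
Unshelve. all: end_near. Qed.

(** Replacing an arbitrary centre by the mean costs at most the distance between them: L for the
    real part and L for the imaginary part, hence 3 L in all. *)
Lemma mean_oscillation_center u c (a d L : R) : circle_measurable u -> 0 < d -> 0 <= L ->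
  (\int[mu]_(t in `[a, (a + d)%R]) (nc (u (expi t) - c))%:E <= (d * L)%:E)%E ->
  (mean_oscillation u a d <= (3 * L)%:E)%E.
Proof.
move=> [mr mi] d0 L0 H.
have mI : measurable (`[a, a + d]%classic : set R) by exact: measurable_itv.
have mrI := measurable_funTS mr; have miI := measurable_funTS mi.
have muc c' : measurable_fun `[a, a + d]%classic (fun t => nc (u (expi t) - c')).
  by apply: measurable_funTS; exact: circle_measurable_nc (conj mr mi).
have inc : mu.-integrable `[a, a + d] (EFin \o (fun t => nc (u (expi t) - c))).
  apply/integrableP; split; first by apply/measurable_EFinP; exact: muc.
  under eq_integral do rewrite /= ger0_norm ?nc_ge0//.
  by rewrite (le_lt_trans H)// ltry.
have lenI : fine (mu `[a, (a + d)%R]) = d.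
  by rewrite lebesgue_measure_itv /= lte_fin ltrDl d0 -EFinB /= addrAC subrr add0r.
have HR : (\int[mu]_(t in `[a, a + d]) nc (u (expi t) - c))%R <= d * L.
  rewrite -lee_fin; apply: le_trans H; rewrite /Rintegral fineK//.
  exact: integrable_fin_num.
(* Used with [p] the real part and the imaginary part. *)
have comp (p : R[i] -> R) : (forall z w, p (z - w) = p z - p w) -> (forall z, `|p z| <= nc z) ->
    measurable_fun `[a, a + d]%classic (fun t => p (u (expi t))) ->
    `|d^-1 * (\int[mu]_(t in `[a, a + d]) p (u (expi t)))%R - p c| <= L.
  move=> pB pn mp.
  have iB : mu.-integrable `[a, a + d] (EFin \o (fun t => p (u (expi t)) - p c)).
    have mpB : measurable_fun `[a, a + d]%classic (EFin \o (fun t => p (u (expi t)) - p c)).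
      by apply/measurable_EFinP; apply: measurable_funB => //; exact: measurable_cst.
    apply: (@le_integrable _ _ R mu _ mI _ (EFin \o (fun t => nc (u (expi t) - c))) mpB) => //.
    by move=> t _; rewrite /= lee_fin -pB (le_trans (pn _))// ler_norm.
  have ic : mu.-integrable `[a, a + d] (EFin \o (fun _ : R => p c)).
    by apply: (ccont_integrable_re (F := fun=> (p c)%:C)); exact: ccont_cst.
  have E : (\int[mu]_(t in `[a, a + d]) p (u (expi t)) =
      \int[mu]_(t in `[a, a + d]) (p (u (expi t)) - p c) + p c * d)%R.
    rewrite -[in X in _ = _ + _ * X]lenI -Rintegral_cst// -RintegralD//.
    by apply: eq_Rintegral => t _; rewrite subrK.
  rewrite E mulrDr [p c * d]mulrC mulrA mulVf ?gt_eqF// mul1r addrK normrM normfV (gtr0_norm d0).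
  rewrite ler_pdivrMl//; apply: le_trans HR.
  rewrite (le_trans (le_normr_Rintegral _ _))//.
  apply: le_Rintegral => //; first exact: (integrable_abse iB).
  by move=> t _; rewrite -pB.
have mc : nc (c - arc_mean u a d) <= 2 * L.
  have [X [Y [AE [XE YE]]]] : exists X Y, arc_mean u a d = X +i* Y /\
     X = d^-1 * (\int[mu]_(t in `[a, a + d]) cre (u (expi t)))%R /\
     Y = d^-1 * (\int[mu]_(t in `[a, a + d]) cim (u (expi t)))%R.
    exists (d^-1 * (\int[mu]_(t in `[a, a + d]) cre (u (expi t)))%R).
    exists (d^-1 * (\int[mu]_(t in `[a, a + d]) cim (u (expi t)))%R); split => //.
    by rewrite /arc_mean /complex_integral; apply: complex_ext; rewrite ?creM ?cimM /= mul0r ?subr0 ?addr0.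
  rewrite ncBC AE mulr_natl mulr2n; apply: le_trans (nc_le_re_im _) _.
  rewrite creB cimB /= XE YE; apply: lerD; apply: comp => //.
  - exact: creB.
  - exact: nc_re.
  - exact: cimB.
  - exact: nc_im.
rewrite /mean_oscillation.
apply: (@le_trans _ _ ((d^-1)%:E * (d * (3 * L))%:E)%E); last first.
  by rewrite -EFinM lee_fin mulKf ?gt_eqF.
rewrite lee_pmul2l ?lte_fin ?invr_gt0//.
apply: (@le_trans _ _ (\int[mu]_(t in `[a, (a + d)%R]) ((nc (u (expi t) - c))%:E + (2 * L)%:E))%E).
  apply: ge0_le_integral => //.
  - by move=> t _; rewrite lee_fin nc_ge0.
  - by apply/measurable_EFinP; exact: muc.
  - by apply: emeasurable_funD; [by apply/measurable_EFinP; exact: muc|exact: measurable_cst].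
  - move=> t _; rewrite -EFinD lee_fin.
    by rewrite (le_trans (nc_triangle _ _ c))// lerD2l.
rewrite ge0_integralD//; last 3 first.
- by move=> t _; rewrite lee_fin nc_ge0.
- by apply/measurable_EFinP; exact: muc.
- by move=> t _; rewrite lee_fin mulr_ge0.
rewrite integral_cst//= lebesgue_measure_itv /= lte_fin ltrDl d0 -EFinB.
rewrite (_ : a + d - a = d) -?EFinM; last by rewrite addrAC subrr add0r.
apply: le_trans (leeD H (lexx _)) _.
by rewrite -EFinD lee_fin le_eqVlt; apply/orP; left; apply/eqP; ring.
Qed.

Lemma mean_oscillation_le g u (a d kappa : R) : hol g -> boundary_values g u ->
  0 < d -> d <= 1 -> d <= 2 * pi -> 0 < kappa ->
  hn (fun z => peak (expi a) d z * volterra g (test_fun a d) z) kappa ->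
  (mean_oscillation u a d <= (3 * ((72 + 16 * pi) * kappa))%:E)%E.
Proof.
move=> hg gu d0 d1 d2 k0 small.
have [c Hc] := oscillation_center hg d0 d1 k0 small d2.
apply: (@mean_oscillation_center u c) => //; first by case: gu.
  by rewrite mulr_ge0 ?(ltW k0)// addr_ge0// mulr_ge0// pi_ge0.
apply: (boundary_fatou hg gu) => [|r rd]; first by rewrite d0.
by rewrite mulrA; exact: Hc.
Qed.

End boundary.

(** * Commutators with multiplications *)

Section commutator.
Context {R : realType}.
Implicit Types (b f h : R[i] -> R[i]) (z w : R[i]).

Lemma hn_scale c f A : hol f -> 0 <= A -> hn f A -> hn (fun z => c * f z) (nc c * A).
Proof.
move=> hf A0 fA; apply: hn_le fA => //.
- by apply: hol_dcont; exact: holZ.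
- exact: hol_dcont.
- exact: nc_ge0.
- by move=> z _; rewrite ncM.
Qed.

Lemma hn_ext f h A : (forall z, nc z < 1 -> f z = h z) -> hn f A -> hn h A.
Proof. by move=> fh; rewrite /hn (h2norm_ext fh). Qed.

Lemma hn_unshift N f A : hol f -> 0 <= A -> hn (fun z => z ^+ N * f z) A -> hn f A.
Proof.
move=> hf A0; have [c cf] := hol_pser hf; have sf := pser_shift N cf.
rewrite /hn (h2norm_series cf A0) (h2norm_series sf A0) => H n.
apply: le_trans (H (N + n)%N).
rewrite big_split_ord /= [leRHS]addrC ler_wpDr//.
  by apply: sumr_ge0 => i _; exact: sqr_ge0.
by apply: ler_sum => i _; rewrite ltnNge leq_addr /= addKn.
Qed.

Variable g : R[i] -> R[i].
Hypothesis hg : hol g.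
Local Notation V := (volterra g).

Lemma volterraD f h z : hol f -> hol h -> nc z < 1 ->
  V (fun w => f w + h w) z = V f z + V h z.
Proof.
move=> hf hh z1; rewrite -[RHS](cintD (volterra_ccont hg hf z1) (volterra_ccont hg hh z1)).
by apply: eq_cint => t _; cbv beta; rewrite !mulrDl.
Qed.

Lemma volterraZ c f z : hol f -> nc z < 1 -> V (fun w => c * f w) z = c * V f z.
Proof.
move=> hf z1; rewrite -[RHS](cintZ c (volterra_ccont hg hf z1)).
by apply: eq_cint => t _; cbv beta; rewrite !mulrA.
Qed.

Lemma volterra_ext f h z : (forall w, nc w < 1 -> f w = h w) -> nc z < 1 -> V f z = V h z.
Proof.
move=> fh z1; apply: eq_cint => t t01; rewrite fh//.
exact: le_lt_trans (nc_scale _ t01) z1.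
Qed.

Lemma commD b1 b2 f z : hol b1 -> hol b2 -> hol f -> nc z < 1 ->
  comm g (fun w => b1 w + b2 w) f z = comm g b1 f z + comm g b2 f z.
Proof.
move=> h1 h2 hf z1; rewrite /comm.
have -> : V (fun w => (b1 w + b2 w) * f w) z = V (fun w => b1 w * f w + b2 w * f w) z.
  by apply: volterra_ext => // w _; rewrite mulrDl.
rewrite volterraD//; [|exact: holM..].
ring.
Qed.

Lemma commZ c b f z : hol b -> hol f -> nc z < 1 ->
  comm g (fun w => c * b w) f z = c * comm g b f z.
Proof.
move=> hb hf z1; rewrite /comm.
have -> : V (fun w => (c * b w) * f w) z = V (fun w => c * (b w * f w)) z.
  by apply: volterra_ext => // w _; rewrite mulrA.
rewrite volterraZ//; last exact: holM.
ring.
Qed.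

Lemma comm_ext b1 b2 f z : (forall w, nc w < 1 -> b1 w = b2 w) -> nc z < 1 ->
  comm g b1 f z = comm g b2 f z.
Proof.
move=> b12 z1; rewrite /comm b12// (@volterra_ext (fun w => b1 w * f w) (fun w => b2 w * f w))//.
by move=> w w1; rewrite b12.
Qed.

Variable M : R.
Hypothesis M0 : 0 < M.
Hypothesis HV : forall f A, hol f -> 0 < A -> hn f A -> hn (V f) (M * A).

Lemma hn_comm_le b f x y : hol b -> hol f -> 0 < x -> 0 < y ->
  hn (fun z => b z * f z) x -> hn (fun z => b z * V f z) y -> hn (comm g b f) (2 * (M * x + y)).
Proof.
move=> hb hf x0 y0 Hx Hy; apply: hnB.
- by apply: volterra_hol => //; exact: holM.
- by apply: holM => //; exact: volterra_hol.
- by rewrite mulr_ge0// ltW.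
- exact: ltW.
- by apply: HV => //; exact: holM.
- exact: Hy.
Qed.

Lemma hn_comm_psum c n e : 0 < e -> exists2 kappa, 0 < kappa & forall f, hol f -> hn f 1 ->
  (forall z, nc z < 1 -> nc (f z) * (1 - nc z) <= kappa) -> hn (comm g (psum c n) f) e.
Proof.
elim: n e => [|n IH] e e0.
  exists 1 => // f hf f1 _; apply: (@hn_ext (fun=> 0)) => [z z1|].
    have -> : psum c 0 = fun w : R[i] => 0 * 0 by apply/funext => w; rewrite /psum big_ord0 mul0r.
    by rewrite (commZ 0 (hol_cst 0))// mul0r.
  apply: hn_sup => [||z _]; [|exact: ltW|by rewrite nc0 ltW].
  by apply: hol_dcont; exact: hol_cst.
have e4 : 0 < e / 4 by rewrite divr_gt0.
have [k1 k10 H1] := IH _ e4.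
pose C := nc (c n) + 1; have C0 : 0 < C by rewrite /C ltr_wpDl// nc_ge0.
have e5 : 0 < e / 4 / C by rewrite divr_gt0.
have [k2 k20 H2] := hn_comm_monomial hg n M0 e5.
exists (Num.min k1 k2) => [|f hf f1 ff]; first by rewrite lt_min k10.
have ff1 z : nc z < 1 -> nc (f z) * (1 - nc z) <= k1.
  by move=> /ff h; apply: le_trans h _; rewrite ge_min lexx.
have ff2 z : nc z < 1 -> nc (f z) * (1 - nc z) <= k2.
  by move=> /ff h; apply: le_trans h _; rewrite ge_min lexx orbT.
have fM : hn (V f) M by rewrite -[M]mulr1; exact: HV.
have hX := @comm_hol _ _ hg _ _ (holX n) hf.
have hp := @comm_hol _ _ hg _ _ (psum_hol c n) hf.
have B2 : hn (fun z => c n * comm g (fun w => w ^+ n) f z) (e / 4).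
  apply: hn_weak (hn_scale (c n) hX (ltW e5) (H2 _ hf fM ff2)).
  by rewrite mulrC mulrAC ler_pdivrMr// ler_wpM2l ?(ltW e4)// /C lerDl.
have := hnD hp (holZ (c n) hX) (ltW e4) (ltW e4) (H1 _ hf f1 ff1) B2.
rewrite (_ : 2 * (e / 4 + e / 4) = e); last by field.
apply: hn_ext => z z1; rewrite -commZ//; last exact: holX.
rewrite -commD//; [|exact: psum_hol|by apply: holZ; exact: holX].
by apply: comm_ext => // w _; rewrite psumS.
Qed.

(** The remainder of a polynomial approximation contributes little because multiplication and [V]
    are bounded; the polynomial part is small on flat functions. *)
Lemma hn_comm_disk_algebra b e : disk_algebra b -> 0 < e -> exists2 kappa, 0 < kappa &
  forall f, hol f -> hn f 1 ->
  (forall z, nc z < 1 -> nc (f z) * (1 - nc z) <= kappa) -> hn (comm g b f) e.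
Proof.
(* The remainder contributes 2 (M e' + e' M) = e / 4, and adding the polynomial part gives 2 (e / 4
   + e / 4) = e. *)
move=> db e0; pose e' := e / (16 * M).
have e'0 : 0 < e' by rewrite divr_gt0// mulr_gt0.
have e4 : 0 < e / 4 by rewrite divr_gt0.
have [c [n Hc]] := db _ e'0; have [kappa k0 Hk] := hn_comm_psum c n e4.
exists kappa => // f hf f1 ff.
have hb := disk_algebra_hol db.
pose q z := b z - psum c n z; have hq : hol q by apply: holB => //; exact: psum_hol.
have fM : hn (V f) M by rewrite -[M]mulr1; exact: HV.
have hVf := volterra_hol hg hf.
have q1 h A : hol h -> 0 <= A -> hn h A -> hn (fun z => q z * h z) (e' * A).
  move=> hh A0 hA; apply: hn_le (ltW e'0) A0 _ hA.
  - by apply: hol_dcont; exact: holM.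
  - exact: hol_dcont.
  - by move=> z z1; rewrite ncM ler_wpM2r ?nc_ge0// Hc// ltW.
have B1 : hn (fun z => q z * f z) e' by rewrite -[e']mulr1; exact: q1.
have B2 : hn (fun z => q z * V f z) (e' * M) by apply: q1 => //; exact: ltW.
have := hn_comm_le hq hf e'0 (mulr_gt0 e'0 M0) B1 B2.
rewrite (_ : 2 * (M * e' + e' * M) = e / 4); last by rewrite /e'; field; rewrite gt_eqF.
move=> Bq; have := hnD (comm_hol hg (psum_hol c n) hf) (comm_hol hg hq hf)
   (ltW e4) (ltW e4) (Hk _ hf f1 ff) Bq.
rewrite (_ : 2 * (e / 4 + e / 4) = e); last by field.
apply: hn_ext => z z1; rewrite -commD//; last exact: psum_hol.
by apply: comm_ext => // w _; rewrite addrC subrK.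
Qed.

End commutator.

(** * Norm and flatness of the test functions *)

Section test_function.
Context {R : realType}.
Variables (a d : R).
Hypothesis d0 : 0 < d.

Lemma test_fun_hn : hn (test_fun a d) 1.
Proof.
have s0 : 0 < Num.sqrt d by rewrite sqrtr_gt0.
have := hn_scale ((Num.sqrt d)^-1)%:C (peak_hol (nc_expi a) d0) (ltW s0) (peak_hn (nc_expi a) d0).
by rewrite ncC ger0_norm ?invr_ge0 ?(ltW s0)// mulVf// gt_eqF.
Qed.

(** The denominator of the peak is at least 1 - |z|. As d tends to 0 the test functions thus become
    arbitrarily flat at bounded norm. *)
Lemma test_fun_flat z : nc z < 1 -> nc (test_fun a d z) * (1 - nc z) <= Num.sqrt d.
Proof.
move=> z1; have s0 : 0 < Num.sqrt d by rewrite sqrtr_gt0.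
have den : 1 - nc z <= nc (1 + d%:C - cj (expi a) * z).
  apply: le_trans (nc_subl _ _); rewrite ncM nc_conj nc_expi mul1r lerB//.
  rewrite (_ : 1 + d%:C = (1 + d)%:C); last by rewrite ofrealD.
  rewrite ncC ger0_norm; last by rewrite addr_ge0// ltW.
  by rewrite lerDl ltW.
have den0 : 0 < nc (1 + d%:C - cj (expi a) * z) by apply: lt_le_trans den; rewrite subr_gt0.
rewrite /test_fun /peak ncM ncM ncV !ncC !gtr0_norm ?invr_gt0//.
rewrite -[d in _ * (d / _)](@sqr_sqrtr _ d) ?(ltW d0)// expr2 -!mulrA mulKf ?gt_eqF//.
by rewrite ger_pMr// ler_pdivrMl// mulr1.
Qed.

End test_function.

(** * The sliding hump *)

Section cluster.
Context {R : realType}.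

Lemma circle_cluster (P : R -> R -> Prop) :
  (forall e, 0 < e -> exists a d, [/\ 0 < d, d < e & P a d]) ->
  exists2 xi : R[i], nc xi = 1 & forall e, 0 < e ->
    exists a d, [/\ 0 < d, d < e, nc (expi a - xi) <= e & P a d].
Proof.
move=> H.
have /choice[F HF] : forall n : nat, exists p : R * R, [/\ 0 < p.2, p.2 < n.+1%:R^-1 & P p.1 p.2].
  move=> n.
  have n0 : 0 < n.+1%:R^-1 :> R by rewrite invr_gt0.
  by have [a [d Hd]] := H _ n0; exists (a, d).
(* The points are placed in the compact square [-1, 1]^2 by their coordinates; a cluster point there
   is automatically on the circle. *)
pose X n : R * R := (cos (F n).1, sin (F n).1).
have cK := compact_setX (@segment_compact R (-1) 1) (@segment_compact R (-1) 1).
have XK : (X @ \oo) (`[-1, 1]%classic `*` `[-1, 1]%classic : set (R * R)).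
  exists 0%N => // n _; split; rewrite /= in_itv /=.
  - by rewrite cos_geN1 cos_le1.
  - by rewrite sin_geN1 sin_le1.
have [p [_ clp]] := cK (X @ \oo) _ XK.
pose xi := p.1 +i* p.2.
have near_xi e : 0 < e -> exists n, (F n).2 < e /\ nc (expi (F n).1 - xi) <= e.
  move=> e0; have e2 : 0 < e / 2 by rewrite divr_gt0.
  (* Restricting to indices beyond 1 / e forces the length below e together with closeness to
     [xi]. *)
  have XA : (X @ \oo) [set X n | n in [set n | e^-1 < n%:R]].
    have [N _ HN] := nbhs_infty_gtr e^-1.
    by exists N => // n Nn; exists n => //; exact: HN.
  have [q [[n /= ne <-] [/= b1 b2]]] := clp _ _ XA (nbhsx_ballx p _ e2).
  exists n; split.
    have [_ h _] := HF n; apply: (lt_trans h).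
    rewrite -[e]invrK ltf_pV2 ?posrE ?invr_gt0//; apply: (lt_trans ne); rewrite ltr_nat//.
  apply: (le_trans (nc_le_re_im _)); rewrite creB cimB /= (splitr e).
  by apply: lerD; apply: ltW; rewrite distrC.
have nxi : nc xi = 1.
  apply/le_anti/andP; split; apply/ler_addgt0Pr => e e0; have [n [_ h]] := near_xi e e0.
    by have := nc_subl xi (expi (F n).1); rewrite ncBC nc_expi; move: h; lra.
  by have := nc_subl (expi (F n).1) xi; rewrite nc_expi; move: h; lra.
exists xi => // e e0; have [n [h1 h2]] := near_xi e e0; have [k1 _ k2] := HF n.
by exists (F n).1, (F n).2.
Qed.

End cluster.

(** * Construction of one hump *)

Section hump.
Context {R : realType}.
Variables (g : R[i] -> R[i]) (M c0 : R) (xi : R[i]).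
Hypothesis hg : hol g.
Local Notation V := (volterra g).
Hypothesis M0 : 0 < M.
Hypothesis HV : forall f A, hol f -> 0 < A -> hn f A -> hn (V f) (M * A).
Hypothesis c00 : 0 < c0.
Hypothesis nxi : nc xi = 1.
Hypothesis bad : forall e, 0 < e -> exists a d, [/\ 0 < d, d < e, nc (expi a - xi) <= e &
  ~ hn (fun z => peak (expi a) d z * V (test_fun a d) z) c0].

(* One step of the sliding hump, [B] being the sum of the previous humps.  The
   symbol [beta] is seen only by the test function [f]: the commutator with [B]
   and with every later symbol concentrated near [xi] is small on [f]. *)
Record hump (kappa : R) (B : R[i] -> R[i]) (f beta : R[i] -> R[i]) (kappa' : R) : Prop := Hump {
  hump_gt0 : 0 < kappa';
  hump_half : kappa' <= kappa / 2;
  hump_disk_algebra : disk_algebra beta;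
  hump_xi : beta xi = 0;
  hump_hol : hol f;
  hump_hn : hn f 1;
  hump_flat : forall z, nc z < 1 -> nc (f z) * (1 - nc z) <= kappa;
  hump_le2 : forall z, nc z <= 1 -> nc (beta z) <= 2;
  hump_far : forall z, nc z <= 1 -> kappa <= nc (z - xi) -> nc (beta z) <= kappa / 2;
  hump_near : forall z, nc z <= 1 -> nc (z - xi) < kappa' -> nc (beta z) <= kappa / 2;
  hump_before : hn (comm g B f) (c0 / 100);
  hump_now : ~ hn (comm g beta f) (c0 / 10);
  hump_after : forall b, hol b -> (forall z, nc z < 1 -> nc (b z) <= 3) ->
    (forall z, nc z < 1 -> kappa' <= nc (z - xi) -> nc (b z) <= kappa') ->
    hn (comm g b f) (c0 / 100) }.

Lemma hump_exists kappa B : 0 < kappa -> disk_algebra B -> exists f beta kappa', hump kappa B f beta kappa'.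
Proof.
move=> k0 dB; have c100 : 0 < c0 / 100 by rewrite divr_gt0.
have [kB kB0 HB] := hn_comm_disk_algebra hg M0 HV dB c100.
pose k1 := Num.min kappa kB; have k10 : 0 < k1 by rewrite lt_min k0.
(* Three demands: the arc starts within kappa / 2 of [xi]; d <= kappa^2 / 8 makes the peak at most
   kappa / 4 at distance kappa / 2; and d <= k1^2 gives flatness at most k1. *)
pose e := Num.min (kappa / 2) (Num.min (kappa ^+ 2 / 8) (k1 ^+ 2)).
have e0 : 0 < e by rewrite !lt_min !divr_gt0// ?exprn_gt0.
have [a [d [d0 de ae nbad]]] := bad e0.
have {}ae : nc (expi a - xi) <= kappa / 2 by apply: (le_trans ae); rewrite ge_min lexx.
have dk : d <= kappa ^+ 2 / 8 by apply: (le_trans (ltW de)); rewrite !ge_min lexx orbT.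
have dk1 : d <= k1 ^+ 2 by apply: (le_trans (ltW de)); rewrite !ge_min lexx !orbT.
have sd1 : Num.sqrt d <= k1.
  by rewrite -[k1]ger0_norm ?(ltW k10)// -sqrtr_sqr ler_sqrt ?sqr_ge0.
pose f := test_fun a d; have hf : hol f by exact: test_fun_hol.
have f1 : hn f 1 by exact: test_fun_hn.
have hVf := volterra_hol hg hf.
have VfM : hn (V f) M by rewrite -[M]mulr1; exact: HV.
pose pk := peak (expi a) d.
have hpk : hol pk by apply: peak_hol => //; exact: nc_expi.
have c10 : 0 < c0 / 10 by rewrite divr_gt0.
have hpV : hol (fun z => pk z * V f z) by exact: holM.
have pVM : hn (fun z => pk z * V f z) M.
  rewrite -[M]mul1r; apply: hn_le ler01 (ltW M0) _ VfM => [||z z1]; [exact: hol_dcont..|].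
  by rewrite ncM ler_wpM2r ?nc_ge0// peak_le1 ?nc_expi// ltW.
(* Cutting the peak off at [xi] must not destroy the lower bound: the part removed is concentrated
   near [xi], hence small in norm for eta small. *)
have [eta eta0 Heta] : exists2 eta, 0 < eta & hn (fun z => peak xi eta z * (pk z * V f z)) (c0 / 10).
  have [kc kc0 Hkc] := hn_concentrated hpV M0 pVM nxi c10.
  exists (kc ^+ 2) => [|]; first by rewrite exprn_gt0.
  apply: Hkc => [|z z1|z z1 zk]; first by apply: peak_hol; rewrite ?exprn_gt0.
    by apply: le_trans (peak_le1 _ _ (ltW z1)) _; rewrite ?exprn_gt0// ler1n.
  have := peak_far nxi (exprn_gt0 2 kc0) (ltW z1) => h.
  rewrite -(ler_pM2r kc0) -expr2; apply: le_trans h.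
  by rewrite ler_wpM2l ?nc_ge0.
pose psi z := 1 - peak xi eta z.
have hpe : hol (peak xi eta) by exact: peak_hol.
have hpsi : hol psi by apply: holB => //; exact: hol_cst.
have hq : hol (fun z => pk z * psi z) by exact: holM.
have hqf : hol (fun z => pk z * psi z * f z) by exact: holM.
have psi2 z : nc z <= 1 -> nc (psi z) <= 2.
  move=> z1; apply: (le_trans (ncB _ _)); rewrite nc1.
  by have := peak_le1 nxi eta0 z1; lra.
have pk1 z : nc z <= 1 -> nc (pk z) <= 1 by apply: peak_le1 => //; exact: nc_expi.
have q2 z : nc z <= 1 -> nc (pk z * psi z) <= 2.
  by move=> z1; rewrite ncM -[2]mul1r ler_pM ?nc_ge0 ?pk1 ?psi2.
have qfM : hn (V (fun z => pk z * psi z * f z)) (M * (2 * 1)).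
  apply: (HV hqf); first by rewrite mulr1.
  apply: hn_le f1 => //; [exact: hol_dcont..|move=> z z1].
  by rewrite ncM ler_wpM2r ?nc_ge0// q2// ltW.
have M2 : 0 < M * (2 * 1) by rewrite mulr1 mulr_gt0.
(* N is taken after eta and d, so that [V] of the full product with f is small. *)
have [N HN] := hn_volterra_shift hg hqf M2 qfM c10.
pose beta z := z ^+ N * (pk z * psi z).
have zN (z : R[i]) : nc z <= 1 -> nc (z ^+ N) <= 1 by move=> z1; rewrite ncX exprn_ile1 ?nc_ge0.
have betaq z : nc z <= 1 -> nc (beta z) <= nc (pk z * psi z).
  by move=> z1; rewrite /beta ncM ler_piMl ?nc_ge0 ?zN.
have hbeta : hol beta by apply: holM => //; exact: holX.
have dpsi : disk_algebra psi.
  have := disk_algebraD (disk_algebra_cst 1) (disk_algebraM (disk_algebra_cst (-1)) (disk_algebra_peak nxi eta0)).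
  by congr disk_algebra; apply/funext => z; rewrite mulN1r.
have xi1 : nc xi <= 1 by rewrite nxi.
have psi0 : psi xi = 0.
  have E : (1 : R)%:C = 1 :> R[i] by [].
  rewrite /psi /peak [cj xi * xi]mulrC mulr_cj nxi expr1n E addrAC subrr add0r divff ?subrr//.
  by apply/eqP => -[/eqP]; rewrite gt_eqF.
have [r r0 Hr] : exists2 r, 0 < r & forall z, nc z <= 1 -> nc (z - xi) < r -> nc (psi z) <= kappa / 2.
  have k2 : 0 < kappa / 2 by rewrite divr_gt0.
  have [r r0 Kr] := disk_algebra_clim dpsi xi1 k2; exists r => // z z1 zr.
  by have := Kr z zr z1; rewrite /= psi0 subr0.
(* Solves 2 (M e2 + e2) = c0 / 100, the bound of [hn_comm_le]. *)
pose e2 := c0 / 100 / (2 * (M + 1)).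
have e20 : 0 < e2 by rewrite divr_gt0// mulr_gt0// ltr_wpDl// ltW.
have [k2 k20 H2] := hn_concentrated hf ltr01 f1 nxi e20.
have [k3 k30 H3] := hn_concentrated hVf M0 VfM nxi e20.
pose k' := Num.min (Num.min (kappa / 2) r) (Num.min k2 k3).
have k'E : [/\ 0 < k', k' <= kappa / 2, k' <= r, k' <= k2 & k' <= k3].
  by rewrite !lt_min !ge_min !lexx !orbT r0 k20 k30 divr_gt0.
have [k'0 k'h k'r k'2 k'3] := k'E.
exists f, beta, k'; split=> //.
- exact: disk_algebraM (disk_algebraX _) (disk_algebraM (disk_algebra_peak (nc_expi a) d0) dpsi).
- by rewrite /beta psi0 !mulr0.
- move=> z z1; apply: (le_trans (test_fun_flat a d0 z1)); apply: (le_trans sd1).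
  by rewrite ge_min lexx.
- by move=> z z1; apply: (le_trans (betaq z z1)); exact: q2.
- move=> z z1 zk; apply: (le_trans (betaq z z1)).
  have zd : kappa / 2 <= nc (z - expi a).
    have := nc_triangle z xi (expi a).
    by move: zk ae; lra.
  have pf := peak_far (nc_expi a) d0 z1.
  have p4 : nc (pk z) <= kappa / 4.
    have kh : 0 < kappa / 2 by rewrite divr_gt0.
    rewrite -(ler_pM2r kh); apply: (@le_trans _ _ d).
      by apply: le_trans pf; rewrite ler_wpM2l ?nc_ge0.
    by apply: (le_trans dk); rewrite expr2; lra.
  rewrite ncM (_ : kappa / 2 = kappa / 4 * 2); last by field.
  by rewrite ler_pM ?nc_ge0 ?psi2.
- move=> z z1 zk; apply: (le_trans (betaq z z1)); rewrite ncM -[leRHS]mul1r.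
  by rewrite ler_pM ?nc_ge0 ?pk1// Hr// (lt_le_trans zk).
- apply: HB => // z z1; apply: (le_trans (test_fun_flat a d0 z1)); apply: (le_trans sd1).
  by rewrite ge_min lexx orbT.
(* A small commutator would make z^N pk psi V f small; removing the isometric shift and adding back
   the part cut off at [xi] gives 2 (2 (1/10 + 1/10) + 1/10) c0 = c0 for pk V f, against the choice
   of the arc. *)
- move=> Hn; apply: nbad.
  have hVb : hol (V (fun w => beta w * f w)) by apply: volterra_hol => //; exact: holM.
  have B1 : hn (V (fun w => beta w * f w)) (c0 / 10).
    by apply: hn_ext HN => z z1; apply: volterra_ext => // w _; rewrite /beta !mulrA.
  have B2 := hnB hVb (comm_hol hg hbeta hf) (ltW c10) (ltW c10) B1 Hn.
  have B3 : hn (fun z => z ^+ N * (pk z * psi z * V f z)) (2 * (c0 / 10 + c0 / 10)).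
    by apply: hn_ext B2 => z z1; rewrite /comm opprB addrC subrK /beta !mulrA.
  have C0 : 0 <= 2 * (c0 / 10 + c0 / 10) by rewrite mulr_ge0// addr_ge0// ltW.
  have B4 := hn_unshift (holM hq hVf) C0 B3.
  have := hnD (holM hq hVf) (holM hpe hpV) C0 (ltW c10) B4 Heta.
  rewrite (_ : 2 * (2 * (c0 / 10 + c0 / 10) + c0 / 10) = c0); last by field.
  apply: hn_ext => z z1; change (pk z * psi z * V f z + peak xi eta z * (pk z * V f z) = pk z * V f z).
  by rewrite /psi; move: (V f z) (peak xi eta z) (pk z) => x y w; ring.
- move=> b hb b3 bk.
  have B1 := H2 b hb b3 (fun z z1 zk => le_trans (bk z z1 (le_trans k'2 zk)) k'2).
  have B2 := H3 b hb b3 (fun z z1 zk => le_trans (bk z z1 (le_trans k'3 zk)) k'3).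
  have := hn_comm_le hg M0 HV hb hf e20 e20 B1 B2.
  rewrite (_ : 2 * (M * e2 + e2) = c0 / 100)//.
  rewrite /e2; field; by rewrite gt_eqF// addr_gt0.
Qed.

End hump.

(** * Convergence and regularity of the sum of the humps *)

Section hump_series.
Context {R : realType}.
Variables (xi : R[i]) (K : nat -> R) (beta : nat -> R[i] -> R[i]).
Implicit Types (z w : R[i]).
Hypothesis nxi : nc xi = 1.
Hypothesis K0 : K 0%N = 1.
Hypothesis Kgt0 : forall n, 0 < K n.
Hypothesis Khalf : forall n, K n.+1 <= K n / 2.
Hypothesis dbeta : forall n, disk_algebra (beta n).
Hypothesis beta_xi : forall n, beta n xi = 0.
Hypothesis beta_le2 : forall n z, nc z <= 1 -> nc (beta n z) <= 2.
Hypothesis beta_far : forall n z, nc z <= 1 -> K n <= nc (z - xi) -> nc (beta n z) <= K n / 2.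
Hypothesis beta_near : forall n z, nc z <= 1 -> nc (z - xi) < K n.+1 -> nc (beta n z) <= K n / 2.

Definition hump_sum n z := \sum_(i < n) beta i z.
Local Notation B := hump_sum.

Lemma hump_sumS n z : B n.+1 z = B n z + beta n z.
Proof. by rewrite /hump_sum big_ord_recr. Qed.

Lemma hump_sum_disk_algebra n : disk_algebra (B n).
Proof.
elim: n => [|n IH].
  by have := disk_algebra_cst (0 : R[i]); congr disk_algebra; apply/funext => z; rewrite /hump_sum big_ord0.
by have := disk_algebraD IH (dbeta n); congr disk_algebra; apply/funext => z; rewrite hump_sumS.
Qed.

Lemma hump_scale_decr n : K n.+1 <= K n.
Proof. by have := Khalf n; have := Kgt0 n; lra. Qed.

Lemma hump_scale_mono n m : K (n + m)%N <= K n.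
Proof. by elim: m => [|m IH]; rewrite ?addn0// addnS (le_trans (hump_scale_decr _)). Qed.

Lemma hump_scale_geom n : K n <= 2^-1 ^+ n.
Proof.
elim: n => [|n IH]; first by rewrite K0 expr0.
by rewrite (le_trans (Khalf n))// exprSr ler_wpM2r// invr_ge0.
Qed.

Lemma hump_scale_small e : 0 < e -> exists n, K n <= e.
Proof.
move=> e0; have : (fun n => (2^-1 : R) ^+ n) @ \oo --> 0.
  by apply: cvg_expr; rewrite ger0_norm ?invr_ge0// invf_lt1// ltr1n.
move=> /cvgrPdist_lt /(_ _ e0) [N _ /(_ N (leqnn N))] /=.
rewrite sub0r normrN ger0_norm ?exprn_ge0 ?invr_ge0// => h.
by exists N; exact: le_trans (hump_scale_geom N) (ltW h).
Qed.

(** Telescoping: a far hump is at most K_j / 2, and K_j / 2 <= K_j - K_(j+1) because the scales at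
    least halve. *)
Lemma hump_tail_far n m z : nc z <= 1 -> K n <= nc (z - xi) ->
  nc (B (n + m)%N z - B n z) <= K n - K (n + m)%N.
Proof.
move=> z1 zn; elim: m => [|m IH]; first by rewrite addn0 !subrr nc0.
rewrite addnS hump_sumS addrAC; apply: le_trans (ncD _ _) _.
have := beta_far z1 (le_trans (hump_scale_mono n m) zn).
by move: IH (Khalf (n + m)%N); lra.
Qed.

(** The same telescoping when z is so close to [xi] that every hump in the range is in its near
    zone. *)
Lemma hump_tail_near n m z : nc z <= 1 -> nc (z - xi) < K (n + m)%N ->
  nc (B (n + m)%N z - B n z) <= K n - K (n + m)%N.
Proof.
move=> z1; elim: m => [|m IH]; first by rewrite addn0 !subrr nc0.
rewrite addnS => zn.
rewrite hump_sumS addrAC; apply: le_trans (ncD _ _) _.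
have := beta_near z1 zn; have := IH (lt_le_trans zn (hump_scale_decr _)).
by move: (Khalf (n + m)%N); lra.
Qed.

(* At any point at most one of the humps is not small. *)
Lemma hump_tail_bound n m z : nc z <= 1 ->
  nc (B (n + m)%N z - B n z) <= K n - K (n + m)%N + 2.
Proof.
move=> z1; elim: m => [|m IH]; first by rewrite addn0 !subrr nc0 add0r.
case: (ltP (nc (z - xi)) (K (n + m.+1)%N)) => zm.
  by have := hump_tail_near z1 zm; lra.
move: zm; rewrite addnS hump_sumS addrAC => zm; apply: le_trans (ncD _ _) _.
have [zm'|zm'] := ltP (nc (z - xi)) (K (n + m)%N).
  have := hump_tail_near z1 zm'; have := beta_le2 (n + m)%N z1.
  by move: (hump_scale_decr (n + m)%N); lra.
by have := beta_far z1 zm'; move: IH (Khalf (n + m)%N); lra.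
Qed.

Lemma hump_sum_xi n : B n xi = 0.
Proof. by rewrite /hump_sum big1. Qed.

(** All humps vanish at [xi]; any other point is far for all late humps, whose tails decay
    geometrically. *)
Lemma hump_sum_cvg z : nc z <= 1 -> exists l, clim \oo (B ^~ z) l.
Proof.
move=> z1; have [->|zxi] := eqVneq z xi.
  by exists 0 => e e0; exists 0%N => // n _ /=; rewrite hump_sum_xi subr0 nc0 ltW.
have r0 : 0 < nc (z - xi) by rewrite nc_gt0 ?subr_eq0.
have [N HN] := hump_scale_small r0.
(* The factor 2^N compensates 2^-n for the indices n < N, where only the uniform bound 3 is
   available. *)
apply: (@nc_geometric_cauchy _ _ (3 * 2 ^+ N) 2^-1); first by rewrite invr_ge0 ler0n invf_lt1// ltr1n.
move=> n m; have [nN|Nn] := ltnP n N.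
  apply: (@le_trans _ _ 3).
    apply: (le_trans (hump_tail_bound n m z1)).
    by have := Kgt0 (n + m)%N; have := hump_scale_mono 0 n; rewrite add0n K0; lra.
  rewrite -mulrA ler_peMr// -(subnKC (ltnW nN)) exprD mulrAC -exprMn divff// expr1n mul1r.
  by rewrite exprn_ege1// ler1n.
have nK : K n <= nc (z - xi) by apply: le_trans HN; rewrite -(subnKC Nn); exact: hump_scale_mono.
apply: (le_trans (hump_tail_far m z1 nK)); apply: (@le_trans _ _ (2^-1 ^+ n)).
  by have := Kgt0 (n + m)%N; have := hump_scale_geom n; lra.
rewrite ler_peMl ?exprn_ge0 ?invr_ge0//.
have : 1 <= (2 : R) ^+ N by rewrite exprn_ege1// ler1n.
by lra.
Qed.

Variable b : R[i] -> R[i].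
Hypothesis bE : forall z, nc z <= 1 -> clim \oo (B ^~ z) (b z).

Lemma hump_limit_le n z C : nc z <= 1 -> (forall m, nc (B (n + m)%N z - B n z) <= C) ->
  nc (b z - B n z) <= C.
Proof.
move=> z1 H; apply: (@clim_nc_le _ _ \oo _ (fun m => B m z - B n z)).
  by apply: climB; [exact: bE|exact: clim_cst].
by exists n => // m /= nm; rewrite -(subnKC nm); exact: H.
Qed.

Lemma hump_limit_far n z : nc z <= 1 -> K n <= nc (z - xi) -> nc (b z - B n z) <= K n.
Proof.
move=> z1 zn; apply: hump_limit_le => // m; apply: (le_trans (hump_tail_far m z1 zn)).
by rewrite gerBl ltW.
Qed.

Lemma hump_limit_tail n z : nc z <= 1 -> nc (b z - B n z) <= 3.
Proof.
move=> z1; apply: hump_limit_le => // m; apply: (le_trans (hump_tail_bound n m z1)).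
by have := Kgt0 (n + m)%N; have := hump_scale_mono 0 n; rewrite add0n K0; lra.
Qed.

Lemma hump_limit_le3 z : nc z <= 1 -> nc (b z) <= 3.
Proof. by move=> /(hump_limit_tail 0); rewrite /hump_sum big_ord0 subr0. Qed.

(** A disk of radius r < 1 keeps distance 1 - r from [xi], so the convergence is uniform on it. *)
Lemma hump_limit_hol : hol b.
Proof.
apply: hol_uniform => r /andP[r0 r1] e e0.
have m0 : 0 < Num.min (1 - r) e by rewrite lt_min subr_gt0 r1.
have [n] := hump_scale_small m0; rewrite le_min => /andP[n1 n2].
exists (B n) => [|z zr]; first exact/disk_algebra_hol/hump_sum_disk_algebra.
apply: le_trans n2; apply: hump_limit_far; first exact: le_trans zr (ltW r1).
apply: (le_trans n1); have := nc_subl xi z; rewrite nxi ncBC => h; apply: le_trans h.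
by rewrite lerD2l lerN2.
Qed.

(** Near a point of the circle other than [xi], [b] is uniformly approximated by sums from the disk
    algebra. *)
Lemma hump_limit_radial t : expi t != xi ->
  clim (1 : R)^'- (fun r => b (r%:C * expi t)) (b (expi t)).
Proof.
move=> txi e e0; have e3 : 0 < e / 3 by rewrite divr_gt0.
have x0 : 0 < nc (expi t - xi) by rewrite nc_gt0 ?subr_eq0.
pose m := Num.min (nc (expi t - xi) / 2) (e / 3).
have m0 : 0 < m by rewrite lt_min e3 divr_gt0.
have [n] := hump_scale_small m0; rewrite le_min => /andP[n1 n2].
have t1 : nc (expi t) <= 1 by rewrite nc_expi.
have [d d0 Hd] := disk_algebra_clim (hump_sum_disk_algebra n) t1 e3.
pose d' := Num.min d (Num.min 1 (nc (expi t - xi) / 2)).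
have d'0 : 0 < d' by rewrite !lt_min d0 ltr01 divr_gt0.
rewrite /at_left /within /=; apply/nbhs_ballP; exists d' => //= r.
rewrite /ball /= !lt_min => /and3P[rd r1 rx] rlt.
have rt : nc (r%:C * expi t - expi t) = `|1 - r|.
  by rewrite -[X in _ - X]mul1r -mulrBl ncM nc_expi mulr1 ncBC -[1]/((1 : R)%:C) -rmorphB ncC.
have r0 : 0 <= r by move: r1; rewrite ltr_norml; lra.
have z1 : nc (r%:C * expi t) <= 1 by rewrite ncM nc_expi mulr1 ncC ger0_norm// ltW.
have zx : nc (expi t - xi) / 2 <= nc (r%:C * expi t - xi).
  have := nc_triangle (expi t) xi (r%:C * expi t); rewrite (ncBC (expi t) (r%:C * expi t)) rt.
  by move: rx; lra.
have B1 := hump_limit_far z1 (le_trans n1 zx).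
have xx : K n <= nc (expi t - xi) by apply: (le_trans n1); rewrite ler_pdivrMr// ler_peMr ?nc_ge0// ler1n.
have B2 := hump_limit_far t1 xx.
have B3 := Hd (r%:C * expi t); rewrite rt in B3; have {}B3 := B3 rd z1.
have -> : b (r%:C * expi t) - b (expi t) = (b (r%:C * expi t) - B n (r%:C * expi t)) +
  (B n (r%:C * expi t) - B n (expi t)) - (b (expi t) - B n (expi t)) by ring.
apply: (le_trans (ncB _ _)); have := ncD (b (r%:C * expi t) - B n (r%:C * expi t)) (B n (r%:C * expi t) - B n (expi t)).
by move: B1 B2 B3 n2; rewrite /=; lra.
Qed.

End hump_series.

(** * Multiplications as Toeplitz operators *)

Section toeplitz.
Context {R : realType}.
Implicit Types (f b u v w : R[i] -> R[i]) (xi z : R[i]).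
Local Notation mu := (@lebesgue_measure R).

Lemma disk_algebra_circle_measurable b : disk_algebra b -> circle_measurable b.
Proof.
move=> db.
have bc (t e : R) : 0 < e -> \forall s \near t, nc (b (expi t) - b (expi s)) <= e.
  have t1 : nc (expi t) <= 1 by rewrite nc_expi.
  move=> e0; have [d d0 Hd] := disk_algebra_clim db t1 e0.
  have d2 : 0 < d / 2 by rewrite divr_gt0.
  apply/nbhs_ballP; exists (d / 2) => //= s; rewrite /ball /= => st.
  rewrite ncBC; apply: Hd; last by rewrite /= nc_expi.
  by apply: (le_lt_trans (expi_lip _ _)); rewrite distrC; move: st; lra.
split; apply: continuous_measurable_fun => t; apply/cvgrPdist_le => e e0; apply: filterS (bc t e e0) => s.
  by apply: le_trans; rewrite -creB nc_re.
by apply: le_trans; rewrite -cimB nc_im.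
Qed.

Lemma circle_measurable_clim (F : nat -> R[i] -> R[i]) b : (forall n, circle_measurable (F n)) ->
  (forall t : R, clim \oo (F ^~ (expi t)) (b (expi t))) -> circle_measurable b.
Proof.
move=> mF Fb; split.
  apply: (@measurable_fun_cvg _ _ _ _ (fun n t => cre (F n (expi t)))) => [n|t _].
    by have [] := mF n.
  apply/cvgrPdist_le => e e0; apply: filterS (Fb t e e0) => n /=.
  by apply: le_trans; rewrite -creB ncBC nc_re.
apply: (@measurable_fun_cvg _ _ _ _ (fun n t => cim (F n (expi t)))) => [n|t _].
  by have [] := mF n.
apply/cvgrPdist_le => e e0; apply: filterS (Fb t e e0) => n /=.
by apply: le_trans; rewrite -cimB ncBC nc_im.
Qed.

Lemma circle_measurableB u v : circle_measurable u -> circle_measurable v ->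
  circle_measurable (fun z => u z - v z).
Proof.
move=> [ur ui] [vr vi]; split.
  by under eq_fun do rewrite creB; exact: measurable_funB.
by under eq_fun do rewrite cimB; exact: measurable_funB.
Qed.

Lemma circle_measurableM u v : circle_measurable u -> circle_measurable v ->
  circle_measurable (fun z => u z * v z).
Proof.
move=> [ur ui] [vr vi]; split.
  by under eq_fun do rewrite creM; apply: measurable_funB; exact: measurable_funM.
by under eq_fun do rewrite cimM; apply: measurable_funD; exact: measurable_funM.
Qed.

Lemma circle_measurable_conj u : circle_measurable u -> circle_measurable (fun z => cj (u z)).
Proof.
move=> [ur ui]; split.
  by apply: (eq_measurable_fun _ _ ur) => t _ /=; case: (u _).
have := measurable_funN ui; apply: eq_measurable_fun => t _ /=; by case: (u _).
Qed.

Lemma circle_integral_ae0 F : circle_measurable F ->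
  {ae mu, forall t, `[0, 2 * pi]%classic t -> F (expi t) = 0} -> circle_integral F = 0.
Proof.
move=> [mr mi] F0.
have I0 (h : R -> R) : measurable_fun setT h ->
    {ae mu, forall t, `[0, 2 * pi]%classic t -> h t = 0} ->
    (\int[mu]_(t in `[0%R, (2 * pi)%R]) h t)%R = 0.
  move=> mh h0; rewrite /Rintegral.
  rewrite (@ae_eq_integral _ _ R mu _ (cst 0%E)) ?integral0//.
  - by apply/measurable_EFinP; exact: measurable_funTS.
  - by apply: (@filterS _ _ (ae_filter_ringOfSetsType mu)) h0 => t /= H /H ->.
rewrite /circle_integral /complex_integral !I0 ?mulr0//.
- by apply: (@filterS _ _ (ae_filter_ringOfSetsType mu)) F0 => t /= H /H ->.
- by apply: (@filterS _ _ (ae_filter_ringOfSetsType mu)) F0 => t /= H /H ->.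
Qed.

(** The cosine is injective on each half of [0, 2 pi], so each half contains at most one such
    angle. *)
Lemma expi_eq_negligible xi : mu.-negligible [set t | `[0, 2 * pi]%classic t /\ expi t = xi].
Proof.
have N1 (A : set R) : (forall s t, A s -> A t -> s = t) -> mu.-negligible A.
  move=> A1; have [[x Ax]|nA] := pselect (exists x, A x); last first.
    apply: negligibleS (negligible_set0 mu) => t At; exfalso; apply: nA; by exists t.
  apply: (@negligibleS _ _ _ mu [set x]); first by move=> t At; exact: A1.
  by apply/negligibleP; [exact: measurable_set1|exact: lebesgue_measure_set1].
have cE s t : expi s = expi t -> cos s = cos t by case.
apply: (@negligibleS _ _ _ mu ([set t | 0 <= t <= pi /\ expi t = xi] `|` [set t | pi <= t <= 2 * pi /\ expi t = xi])).
  move=> t [] /=; rewrite in_itv /= => /andP[t0 t1] tx.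
  by have [tp|/ltW tp] := leP t pi; [left|right]; split; rewrite // ?t0 ?t1 ?tp.
apply: negligibleU; apply: N1 => s t [/= s1 sx] [/= t1 tx].
  by apply: cos_inj; rewrite ?in_itv//=; apply: cE; rewrite sx tx.
have c2 x : cos (2 * pi - x) = cos x :> R.
  by rewrite addrC mulr_natl cosD2pi cosN.
suff : 2 * pi - s = 2 * pi - t by move/addrI/oppr_inj.
move: s1 t1 => /andP[s1 s2] /andP[t1 t2].
apply: cos_inj; rewrite ?in_itv/= ?subr_ge0 ?s2 ?t2 ?andTb; last by rewrite !c2; apply: cE; rewrite sx tx.
- by move: s1; lra.
- by move: t1; lra.
Qed.

Lemma H2_norm f : H2 f -> exists2 r : R, 0 <= r & h2norm f = r%:E.
Proof.
move=> [_ fin]; have n0 : (0 <= h2norm f)%E by exact: poweR_ge0.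
exists (fine (h2norm f)); first exact: fine_ge0.
by rewrite fineK// ge0_fin_numE.
Qed.

Variables (b : R[i] -> R[i]) (xi : R[i]).
Hypothesis mb : circle_measurable b.
Hypothesis hb : hol b.
Hypothesis b3 : forall z, nc z <= 1 -> nc (b z) <= 3.
Hypothesis b_radial : forall t, expi t != xi ->
  clim (1 : R)^'- (fun r => b (r%:C * expi t)) (b (expi t)).

Lemma hn_mul3 f A : hol f -> 0 <= A -> hn f A -> hn (fun z => b z * f z) (3 * A).
Proof.
move=> hf A0 fA; apply: hn_le fA => // [||z z1].
- by apply: hol_dcont; exact: holM.
- exact: hol_dcont.
- by rewrite ncM ler_wpM2r ?nc_ge0// b3// ltW.
Qed.

Lemma mul_bounded : bounded_operators (fun f z => b z * f z).
Proof.
split.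
- move=> f /H2P[hf [A A0 fA]]; apply/H2P; split; first exact: holM.
  by exists (3 * A); [rewrite mulr_gt0|exact: hn_mul3 (ltW A0) fA].
- by move=> c f h _ _ z _; rewrite mulrDr mulrCA.
- exists 3 => f Hf; have [r r0 fr] := H2_norm Hf; have /H2P[hf _] := Hf.
  by rewrite fr -EFinM; apply: hn_mul3 => //; rewrite /hn fr.
Qed.

(** For a holomorphic symbol no projection takes place: b f is in H^2 and its radial limits are b u
    almost everywhere, so the function to be shown orthogonal to H^2 vanishes almost everywhere. *)
Lemma mul_toeplitz : toeplitz_algebra (fun f z => b z * f z).
Proof.
move=> A _ gen; apply: (gen b).
- by split=> //; exists 3; apply: (@nearW _ _ _ (ae_filter_ringOfSetsType mu)) => t; rewrite b3 ?nc_expi.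
- split; first exact: mul_bounded.
  move=> f u Hf fu; split; first by have [H _ _] := mul_bounded; exact: H.
  move=> w bw f' v Hf' fv; apply: circle_integral_ae0.
    change (circle_measurable (fun z => (b z * u z - w z) * cj (v z))).
    apply: circle_measurableM; last by apply: circle_measurable_conj; case: fv.
    by apply: circle_measurableB; [apply: circle_measurableM => //; case: fu|case: bw].
  have [_ fu'] := fu; have [_ bw'] := bw.
  (* Radial limits of [b] are known only off [xi], which corresponds to a null set of angles. *)
  have xi0 : {ae mu, forall t, `[0, 2 * pi]%classic t -> expi t != xi}.
    apply: negligibleS (expi_eq_negligible xi) => t /= /not_implyP[t1 /negP/negPn/eqP tx].
    by split.
  apply: (@filterS3 _ _ (ae_filter_ringOfSetsType mu)) fu' bw' xi0 => t ft bt tx t1.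
  suff -> : w (expi t) = b (expi t) * u (expi t) by rewrite subrr mul0r.
  have ft' : clim (1 : R)^'- (fun r => f (r%:C * expi t)) (u (expi t)).
    exact ((cvg_clim (fun r => f (r%:C * expi t)) (u (expi t))).1 ft).
  have bt' : clim (1 : R)^'- (fun r => b (r%:C * expi t) * f (r%:C * expi t)) (w (expi t)).
    exact ((cvg_clim (fun r => b (r%:C * expi t) * f (r%:C * expi t)) (w (expi t))).1 bt).
  apply: clim_unique bt' _; apply: climM ft'; exact: b_radial (tx t1).
Qed.

End toeplitz.

(** * Choice of the test functions, pointwise decay, and the sequence of humps *)

Section sliding_hump.
Context {R : realType}.
Implicit Types (f b : R[i] -> R[i]) (z w : R[i]).

Lemma bounded_operators_hn (T : operator) : bounded_operators T -> exists2 M : R, 0 < M &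
  forall f A, hol f -> 0 < A -> hn f A -> hn (T f) (M * A).
Proof.
move=> [_ _ [M1 HM]]; exists (Num.max M1 1); first by rewrite lt_max ltr01 orbT.
move=> f A hf A0 fA; have Hf : H2 f by apply/H2P; split=> //; exists A.
have [r r0 fr] := H2_norm Hf; have := HM f Hf.
rewrite /hn fr -EFinM in fA * => h; apply: (le_trans h); rewrite lee_fin.
apply: (@le_trans _ _ (Num.max M1 1 * r)); first by rewrite ler_wpM2r// le_max lexx.
by rewrite ler_wpM2l// le_max ler01 orbT.
Qed.

(** On the disk of radius |z| a flat f is uniformly small, and the value of [V] at z depends only on
    this disk. It identifies the limit of the commutators as 0. *)
Lemma comm_pointwise g b z e : hol g -> hol b -> (forall w, nc w < 1 -> nc (b w) <= 3) -> nc z < 1 -> 0 < e ->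
  exists2 kappa, 0 < kappa & forall f, hol f ->
    (forall w, nc w < 1 -> nc (f w) * (1 - nc w) <= kappa) -> nc (comm g b f z) <= e.
Proof.
move=> hg hb b3 z1 e0; pose r := (1 + nc z) / 2.
have z0 := nc_ge0 z.
have r01 : 0 < r < 1 by rewrite /r; apply/andP; split; lra.
have zr : nc z <= r by rewrite /r; lra.
have [G G0 HG] := hol_bounded (cderiv_hol hg) r01.
have s0 : 0 < 1 - nc z by rewrite subr_gt0.
(* With |f| <= k and |g'| <= G the two terms of the commutator are at most 6 k G each. *)
exists (e * (1 - nc z) / (12 * G)); first by rewrite divr_gt0 ?mulr_gt0.
move=> f hf ff; pose k := e / (12 * G).
have k0 : 0 <= k by rewrite divr_ge0 ?mulr_ge0 ?(ltW e0) ?(ltW G0).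
have fk w : nc w <= nc z -> nc (f w) <= k.
  move=> wz; have w1 := le_lt_trans wz z1; have w0 : 0 < 1 - nc w by rewrite subr_gt0.
  rewrite -(ler_pM2r w0); apply: (le_trans (ff w w1)).
  rewrite mulrAC -/k ler_wpM2l//; lra.
have fgk w : nc w <= nc z -> nc (f w * cderiv g w) <= k * G.
  by move=> wz; rewrite ncM ler_pM ?nc_ge0 ?fk// HG// (le_trans wz).
have B1 : nc (volterra g (fun w => b w * f w) z) <= 2 * (3 * (k * G)).
  apply: volterra_bound => // [|w wz]; first exact: holM.
  rewrite -mulrA ncM ler_pM ?nc_ge0 ?fgk// b3//; exact: le_lt_trans wz z1.
have B2 : nc (volterra g f z) <= 2 * (k * G) by exact: volterra_bound.
have B3 : nc (b z * volterra g f z) <= 3 * (2 * (k * G)) by rewrite ncM ler_pM ?nc_ge0// b3.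
apply: (le_trans (ncB _ _)); apply: (le_trans (lerD B1 B3)).
rewrite le_eqVlt; apply/orP; left; apply/eqP; rewrite /k; field; rewrite gt_eqF//.
Qed.

(** Contraposition: if for each level all short arcs passed the test, [mean_oscillation_le] would
    put the boundary function [u] of [g] in VMO. *)
Lemma not_VMOA_test_functions g : (BMOA `\` VMOA) g -> exists2 c0 : R, 0 < c0 &
  forall e, 0 < e -> exists a d, [/\ 0 < d, d < e &
    ~ hn (fun z => peak (expi a) d z * volterra g (test_fun a d) z) c0].
Proof.
move=> [[Hg [u gu bu]] nV].
have /H2P[hg _] := Hg.
apply: contrapT => nc0; apply: nV; split=> //; exists u => //; split=> // e e0.
pose C := 3 * (72 + 16 * pi) : R.
have C0 : 0 < C by rewrite mulr_gt0// ltr_wpDr// mulr_ge0// pi_ge0.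
have k0 : 0 < e / C by rewrite divr_gt0.
apply: contrapT => ne; apply: nc0; exists (e / C) => // h h0.
apply: contrapT => nad; apply: ne.
(* The oscillation estimate is available for arcs of length at most 1. *)
exists (Num.min 1 h) => [|a d /andP[d0 d2]]; first by rewrite lt_min ltr01.
rewrite lt_min => /andP[d1 dh].
rewrite (_ : e = 3 * ((72 + 16 * pi) * (e / C))); last first.
  by rewrite mulrA -/C mulrC divfK// gt_eqF.
apply: (mean_oscillation_le hg gu) => //; first exact: ltW.
apply: contrapT => nh; apply: nad; exists a, d; split=> //.
Qed.

Section hump_sequence.
Variables (g : R[i] -> R[i]) (M c0 : R) (xi : R[i]).
Hypothesis hg : hol g.
Hypothesis M0 : 0 < M.
Hypothesis HV : forall f A, hol f -> 0 < A -> hn f A -> hn (volterra g f) (M * A).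
Hypothesis c00 : 0 < c0.
Hypothesis nxi : nc xi = 1.
Hypothesis bad : forall e, 0 < e -> exists a d, [/\ 0 < d, d < e, nc (expi a - xi) <= e &
  ~ hn (fun z => peak (expi a) d z * volterra g (test_fun a d) z) c0].

(** Dependent recursion on the pair formed by the scale and the sum of the previous humps, from
    which [hump_exists] produces the next hump and scale. *)
Lemma hump_sequence : exists (K : nat -> R) (f beta : nat -> R[i] -> R[i]), K 0%N = 1 /\
  forall n, 0 < K n /\ hump g c0 xi (K n) (hump_sum beta n) (f n) (beta n) (K n.+1).
Proof.
have /choice[F HF] : forall s : R * (R[i] -> R[i]), exists o : ((R[i] -> R[i]) * (R[i] -> R[i])) * R,
    0 < s.1 -> disk_algebra s.2 -> hump g c0 xi s.1 s.2 o.1.1 o.1.2 o.2.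
  move=> [k B]; have [[k0 dB]|n] := pselect (0 < k /\ disk_algebra B).
    have [f [beta [k' H]]] := hump_exists hg M0 HV c00 nxi bad k0 dB.
    by exists ((f, beta), k').
  (* Arbitrary value for states that do not occur in the recursion. *)
  by exists ((id, id), 0) => /= h1 h2; exfalso; apply: n.
pose st n := iter n (fun s : R * (R[i] -> R[i]) => ((F s).2, fun z => s.2 z + (F s).1.2 z)) (1, fun=> 0).
pose K n := (st n).1; pose f n := (F (st n)).1.1; pose beta n := (F (st n)).1.2.
have stE n : (st n).2 = hump_sum beta n.
  elim: n => [|n IH]; apply/funext => z; first by rewrite /hump_sum big_ord0.
  by rewrite hump_sumS -IH.
have ok n : 0 < (st n).1 /\ disk_algebra (st n).2.
  elim: n => [|n [IH1 IH2]]; first by split; [exact: ltr01|exact: disk_algebra_cst].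
  have H := HF (st n) IH1 IH2; split; first exact: hump_gt0 H.
  exact: disk_algebraD IH2 (hump_disk_algebra H).
exists K, f, beta; split=> // n; have [h1 h2] := ok n; split=> //.
by rewrite -stE; exact: HF.
Qed.

End hump_sequence.
End sliding_hump.

Theorem corollary4p4 (R : realType) (g : R[i] -> R[i])
    (hg : (BMOA `\` VMOA) g) :
  ~ essential_commutator toeplitz_algebra (volterra g).
Proof.
move=> [Vbdd Vcpt].
have [c0 c00 Hc0] := not_VMOA_test_functions hg.
have {hg}/H2P[hg _] : H2 g by case: hg => -[].
have [M M0 HV] := bounded_operators_hn Vbdd.
have [xi nxi Hxi] := circle_cluster Hc0.
have [K [f [beta [K0 HK]]]] := hump_sequence hg M0 HV c00 nxi Hxi.
have Kgt0 n : 0 < K n by have [] := HK n.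
have H n : hump g c0 xi (K n) (hump_sum beta n) (f n) (beta n) (K n.+1) by have [] := HK n.
have Khalf n := hump_half (H n); have dbeta n := hump_disk_algebra (H n).
have bxi n := hump_xi (H n).
have ble2 n := hump_le2 (H n); have bfar n := hump_far (H n); have bnear n := hump_near (H n).
(* The limit is taken on the closed disk, so that the same [b] provides both the holomorphic
   function and the symbol on the circle. *)
have /choice[b Hb] : forall z : R[i], exists l, nc z <= 1 -> clim \oo (hump_sum beta ^~ z) l.
  move=> z; have [z1|nz] := pselect (nc z <= 1); last by exists 0 => /nz.
  by have [l Hl] := hump_sum_cvg K0 Kgt0 Khalf bxi ble2 bfar bnear z1; exists l.
have hb : hol b := hump_limit_hol nxi K0 Kgt0 Khalf dbeta bfar Hb.
have b3 z : nc z <= 1 -> nc (b z) <= 3 := hump_limit_le3 K0 Kgt0 Khalf ble2 bfar bnear Hb (z := z).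
have b3' z : nc z < 1 -> nc (b z) <= 3 by move=> /ltW; exact: b3.
have mb : circle_measurable b.
  apply: (circle_measurable_clim (F := hump_sum beta)) => [n|t]; last by apply: Hb; rewrite nc_expi.
  exact/disk_algebra_circle_measurable/hump_sum_disk_algebra.
have brad t : expi t != xi -> clim (1 : R)^'- (fun r => b (r%:C * expi t)) (b (expi t)) :=
  hump_limit_radial K0 Kgt0 Khalf dbeta bfar Hb (t := t).
(* Multiplication by [b] is in the Toeplitz algebra, so its commutator is compact; this is applied
   to the bounded sequence [f]. *)
have [_ /(_ f)] := Vcpt _ (mul_toeplitz mb hb b3 brad).
have hf n := hump_hol (H n); have f1 n := hump_hn (H n); have ff n := hump_flat (H n).
case=> [n||s [h [smono Hh conv]]].
- by apply/H2P; split=> //; exists 1.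
- by exists 1.
have hh : hol h by case/H2P: Hh.
have hc n : hol (comm g b (f n)) by exact: comm_hol.
have small e : 0 < e -> \forall n \near \oo, hn (fun z => comm g b (f (s n)) z - h z) e.
  move=> e0; have ne : nbhs (0%E : \bar R) (fun x => (x < e%:E)%E) by apply: open_ereal_lt'; rewrite lte_fin.
  by have [N _ HN] := conv _ ne; exists N => // n Nn; apply: ltW; exact: HN Nn.
have sn n : (n <= s n)%N.
  elim: n => // n IH; exact: leq_ltn_trans IH (smono _ _ (ltnSn n)).
have pointwise z e : nc z < 1 -> 0 < e -> \forall n \near \oo, nc (comm g b (f (s n)) z) <= e.
  move=> z1 e0; have [k k0 Hk] := comm_pointwise hg hb b3' z1 e0.
  have [N HN] := hump_scale_small K0 Khalf k0.
  exists N => // n /= Nn; apply: Hk => // w w1; apply: (le_trans (ff _ w w1)).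
  apply: le_trans HN; rewrite -(subnKC (leq_trans Nn (sn n))); exact: hump_scale_mono.
have h0 z : nc z < 1 -> h z = 0.
  move=> z1; apply: nc_eq0.
  have [x0|] := ltP 0 (nc (h z)); last by move=> x0; apply/le_anti; rewrite x0 nc_ge0.
  (* At this norm distance [hn_point] gives a distance at most |h(z)| / 4 at the point z. *)
  have e0 : 0 < nc (h z) / 4 * (1 - nc z) by rewrite mulr_gt0 ?subr_gt0// divr_gt0.
  have x4 : 0 < nc (h z) / 4 by rewrite divr_gt0.
  have [N _ HN] := filterI (small _ e0) (pointwise z _ z1 x4).
  have [HN1 HN2] := HN N (leqnn N).
  have hz := hn_point (holB (hc (s N)) hh) e0 HN1 z1.
  have d0 : 0 < 1 - nc z by rewrite subr_gt0.
  have d1 : 1 - nc z <= 1 by rewrite gerBl nc_ge0.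
  have le4 : nc (comm g b (f (s N)) z - h z) <= nc (h z) / 4.
    rewrite -ler_sqr ?nnegrE ?nc_ge0 ?(ltW x4)// -(ler_pM2r d0); apply: (le_trans hz).
    by rewrite exprMn ler_wpM2l ?sqr_ge0// expr2 ger_pMl.
  have := nc_subl (h z) (comm g b (f (s N)) z); rewrite ncBC.
  by move: le4 HN2 x0; rewrite /=; lra.
have c100 : 0 < c0 / 100 by rewrite divr_gt0.
(* A single late index j now suffices: [b] splits into the humps before j, the hump j, and the
   tail. *)
have [N _ HN] := small _ c100; have := HN N (leqnn N); move: (s N) => j /= Hj.
have {}Hj : hn (comm g b (f j)) (c0 / 100).
  by apply: hn_ext Hj => z z1; rewrite h0// subr0.
have hB n : hol (hump_sum beta n) by apply: disk_algebra_hol; exact: hump_sum_disk_algebra.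
have hbeta n : hol (beta n) by exact: disk_algebra_hol.
have hT : hol (fun z => b z - hump_sum beta j.+1 z) by exact: holB.
have Ha : hn (comm g (fun z => b z - hump_sum beta j.+1 z) (f j)) (c0 / 100).
  apply: (hump_after (H j)) => // z z1.
    exact: (hump_limit_tail K0 Kgt0 Khalf ble2 bfar bnear Hb j.+1 (ltW z1)).
  by move=> zk; exact: (hump_limit_far Kgt0 Khalf bfar Hb (ltW z1) zk).
apply: (hump_now (H j)).
have c1 := ltW c100; have c2 : 0 <= 2 * (c0 / 100 + c0 / 100) by rewrite mulr_ge0// addr_ge0.
have hcB := comm_hol hg (hB j) (hf j); have hcT := comm_hol hg hT (hf j).
(* The commutator with hump j is the total minus the two other parts, each at most c0 / 100; the
   losses give 2 (2 (1/100 + 1/100) + 1/100) = 1/10. *)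
have := hnB (holB (hc j) hcB) hcT c2 c1 (hnB (hc j) hcB c1 c1 Hj (hump_before (H j))) Ha.
rewrite (_ : 2 * (2 * (c0 / 100 + c0 / 100) + c0 / 100) = c0 / 10); last by field.
apply: hn_ext => z z1.
have E1 : comm g b (f j) z = comm g (hump_sum beta j.+1) (f j) z +
    comm g (fun w => b w - hump_sum beta j.+1 w) (f j) z.
  by rewrite -commD//; apply: comm_ext => // w _; rewrite addrC subrK.
have E2 : comm g (hump_sum beta j.+1) (f j) z = comm g (hump_sum beta j) (f j) z + comm g (beta j) (f j) z.
  by rewrite -commD//; apply: comm_ext => // w _; rewrite hump_sumS.
by rewrite E1 E2 addrAC addrK [X in X - _]addrC addrK.
Qed.
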